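(* Let $\mathcal{D}\subset\mathcal{M}$ be an inclusion of von Neumann algebras. Let $\omega$ be a normal state on $\mathcal{M}$ such that $\omega(ax)=\omega(xa)$ for every $a\in\mathcal{D}$, $x\in\mathcal{M}$, and let $z$ be the support projection in $\mathcal{D}$ of $\omega_{|\mathcal{D}}$. There is a bijective correspondence between surjective normal idempotent contractive $\mathcal{D}$-module maps $E:\mathcal{M}\to\mathcal{D}z$ with $\mathrm{supp}(E)\le z$, and extensions of $\omega_{|\mathcal{D}}$ to normal states $\rho$ on all of $\mathcal{M}$ which have $\mathcal{D}$ in the centralizer (that is, $\rho(dx)=\rho(xd)$ for all $d\in\mathcal{D}$, $x\in\mathcal{M}$). Under this correspondence, the support projections of $E$ and $\rho$ in $\mathcal{M}$ are the same, and $\rho=\rho\circ E=\omega\circ E$. Also, such maps $E$ are completely positive.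
   Context: The inclusion $\mathcal{D}\subset\mathcal{M}$ is unital. The support projection of a normal state is the complement of the largest projection on which it vanishes (taken in $\mathcal{D}$ for $\omega_{|\mathcal{D}}$, in $\mathcal{M}$ for $\rho$). For a normal positive map $E$ on $\mathcal{M}$, $\mathrm{supp}(E)$ is the complement of the largest projection $p\in\mathcal{M}$ with $E(p)=0$. Normal means weak* continuous. A $\mathcal{D}$-module map is a linear map with $E(dx)=dE(x)$ and $E(xd)=E(x)d$ for $d\in\mathcal{D}$, $x\in\mathcal{M}$. *)

(* Defs.v *)
From HB Require Import structures.
From mathcomp Require Import all_boot all_order all_algebra complex sesquilinear.
From mathcomp Require Import all_classical all_reals all_analysis.

Set Implicit Arguments.
Unset Strict Implicit.
Unset Printing Implicit Defensive.

Import Order.TTheory GRing.Theory Num.Theory numFieldNormedType.Exports.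

Local Open Scope classical_set_scope.
Local Open Scope complex_scope.
Local Open Scope ring_scope.

(* The complex numbers R[i], packaged so that the norm topology which the
   library puts on every numClosedFieldType applies to them. *)
Definition Cplx (R : realType) : numClosedFieldType := R[i].

(* A complex Hilbert space is a complete normed space H over Cplx R with an inner
   product dot (linear in its first argument) satisfying dot u u = `|u| ^+ 2;
   that last identity is a hypothesis of the theorem.  Operators on H are plain
   functions H -> H, with pointwise linear structure and \o as product, and a
   von Neumann algebra on H is a set of operators. *)
Section VonNeumannAlgebras.
Context (R : realType) (H : completeNormedModType (Cplx R)).
Context (dot : {dot H for Num.conj}).
Local Notation C := (Cplx R).

Implicit Types (x y p : H -> H) (S M D : set (H -> H)).

Definition bounded_by x (c : R) := 0 <= c /\ forall u, `|x u| <= (c%:C : C) * `|u|.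

Definition bounded_operator x := linear x /\ exists c, bounded_by x c.

Definition opnorm x : R := inf [set c | bounded_by x c].

Definition is_adjoint x y := forall u v, dot (x u) v = dot u (y v).

Definition op_ge0 x := forall u, 0 <= dot (x u) u.

Definition op_le x y := op_ge0 (y - x).

Definition projection p := p \o p = p /\ is_adjoint p p.

Definition commutant S : set (H -> H) :=
  [set y | bounded_operator y /\ forall x, S x -> x \o y = y \o x].

(* A commutant is always a linear space containing the identity and closed
   under products, so the unital algebra operations need not be listed. *)
Record von_neumann_algebra M : Prop := {
  vna_star : forall x, M x -> exists2 y, M y & is_adjoint x y;
  vna_bicommutant : commutant (commutant M) = M }.

(* The weak* topology of a von Neumann algebra M on H: its predual consists of
   the functionals x |-> \sum_n <x (xi n), eta n> with xi and eta square
   summable, and the topology is the initial topology on M for all of these.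
   It is set up here on all functions H -> H and then restricted to M by
   {within M, continuous _}. *)
Definition square_summable (xi : nat -> H) :=
  cvgn (series (fun n => `|xi n| ^+ 2)).

Definition predual_index : Type :=
  {q : (nat -> H) * (nat -> H) | square_summable q.1 /\ square_summable q.2}.

Definition predual_eval x : {ptws predual_index -> C} :=
  fun q => limn (series (fun n => dot (x ((sval q).1 n)) ((sval q).2 n))).

Definition weakstar := initial_topology predual_eval.

Definition normal_functional M (f : (H -> H) -> C) :=
  {within (M : set weakstar), continuous (f : weakstar -> C)}.

Definition normal_map M (E : (H -> H) -> (H -> H)) :=
  {within (M : set weakstar), continuous (E : weakstar -> weakstar)}.

Record normal_state M (rho : (H -> H) -> C) : Prop := {
  state_linear : forall (a : C) x y, M x -> M y ->
    rho (a *: x + y) = a * rho x + rho y;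
  state_ge0 : forall x, M x -> op_ge0 x -> 0 <= rho x;
  state_unit : rho idfun = 1;
  state_normal : normal_functional M rho }.

Definition in_centralizer D M (rho : (H -> H) -> C) :=
  forall d x, D d -> M x -> rho (d \o x) = rho (x \o d).

(* s is the complement of the largest projection p of M with f p = 0. *)
Definition is_support (V : zmodType) M (f : (H -> H) -> V) (s : H -> H) :=
  [/\ M s, projection s, f (idfun - s) = 0 &
      forall p, M p -> projection p -> f p = 0 -> op_le p (idfun - s)].

(* A map with domain M is represented by its extension by 0 to all functions
   H -> H, so that maps on M are equal iff their representatives are. *)
Definition vanishes_off (V : zmodType) M (f : (H -> H) -> V) :=
  forall x, ~ M x -> f x = 0.

Record module_expectation M D (z : H -> H) (E : (H -> H) -> (H -> H)) : Prop := {
  me_dom : vanishes_off M E;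
  me_image : E @` M = [set d \o z | d in D];
  me_linear : forall (a : C) x y, M x -> M y ->
    E (a *: x + y) = a *: E x + E y;
  me_modl : forall d x, D d -> M x -> E (d \o x) = d \o E x;
  me_modr : forall d x, D d -> M x -> E (x \o d) = E x \o d;
  me_normal : normal_map M E;
  me_idem : forall x, M x -> E (E x) = E x;
  me_contractive : forall x, M x -> opnorm (E x) <= opnorm x;
  me_support : exists2 s, is_support M E s & op_le s z }.

Record centralizing_extension M D (omega rho : (H -> H) -> C) : Prop := {
  ce_dom : vanishes_off M rho;
  ce_state : normal_state M rho;
  ce_extends : forall d, D d -> rho d = omega d;
  ce_centralizer : in_centralizer D M rho }.

(* An n x n matrix over M acts on H^n; X is positive as an operator there. *)
Definition matrix_ge0 n (X : 'M[H -> H]_n) :=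
  forall u : 'I_n -> H, 0 <= \sum_i \sum_j dot (X i j (u j)) (u i).

Definition completely_positive M (E : (H -> H) -> (H -> H)) :=
  forall n (X : 'M[H -> H]_n), (forall i j, M (X i j)) ->
    matrix_ge0 X -> matrix_ge0 (map_mx E X).

End VonNeumannAlgebras.

(* Main.v *)
(* Write Phi E = omega o E.  If E is a contractive D-module projection onto D z,
   then E 1 = z, E is positive, and omega o E is a normal state centralized by D;
   it determines E because omega is faithful on D z.  Complete positivity is
   positivity tested on D-cyclic subspaces, whose projections commute with D.

   Conversely, let rho extend omega on D with D in its centralizer.  For
   0 <= x <= 1 in M, minimize omega(k^2) - 2 Re rho(k x) over k in D with
   0 <= k <= 1.  The minimum is attained since omega is given by a square-summable
   sequence of vectors, and the Euler inequality together with the trace property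
   shows rho(d x) = omega(d h) for the minimizer h and all d in D.  Then
   E x = h z extends linearly to M.  The Schwarz inequality for E gives
   contractivity, and together with the vector sequences implementing omega and
   rho it bounds |E(y) u|^2 by a vector functional of y, whence E is normal. *)
Require Import Defs.
From HB Require Import structures.
From mathcomp Require Import all_boot all_order all_algebra complex sesquilinear.
From mathcomp Require Import all_classical all_reals all_analysis.
From mathcomp Require Import ring lra.
Import Order.TTheory GRing.Theory Num.Theory numFieldNormedType.Exports.
Local Open Scope classical_set_scope.
Local Open Scope complex_scope.
Local Open Scope ring_scope.

Set Implicit Arguments.
Unset Strict Implicit.
Unset Printing Implicit Defensive.

(** * Complex numbers and limits *)

(** Three obstacles shape the proof. [D] need not be complete in the norm of [omega], but its
    operator interval from 0 to 1 is, which is why the minimization takes place there. Without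
    functional calculus, the directions that stay in the interval are produced algebraically, as
    [h b h] and [(1 - h) b (1 - h)], and powers of [1 - h] replace spectral projections. The vectors
    [s k] implementing [omega] need not span the range of [z], so what is known on them is
    transported by one device: a closed subspace that contains every [s k] and is invariant under
    the commutant of [D] contains the range of [z]. This yields faithfulness, completeness of the
    interval and the domination behind normality. For the last, the subspace of dominated vectors
    has to be closed, and this needs dominating sequences of total mass at most the squared norm of
    the vector; the exact representation of positive normal functionals by vector sequences provides
    them. *)

Section ComplexParts.
Context (R : realType).
Local Notation C := (Cplx R).
Implicit Types (a b : C) (c : R).

Definition re a : R := complex.Re a.
Definition im a : R := complex.Im a.
Definition cplx c : C := c%:C.
Definition sqn a : R := re a ^+ 2 + im a ^+ 2.

Lemma reD a b : re (a + b) = re a + re b. Proof. by case: a; case: b. Qed.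
Lemma imD a b : im (a + b) = im a + im b. Proof. by case: a; case: b. Qed.
Lemma reN a : re (- a) = - re a. Proof. by case: a. Qed.
Lemma imN a : im (- a) = - im a. Proof. by case: a. Qed.
Lemma reB a b : re (a - b) = re a - re b. Proof. by rewrite reD reN. Qed.
Lemma imB a b : im (a - b) = im a - im b. Proof. by rewrite imD imN. Qed.
Lemma reM a b : re (a * b) = re a * re b - im a * im b.
Proof. by case: a; case: b. Qed.
Lemma imM a b : im (a * b) = re a * im b + im a * re b.
Proof. by case: a; case: b => *; rewrite /= addrC. Qed.
Lemma reJ a : re a^* = re a. Proof. by case: a. Qed.
Lemma imJ a : im a^* = - im a. Proof. by case: a. Qed.
Lemma re_cplx c : re (cplx c) = c. Proof. by []. Qed.
Lemma im_cplx c : im (cplx c) = 0. Proof. by []. Qed.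
Lemma re0 : re 0 = 0. Proof. by []. Qed.
Lemma im0 : im 0 = 0. Proof. by []. Qed.
Lemma re1 : re 1 = 1. Proof. by []. Qed.
Lemma im1 : im 1 = 0. Proof. by []. Qed.

Lemma cplx_eq a b : re a = re b -> im a = im b -> a = b.
Proof. by case: a => ? ?; case: b => ? ? /= -> ->. Qed.

Lemma cplx_le a b : (a <= b) = (im b == im a) && (re a <= re b).
Proof. exact: lecE. Qed.

Lemma cplx_ge0P a : 0 <= a <-> im a = 0 /\ 0 <= re a.
Proof.
rewrite cplx_le; split => [/andP[/eqP -> ->]//|[-> ->]].
by rewrite eqxx.
Qed.

Lemma cplx_re a : im a = 0 -> a = cplx (re a).
Proof. by move=> a0; apply: cplx_eq. Qed.

Lemma sqn_norm a : cplx (sqn a) = `|a| ^+ 2.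
Proof. exact: add_Re2_Im2. Qed.

Lemma sqn_ge0 a : 0 <= sqn a.
Proof. by rewrite addr_ge0// sqr_ge0. Qed.

Lemma sqn_eq0 a : sqn a <= 0 -> a = 0.
Proof.
rewrite /sqn => a0; have h1 := sqr_ge0 (re a); have h2 := sqr_ge0 (im a).
by apply: cplx_eq; apply/eqP; rewrite -sqrf_eq0 eq_le; apply/andP; split;
  rewrite ?re0 ?im0 ?sqr_ge0//; lra.
Qed.

Lemma cplx_le_cplx (a b : R) : (cplx a <= cplx b) = (a <= b).
Proof. by rewrite cplx_le eqxx. Qed.

Lemma cplx_gt0 (a : Cplx R) : 0 < a -> a = cplx (re a) /\ 0 < re a.
Proof.
rewrite lt0r => /andP[a0 /cplx_ge0P[h1 h2]]; split; first exact: cplx_re.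
rewrite lt0r h2 andbT; apply: contraNN a0 => /eqP h.
by apply/eqP/cplx_eq.
Qed.

End ComplexParts.

Definition ev (P : nat -> Prop) := exists N, forall n, (N <= n)%N -> P n.

Lemma evI (P Q : nat -> Prop) : ev P -> ev Q -> ev (fun n => P n /\ Q n).
Proof.
move=> [N PN] [N' QN]; exists (maxn N N') => n; rewrite geq_max => /andP[? ?].
by split; [exact: PN|exact: QN].
Qed.

Lemma evW (P Q : nat -> Prop) : (forall n, P n -> Q n) -> ev P -> ev Q.
Proof. by move=> PQ [N PN]; exists N => n /PN/PQ. Qed.

Lemma ev_ex (P : nat -> Prop) : ev P -> exists n, P n.
Proof. by move=> [N PN]; exists N; exact: PN. Qed.

Lemma ev_small (R : realType) (e : R) : 0 < e -> ev (fun n => n.+1%:R^-1 <= e).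
Proof.
move=> e0; exists (Num.truncn e^-1) => n nN.
rewrite -[leRHS]invrK lef_pV2 ?posrE ?invr_gt0//.
apply: ltW; apply: lt_le_trans (truncnS_gt _) _.
by rewrite ler_nat.
Qed.

Lemma ler_addeps (R : realType) (a b c : R) :
  0 <= c -> (forall e : R, 0 < e -> a <= b + c * e) -> a <= b.
Proof.
move=> c0 H; rewrite leNgt; apply/negP => ba.
have c1 : 0 < c + 1 by lra.
have := H ((a - b) / (c + 1) / 2).
have -> : c * ((a - b) / (c + 1) / 2) = (a - b) / 2 - (a - b) / (c + 1) / 2.
  by field; lra.
have h : 0 < (a - b) / (c + 1) / 2 by rewrite !divr_gt0// subr_gt0.
move=> /(_ h); lra.
Qed.

Section ComplexLimits.
Context (R : realType).
Local Notation C := (Cplx R).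
Implicit Types (u v : nat -> C) (a b : C).

(** Distances are squared moduli in [R], so that convergence proofs become polynomial inequalities
    over the reals; [cvCP] compares with the topological notion. *)
Definition cvC u a :=
  forall e : R, 0 < e -> ev (fun n => sqn (u n - a) <= e).

Lemma sqnD (a b : C) : sqn (a + b) <= 2 * sqn a + 2 * sqn b.
Proof.
rewrite /sqn !reD !imD.
have := sqr_ge0 (re a - re b); have := sqr_ge0 (im a - im b); nra.
Qed.

Lemma sqnN (a : C) : sqn (- a) = sqn a.
Proof. by rewrite /sqn reN imN !sqrrN. Qed.

Lemma sqnB (a b : C) : sqn (a - b) = sqn (b - a).
Proof. by rewrite -sqnN opprB. Qed.

Lemma sqnM (a b : C) : sqn (a * b) = sqn a * sqn b.
Proof. by rewrite /sqn reM imM; ring. Qed.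

Lemma sqnJ (a : C) : sqn a^* = sqn a.
Proof. by rewrite /sqn reJ imJ sqrrN. Qed.

Lemma sqn_cplx (c : R) : sqn (cplx c) = c ^+ 2.
Proof. by rewrite /sqn re_cplx im_cplx expr0n addr0. Qed.

Lemma sqn_re (a : C) : re a ^+ 2 <= sqn a.
Proof. by rewrite lerDl sqr_ge0. Qed.

Lemma cvC_unique u (a b : C) : cvC u a -> cvC u b -> a = b.
Proof.
move=> ua ub; apply/eqP; rewrite -subr_eq0; apply/eqP/sqn_eq0.
apply: (@ler_addeps _ _ _ 4) => // e e0.
have [n [h1 h2]] := ev_ex (evI (ua _ e0) (ub _ e0)).
have := sqnD (a - u n) (u n - b); rewrite addrA subrK sqnB; lra.
Qed.

(** Arithmetic-geometric mean inequality, [4 c q <= (q + c)^2]; it bounds the quadratic functional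
    of the minimization from below. *)
Lemma quad_bound (a : C) (c q : R) : 0 <= c -> 0 <= q -> sqn a <= c * q ->
  - c <= q - 2 * re a.
Proof.
move=> c0 q0 h; have := sqn_re a; set r := re a => h1.
have : 4 * r ^+ 2 <= (q + c) ^+ 2 by have := sqr_ge0 (q - c); nra.
rewrite (_ : 4 * r ^+ 2 = (2 * r) ^+ 2); last by ring.
move=> h'; have : `|2 * r| <= `|q + c|.
  by rewrite -ler_sqr ?nnegrE// !real_normK ?num_real.
rewrite [`|q + c|]ger0_norm; last by lra.
by move=> /ler_normlP[]; lra.
Qed.

Lemma norm_lt_sqn a (r : R) : 0 < r -> (`|a| < cplx r) = (sqn a < r ^+ 2).
Proof.
move=> r0.
have r0' : 0 <= cplx r by rewrite -[0]/(cplx 0) cplx_le_cplx ltW.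
rewrite -ltr_sqr ?nnegrE// -sqn_norm.
have -> : cplx r ^+ 2 = cplx (r ^+ 2).
  by apply: cplx_eq; rewrite !expr2 ?(reM,imM) !re_cplx !im_cplx; ring.
by rewrite !lt_def cplx_le_cplx; congr (~~ _ && _); apply/eqP/eqP => [[]|->].
Qed.

Lemma cvCP u a : cvC u a <-> u @ \oo --> a.
Proof.
split=> [ua|/cvgrPdist_lt ua e e0].
  apply/cvgrPdist_lt => e /cplx_gt0[-> e0].
  have h : 0 < re e ^+ 2 / 2 by rewrite divr_gt0// exprn_gt0.
  have [N hN] := ua _ h; exists N => // n nN /=.
  by rewrite norm_lt_sqn// sqnB; apply: le_lt_trans (hN _ nN) _; lra.
pose d := Num.min 1 e.
have d0 : 0 < d by rewrite lt_min ltr01.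
have /ua[N _ hN] : 0 < cplx d.
  by rewrite lt_def -[0]/(cplx 0) cplx_le_cplx (ltW d0) andbT; apply/eqP => -[]; lra.
exists N => n nN; have := hN n nN => /=.
rewrite norm_lt_sqn// sqnB => h; apply: le_trans (ltW h) _.
have d1 : d <= 1 by rewrite ge_min lexx.
have d2 : d <= e by rewrite ge_min lexx orbT.
nra.
Qed.

Lemma cvCD u v a b : cvC u a -> cvC v b -> cvC (fun n => u n + v n) (a + b).
Proof.
move=> ua vb e e0; have h : 0 < e / 4 by lra.
apply: evW (evI (ua _ h) (vb _ h)) => n [h1 h2].
by rewrite opprD addrACA; have := sqnD (u n - a) (v n - b); lra.
Qed.

Lemma cvCM b u a : cvC u a -> cvC (fun n => b * u n) (b * a).
Proof.
move=> ua e e0; have b0 := sqn_ge0 b.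
have h : 0 < e / (sqn b + 1) by rewrite divr_gt0//; lra.
apply: evW (ua _ h) => n hn; rewrite -mulrBr sqnM.
apply: le_trans (ler_wpM2l b0 hn) _.
rewrite mulrA ler_pdivrMr; last by lra.
nra.
Qed.

Lemma cvCJ u a : cvC u a -> cvC (fun n => (u n)^*) a^*.
Proof.
by move=> ua e e0; apply: evW (ua _ e0) => n; rewrite -rmorphB /= sqnJ.
Qed.

Lemma cvC_cst a : cvC (fun=> a) a.
Proof. by move=> e e0; exists 0%N => n _; rewrite subrr /sqn re0 im0; lra. Qed.

Lemma cvC_eq u v a : (forall n, u n = v n) -> cvC u a -> cvC v a.
Proof. by move=> /funext->. Qed.

Lemma cvC_sum (I : Type) (r : seq I) (u : I -> nat -> C) (a : I -> C) :
  (forall i, cvC (u i) (a i)) ->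
  cvC (fun n => \sum_(i <- r) u i n) (\sum_(i <- r) a i).
Proof.
move=> ua; elim: r => [|i r IH].
  by rewrite big_nil; apply: cvC_eq (cvC_cst 0) => n; rewrite big_nil.
rewrite big_cons; apply: cvC_eq (cvCD (ua i) IH) => n.
by rewrite big_cons.
Qed.

Lemma cvC_re_le u a (c : R) : cvC u a -> ev (fun n => re (u n) <= c) -> re a <= c.
Proof.
move=> ua uc; apply: (@ler_addeps _ _ _ 1) => // e e0; rewrite mul1r.
have [n [hn rn]] := ev_ex (evI (ua _ (exprn_gt0 2 e0)) uc).
rewrite leNgt; apply/negP => h.
have := sqn_re (u n - a); rewrite reB => h2.
have h3 : e < re a - re (u n) by lra.
have : e ^+ 2 < (re a - re (u n)) ^+ 2 by rewrite ltr_sqr ?nnegrE; lra.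
rewrite -[(re a - _) ^+ 2]sqrrN opprB; lra.
Qed.

Lemma cvC_re_ge u a (c : R) : cvC u a -> ev (fun n => c <= re (u n)) -> c <= re a.
Proof.
move=> ua uc; rewrite -lerN2 -reN -mulN1r.
apply: (cvC_re_le (cvCM (-1) ua)).
by apply: evW uc => n; rewrite mulN1r reN lerN2.
Qed.

Lemma cvC_ge0 u a : cvC u a -> (forall n, 0 <= u n) -> 0 <= a.
Proof.
move=> ua u0; apply/cplx_ge0P; split; last first.
  by apply: (cvC_re_ge ua); exists 0%N => n _; have /cplx_ge0P[] := u0 n.
have h : a^* = a.
  apply: (cvC_unique (u := u)) => //; apply: cvC_eq (cvCJ ua) => n.
  have /cplx_ge0P[h _] := u0 n; apply: cplx_eq; rewrite ?reJ ?imJ ?h ?oppr0//.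
by have := imJ a; rewrite h; lra.
Qed.

Lemma cvC_parts u (a b : R) :
  (fun n => re (u n)) @ \oo --> a -> (fun n => im (u n)) @ \oo --> b ->
  cvC u (a +i* b : C).
Proof.
move=> /cvgrPdist_lt ua /cvgrPdist_lt ub e e0.
pose d := Num.min 1 (e / 2).
have d0 : 0 < d by rewrite lt_min ltr01/=; lra.
have [N _ hN] := ua _ d0; have [N' _ hN'] := ub _ d0.
exists (maxn N N') => n; rewrite geq_max => /andP[/hN/= h1 /hN'/= h2].
have d1 : d <= 1 by rewrite ge_min lexx.
have d2 : d <= e / 2 by rewrite ge_min lexx orbT.
have sq (x : R) : `|x| < d -> x ^+ 2 <= e / 2.
  move=> xd; rewrite -real_normK ?num_real//.
  have := normr_ge0 x; nra.
rewrite /sqn reB imB -[(re _ - _) ^+ 2]sqrrN -[(im _ - _) ^+ 2]sqrrN !opprB.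
by have := sq _ h1; have := sq _ h2; rewrite /re /im /=; lra.
Qed.

End ComplexLimits.

(** * Semi-inner products *)

Section SemiInner.
Context (R : realType).
Local Notation C := (Cplx R).

(** Possibly degenerate, and relative to a set [X]: the same theory serves the Hilbert space, [l2],
    and forms such as [f (adj y \o x)] that are controlled only for operators in an algebra. *)
Record sip (V : lmodType C) (X : set V) (B : V -> V -> C) : Prop := {
  sip0 : X 0;
  sipP : forall (a : C) u v, X u -> X v -> X (a *: u + v);
  sip_lin : forall (a : C) u v w, X u -> X v -> X w ->
    B (a *: u + v) w = a * B u w + B v w;
  sip_sym : forall u v, X u -> X v -> B v u = (B u v)^*;
  sip_ge0 : forall u, X u -> 0 <= B u u }.

Definition Q (V : Type) (B : V -> V -> C) u : R := re (B u u).

Definition cauchyQ (V : zmodType) (B : V -> V -> C) (u : nat -> V) :=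
  forall e : R, 0 < e -> exists N, forall m n, (N <= m)%N -> (N <= n)%N ->
    Q B (u m - u n) <= e.

Definition cvQ (V : zmodType) (B : V -> V -> C) (u : nat -> V) l :=
  forall e : R, 0 < e -> ev (fun n => Q B (u n - l) <= e).

Section Theory.
Context (V : lmodType C) (X : set V) (B : V -> V -> C) (S : sip X B).
Implicit Types (u v w : V) (a : C).

Lemma sipD u v : X u -> X v -> X (u + v).
Proof. by move=> Xu Xv; rewrite -[u]scale1r; exact: sipP S _ _ _ _ _. Qed.
Lemma sipZ a u : X u -> X (a *: u).
Proof. by move=> Xu; rewrite -[_ *: _]addr0; apply: (sipP S) => //; exact: sip0 S. Qed.
Lemma sipN u : X u -> X (- u).
Proof. by move=> Xu; rewrite -scaleN1r; exact: sipZ. Qed.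
Lemma sipB u v : X u -> X v -> X (u - v).
Proof. by move=> Xu Xv; apply: sipD => //; exact: sipN. Qed.

Lemma BDl u v w : X u -> X v -> X w -> B (u + v) w = B u w + B v w.
Proof.
by move=> Xu Xv Xw; have := sip_lin S 1 Xu Xv Xw; rewrite scale1r mul1r.
Qed.
Lemma B0l w : X w -> B 0 w = 0.
Proof.
move=> Xw; have X0 := sip0 S; have := BDl X0 X0 Xw.
by rewrite addr0 -[LHS]addr0 => /addrI/esym.
Qed.
Lemma BZl a u w : X u -> X w -> B (a *: u) w = a * B u w.
Proof.
move=> Xu Xw; have := sip_lin S a Xu (sip0 S) Xw.
by rewrite addr0 B0l// addr0.
Qed.
Lemma BNl u w : X u -> X w -> B (- u) w = - B u w.
Proof. by move=> Xu Xw; rewrite -scaleN1r BZl// mulN1r. Qed.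
Lemma BBl u v w : X u -> X v -> X w -> B (u - v) w = B u w - B v w.
Proof. by move=> Xu Xv Xw; rewrite BDl ?BNl//; exact: sipN. Qed.
Lemma BDr u v w : X u -> X v -> X w -> B w (u + v) = B w u + B w v.
Proof.
move=> Xu Xv Xw; rewrite (sip_sym S (sipD Xu Xv) Xw) BDl// rmorphD /=.
by rewrite -!(sip_sym S).
Qed.
Lemma BZr a u w : X u -> X w -> B w (a *: u) = a^* * B w u.
Proof.
move=> Xu Xw; rewrite (sip_sym S (sipZ a Xu) Xw) BZl// rmorphM /=.
by rewrite -(sip_sym S).
Qed.
Lemma BNr u w : X u -> X w -> B w (- u) = - B w u.
Proof. by move=> Xu Xw; rewrite -scaleN1r BZr// rmorphN rmorph1 mulN1r. Qed.
Lemma BBr u v w : X u -> X v -> X w -> B w (u - v) = B w u - B w v.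
Proof. by move=> Xu Xv Xw; rewrite BDr ?BNr//; exact: sipN. Qed.
Lemma B0r w : X w -> B w 0 = 0.
Proof. by move=> Xw; rewrite (sip_sym S (sip0 S) Xw) B0l// rmorph0. Qed.

Lemma QE u : X u -> B u u = cplx (Q B u).
Proof. by move=> /(sip_ge0 S) /cplx_ge0P[h _]; apply: cplx_eq. Qed.
Lemma Q_ge0 u : X u -> 0 <= Q B u.
Proof. by move=> /(sip_ge0 S) /cplx_ge0P[]. Qed.
Lemma reBC u v : X u -> X v -> re (B u v) = re (B v u).
Proof. by move=> Xu Xv; rewrite (sip_sym S Xv Xu) reJ. Qed.
Lemma QD u v : X u -> X v -> Q B (u + v) = Q B u + Q B v + 2 * re (B u v).
Proof.
move=> Xu Xv; have Xs := sipD Xu Xv.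
by rewrite /Q BDl// !BDr// !reD (reBC Xv Xu); ring.
Qed.
Lemma QZ a u : X u -> Q B (a *: u) = sqn a * Q B u.
Proof.
move=> Xu; have Xs := sipZ a Xu.
rewrite {1}/Q BZl// BZr// QE// /sqn !reM imM reJ imJ re_cplx im_cplx; ring.
Qed.
Lemma QN u : X u -> Q B (- u) = Q B u.
Proof. by move=> Xu; have Xs := sipN Xu; rewrite /Q BNl// BNr// opprK. Qed.
Lemma QB u v : X u -> X v -> Q B (u - v) = Q B u + Q B v - 2 * re (B u v).
Proof.
by move=> Xu Xv; have Xs := sipN Xv; rewrite QD// QN// BNr// reN; ring.
Qed.
Lemma QC u v : X u -> X v -> Q B (u - v) = Q B (v - u).
Proof. by move=> Xu Xv; rewrite -QN ?opprB//; exact: sipB. Qed.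
Lemma Q0 : Q B 0 = 0.
Proof. by rewrite /Q B0l//; exact: sip0 S. Qed.
Lemma QD2 u v : X u -> X v -> Q B (u + v) <= 2 * Q B u + 2 * Q B v.
Proof.
move=> Xu Xv; have := Q_ge0 (sipB Xu Xv); rewrite QB// QD//; lra.
Qed.

(** Positivity at [u - s B(u, v) v] is quadratic in the real number [s]. As [Q B v] may vanish, the
    optimal [s] is replaced by the inverse of [Q B v + e], and [e] tends to 0. *)
Lemma CS u v : X u -> X v -> sqn (B u v) <= Q B u * Q B v.
Proof.
move=> Xu Xv.
have H (s : R) : 2 * s * sqn (B u v) <= Q B u + s ^+ 2 * sqn (B u v) * Q B v.
  have Xs := sipZ (cplx s * B u v) Xv.
  have := Q_ge0 (sipB Xu Xs); rewrite QB// QZ// sqnM sqn_cplx BZr//.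
  by rewrite /sqn rmorphM /= !reM imM !reJ !imJ re_cplx im_cplx; nra.
have h1 := Q_ge0 Xu; have h2 := Q_ge0 Xv; have h3 := sqn_ge0 (B u v).
apply: (@ler_addeps _ _ _ (Q B u)) => // e e0.
have := H (Q B v + e)^-1.
have p : 0 < Q B v + e by lra.
set q := Q B v + e => HH.
have HH2 : 2 * sqn (B u v) * q <= Q B u * q ^+ 2 + sqn (B u v) * Q B v.
  have := ler_wpM2r (sqr_ge0 q) HH.
  have -> : 2 * q^-1 * sqn (B u v) * q ^+ 2 = 2 * sqn (B u v) * q.
    by field; rewrite /q; lra.
  have -> : (Q B u + q^-1 ^+ 2 * sqn (B u v) * Q B v) * q ^+ 2 =
    Q B u * q ^+ 2 + sqn (B u v) * Q B v by field; rewrite /q; lra.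
  by [].
have HH3 : sqn (B u v) * q <= Q B u * q ^+ 2.
  have : sqn (B u v) * Q B v <= sqn (B u v) * q by rewrite ler_wpM2l// /q; lra.
  lra.
have : sqn (B u v) <= Q B u * q.
  by rewrite -(ler_pM2r p) -mulrA -expr2.
by rewrite /q; lra.
Qed.

Lemma cvQ_B k (u : nat -> V) l : X k -> (forall n, X (u n)) -> X l -> cvQ B u l ->
  cvC (fun n => B k (u n)) (B k l).
Proof.
move=> Xk Xu Xl ul e e0; have k0 := Q_ge0 Xk.
have h : 0 < e / (Q B k + 1) by rewrite divr_gt0//; lra.
apply: evW (ul _ h) => n hn; rewrite -BBr//.
apply: le_trans (CS Xk (sipB (Xu n) Xl)) _.
apply: le_trans (ler_wpM2l k0 hn) _.
rewrite mulrA ler_pdivrMr; last by lra.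
nra.
Qed.

Lemma cvQ_Bl k (u : nat -> V) l : X k -> (forall n, X (u n)) -> X l -> cvQ B u l ->
  cvC (fun n => B (u n) k) (B l k).
Proof.
move=> Xk Xu Xl ul e e0; apply: evW (cvQ_B Xk Xu Xl ul e0) => n.
by rewrite (sip_sym S Xk (Xu n)) (sip_sym S Xk Xl) -rmorphB /= sqnJ.
Qed.

Lemma cvQ_BB (u v : nat -> V) l k : (forall n, X (u n)) -> (forall n, X (v n)) ->
  X l -> X k -> cvQ B u l -> cvQ B v k -> cvC (fun n => B (u n) (v n)) (B l k).
Proof.
move=> Xu Xv Xl Xk ul vk e e0.
pose d := Num.min 1 (e / 16).
have d0 : 0 < d by rewrite lt_min ltr01/=; lra.
have d1 : d <= 1 by rewrite ge_min lexx.
have d2 : d <= e / 16 by rewrite ge_min lexx orbT.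
have h16 : 0 < e / 16 by lra.
apply: evW (evI (evI (ul _ d0) (vk _ d0)) (evI (cvQ_Bl Xk Xu Xl ul h16)
  (cvQ_B Xl Xv Xk vk h16))) => n [[h1 h1'] [h2 h3]].
have Xn := Xu n; have Xs := sipB Xn Xl; have Xm := Xv n; have Xt := sipB Xm Xk.
have -> : B (u n) (v n) - B l k =
    (B (u n) k - B l k) + ((B l (v n) - B l k) + B (u n - l) (v n - k)).
  by rewrite BBl// !BBr//; ring.
apply: le_trans (sqnD _ _) _.
have := sqnD (B l (v n) - B l k) (B (u n - l) (v n - k)).
have := CS Xs Xt; have := Q_ge0 Xs; have := Q_ge0 Xt.
move: h1 h1'; set p := Q B _; set q := Q B _ => h1 h1' q0 p0 h4.
have : p * q <= d * 1 by apply: ler_pM => //; lra.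
lra.
Qed.

Lemma cvQ_diag (u : nat -> V) l : (forall n, X (u n)) -> X l -> cvQ B u l ->
  cvC (fun n => B (u n) (u n)) (B l l).
Proof. by move=> Xu Xl ul; exact: cvQ_BB. Qed.

Lemma cvQ_cauchy (u : nat -> V) l : (forall n, X (u n)) -> X l -> cvQ B u l -> cauchyQ B u.
Proof.
move=> Xu Xl ul e e0; have h : 0 < e / 4 by lra.
have [N hN] := ul _ h; exists N => m n /hN hm /hN hn.
have h1 := sipB (Xu m) Xl; have h2 := sipB Xl (Xu n).
have := QD2 h1 h2; rewrite (QC Xl (Xu n)) addrA subrK; lra.
Qed.

(* A minimizing sequence of Q u - 2 Re (l u) on a convex set is Cauchy; the
   limit need not exist, hence the error term in the Euler inequality. *)
Lemma minimizing (K : set V) (l : V -> C) (c : R) :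
  K `<=` X -> K !=set0 ->
  (forall (t : R) u v, 0 <= t <= 1 -> K u -> K v ->
     K (u + cplx t *: (v - u))) ->
  (forall a u v, X u -> X v -> l (a *: u + v) = a * l u + l v) ->
  (forall u, K u -> c <= Q B u - 2 * re (l u)) ->
  exists h : nat -> V, [/\ forall n, K (h n), cauchyQ B h &
    forall k n, K k ->
      - (Q B (k - h n) + 1) / n.+1%:R <= 2 * re (B (k - h n) (h n) - l (k - h n))].
Proof.
move=> KX [k0 Kk0] Kconv llin Fc.
pose F u := Q B u - 2 * re (l u).
have lD u v : X u -> X v -> l (u + v) = l u + l v.
  by move=> Xu Xv; rewrite -[u]scale1r llin// mul1r scale1r.
have l0 : l 0 = 0.
  have := lD _ _ (sip0 S) (sip0 S).
  by rewrite addr0 -[LHS]addr0 => /addrI/esym.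
have lZ a u : X u -> l (a *: u) = a * l u.
  by move=> Xu; have := llin a u 0 Xu (sip0 S); rewrite addr0 l0 addr0.
have lB u v : X u -> X v -> l (u - v) = l u - l v.
  by move=> Xu Xv; rewrite lD//; [rewrite -scaleN1r lZ// mulN1r|exact: sipN].
pose A := [set F u | u in K].
have hA : has_inf A.
  by split; [exists (F k0), k0|exists c => _ [u Ku <-]; exact: Fc].
pose m := inf A.
have mF u : K u -> m <= F u by move=> Ku; apply: ge_inf => //; [case: hA|exists u].
(* Being within [n.+1%:R^-1 ^+ 2] of the infimum matches the step [t = n.+1%:R^-1] taken below:
   dividing the variation by [t] leaves an error of order [t]. *)
have Hex n : exists u, K u /\ F u <= m + n.+1%:R^-1 ^+ 2.
  have e0 : 0 < (n.+1%:R^-1 : R) ^+ 2 by rewrite exprn_gt0// invr_gt0.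
  by have [_ [u Ku <-] /ltW h] := inf_adherent e0 hA; exists u.
have [h hh] := choice Hex.
have Kh n : K (h n) by case: (hh n).
have Fh n : F (h n) <= m + n.+1%:R^-1 ^+ 2 by case: (hh n).
have FE (t : R) u v : X u -> X v -> F (u + cplx t *: v) =
    F u + t ^+ 2 * Q B v + 2 * t * re (B v u - l v).
  move=> Xu Xv; have Xs := sipZ (cplx t) Xv.
  rewrite /F QD// QZ// sqn_cplx lD// lZ// BZr// !reD !reM reJ imJ.
  by rewrite reN re_cplx im_cplx (reBC Xu Xv); ring.
exists h; split => //.
  move=> e e0; have e1 : 0 < e / 4 by lra.
  have [N hN] := ev_small e1; pose N' := N.
  exists N => p q pN qN.
  have Xp := KX _ (Kh p); have Xq := KX _ (Kh q).
  have Xs := sipB Xq Xp.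
  have h01 : 0 <= (2^-1 : R) <= 1 by apply/andP; split; lra.
  (* Parallelogram identity: the value of [F] at the midpoint falls short of the mean of the two
     values by a quarter of [Q B (h p - h q)]. *)
  have := mF _ (Kconv _ _ _ h01 (Kh p) (Kh q)).
  rewrite FE// (QC Xp Xq).
  have := FE 1 _ _ Xp Xs.
  rewrite scale1r addrC subrK.
  have hp := Fh p; have hq := Fh q.
  have sq (k : nat) : (N <= k)%N -> (k.+1%:R^-1 : R) ^+ 2 <= e / 4.
    move=> kN; apply: le_trans (hN _ kN).
    rewrite expr2 ler_piMr// ?invr_ge0// invf_le1// ler1n//.
  move: hp hq (sq _ pN) (sq _ qN).
  set r := re _; set tp := _ ^+ 2; set tq := q.+1%:R^-1 ^+ 2.
  clearbody tp tq r F; lra.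
move=> k n Kk.
have Xk := KX _ Kk; have Xh := KX _ (Kh n).
have Xs := sipB Xk Xh.
set t : R := n.+1%:R^-1.
have t0 : 0 < t by rewrite invr_gt0.
have t1 : t <= 1 by rewrite invf_le1// ler1n.
have h01 : 0 <= t <= 1 by apply/andP; split; lra.
have := mF _ (Kconv _ _ _ h01 (Kh n) Kk); rewrite FE//.
have := Fh n; rewrite -/t; set r := re _; set q := Q B _ => h1 h2.
have : 0 <= t * (t + t * q + 2 * r) by nra.
rewrite pmulr_rge0//; lra.
Qed.

(** Riesz representation without completeness: minimizing [Q B u - 2 Re (l u)] over all of [X] gives
    a Cauchy sequence that represents [l] in the limit. *)
Lemma riesz_seq (l : V -> C) (c : R) :
  (forall a u v, X u -> X v -> l (a *: u + v) = a * l u + l v) ->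
  (forall u, X u -> sqn (l u) <= c * Q B u) -> 0 <= c ->
  exists g : nat -> V, [/\ forall n, X (g n), cauchyQ B g &
    forall k, X k -> cvC (fun n => B k (g n)) (l k)].
Proof.
move=> llin lc c0.
have bnd u : X u -> - c <= Q B u - 2 * re (l u).
  by move=> Xu; apply: quad_bound => //; [exact: Q_ge0|exact: lc].
have [//|||g [Xg cg var]] := @minimizing X l (- c) _ _ _ llin bnd.
- by exists 0; exact: sip0 S.
- by move=> t u v _ Xu Xv; apply: sipD => //; apply: sipZ; exact: sipB.
exists g; split => // k Xk e e0.
have k0 := Q_ge0 Xk.
have h1 : 0 < e / (1 + e) by rewrite divr_gt0//; lra.
have h2 : 0 < (1 + Q B k)^-1 by rewrite invr_gt0; lra.
have h3 : 0 < (e / (1 + e)) * (1 + Q B k)^-1 by rewrite mulr_gt0.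
(* Past this threshold [t * Q B k] is at most 1, so the quadratic term is absorbed by the linear
   one. *)
have [N hN] := evI (ev_small h2) (ev_small e0).
exists N => n /hN[n1 n2].
set b := B k (g n) - l k.
(* Steepest descent: the perturbation [a *: k] turns the first-order term into [- sqn b]. *)
pose a := - b^*.
have Xak := sipZ a Xk.
have := var (g n + a *: k) n (sipD (Xg n) Xak).
rewrite [g n + _]addrC addrK BZl//.
have -> : l (a *: k) = a * l k.
  have l0 : l 0 = 0.
    have := llin 1 _ _ (sip0 S) (sip0 S).
    by rewrite scale1r mul1r addr0 -[LHS]addr0 => /addrI/esym.
  by have := llin a k 0 Xk (sip0 S); rewrite addr0 l0 addr0.
rewrite -mulrBr -/b QZ//.
have -> : re (a * b) = - sqn b.
  by rewrite /a /sqn reM reN imN reJ imJ; ring.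
have -> : sqn a = sqn b by rewrite /a sqnN sqnJ.
move: n1 n2; set t : R := n.+1%:R^-1 => n1 n2 H.
have t0 : 0 < t by rewrite invr_gt0.
have s0 := sqn_ge0 b.
have tk : t * Q B k <= 1.
  have p : 0 < 1 + Q B k by lra.
  have := ler_wpM2r (ltW p) n1; rewrite mulVf; last by lra.
  nra.
nra.
Qed.

(** Only [K] has to be complete: in the application [X] is [D] with the form of [omega], and [K] its
    operator interval. The Euler inequality of [minimizing] passes to the limit because its error
    term tends to 0. *)
Lemma variational (K : set V) (l : V -> C) (c : R) :
  K `<=` X -> K !=set0 ->
  (forall (t : R) u v, 0 <= t <= 1 -> K u -> K v ->
     K (u + cplx t *: (v - u))) ->
  (forall h : nat -> V, (forall n, K (h n)) -> cauchyQ B h ->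
     exists2 k, K k & cvQ B h k) ->
  (forall a u v, X u -> X v -> l (a *: u + v) = a * l u + l v) ->
  (forall u, X u -> sqn (l u) <= c * Q B u) -> 0 <= c ->
  exists2 h, K h & forall k, K k -> 0 <= re (B (k - h) h - l (k - h)).
Proof.
move=> KX K0 Kc Kcomp llin lc c0.
have bnd u : K u -> - c <= Q B u - 2 * re (l u).
  by move=> /KX Xu; apply: quad_bound => //; [exact: Q_ge0|exact: lc].
have [h [Kh ch var]] := minimizing KX K0 Kc llin bnd.
have [h0 Kh0 hh0] := Kcomp h Kh ch; exists h0 => // k Kk.
have Xk := KX _ Kk; have Xh0 := KX _ Kh0; have Xh n := KX _ (Kh n).
have lB u v : X u -> X v -> l (u - v) = l u - l v.
  by move=> Xu Xv; have := llin (-1) v u Xv Xu; rewrite scaleN1r mulN1r addrC => ->; rewrite addrC.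
have cl : cvC (fun n => l (h n)) (l h0).
  move=> e e0; have p : 0 < e / (c + 1) by rewrite divr_gt0//; lra.
  apply: evW (hh0 _ p) => n hn; rewrite -lB//.
  apply: le_trans (lc _ (sipB (Xh n) Xh0)) _.
  apply: le_trans (ler_wpM2l c0 hn) _.
  rewrite mulrA ler_pdivrMr; last by lra.
  nra.
set v := B (k - h0) h0 - _.
have cv : cvC (fun n => B (k - h n) (h n) - l (k - h n)) v.
  have Xhh n := sipB Xk (Xh n).
  have c1 := cvQ_B Xk Xh Xh0 hh0; have c2 := cvQ_diag Xh Xh0 hh0.
  have := cvCD (cvCD c1 (cvCM (-1) c2)) (cvCD (cvC_cst (- l k)) cl).
  rewrite (_ : _ + _ = v); last by rewrite /v BBl// lB//; ring.
  by apply: cvC_eq => n; rewrite BBl// lB//; ring.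
apply: (@ler_addeps _ _ _ (2 * Q B (k - h0) + 3)) => [|e e0].
  by have := Q_ge0 (sipB Xk Xh0); lra.
set m := 2 * _ + 3.
rewrite -lerBlDr sub0r; apply: (cvC_re_ge cv).
apply: evW (evI (ev_small e0) (hh0 _ ltr01)) => n [h1 h2].
have := var k n Kk; set r := re _ => h3.
have := QD2 (sipB Xk Xh0) (sipB Xh0 (Xh n)); rewrite addrA subrK (QC Xh0 (Xh n)) => h4.
have hq : 0 <= Q B (k - h n) + 1 <= m.
  by have := Q_ge0 (sipB Xk (Xh n)); rewrite /m; lra.
move: h1 h3 hq; set t : R := n.+1%:R^-1; set q := Q B _ + 1 => h1 h3 /andP[q0 qm].
have t0 : 0 < t by rewrite invr_gt0.
have : q * t <= m * e by apply: ler_pM => //; exact: ltW.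
have : 0 <= m * e by rewrite mulr_ge0 ?(ltW e0)//; lra.
nra.
Qed.

End Theory.
End SemiInner.

Section Linear.
Context (R : realType) (H : lmodType (Cplx R)).
Implicit Types (x : H -> H) (u v : H).

Lemma inT u : [set: H] u. Proof. by []. Qed.

Lemma linopB x u v : linear x -> x (u - v) = x u - x v.
Proof. by move=> xl; rewrite addrC -scaleN1r xl scaleN1r addrC. Qed.

Lemma linopD x u v : linear x -> x (u + v) = x u + x v.
Proof. by move=> xl; have := xl 1 u v; rewrite !scale1r. Qed.

Lemma linop0 x : linear x -> x 0 = 0.
Proof. by move=> xl; have := linopB 0 0 xl; rewrite !subrr. Qed.

Lemma linopZ x (a : Cplx R) u : linear x -> x (a *: u) = a *: x u.
Proof. by move=> xl; rewrite -[a *: u in LHS]addr0 [LHS]xl linop0// addr0. Qed.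

End Linear.

Section Sesquilinear.
Context (R : realType).
Local Notation C := (Cplx R).

(** Hermitian symmetry comes from polarization: the value on [a *: u + v] is real, and [a = 1]
    settles the imaginary parts, [a = 'i] the real ones. *)
Lemma sip_positive (V : lmodType C) (X : set V) (B : V -> V -> C) :
  X 0 -> (forall (a : C) u v, X u -> X v -> X (a *: u + v)) ->
  (forall (a : C) u v w, X u -> X v -> X w ->
     B (a *: u + v) w = a * B u w + B v w) ->
  (forall (a : C) u v w, X u -> X v -> X w ->
     B w (a *: u + v) = a^* * B w u + B w v) ->
  (forall u, X u -> 0 <= B u u) -> sip X B.
Proof.
move=> X0 Xl Bl Br B0; split=> // u v Xu Xv.
have H (a : C) : a^* * B v u + a * B u v = (a^* * B v u + a * B u v)^*.
  have : im (a^* * B v u + a * B u v) = 0.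
    have := B0 _ (Xl a u v Xu Xv); have := B0 _ Xv; have := B0 _ Xu.
    rewrite Bl ?Br//; last exact: Xl.
    move=> /cplx_ge0P[h1 _] /cplx_ge0P[h2 _] /cplx_ge0P[h3 _].
    by move: h3; rewrite !(reD, imD, reM, imM, reJ, imJ) h1 h2; lra.
  by move=> h; apply: cplx_eq; rewrite ?reJ// imJ h oppr0.
have h1 := H 1; have h2 := H ('i : C).
move: h1 h2; rewrite !(rmorph1, mul1r).
set p := B v u; set q := B u v => h1 h2.
have /(congr1 (@im R)) e1 := h1; have /(congr1 (@im R)) e2 := h2.
move: e1 e2; rewrite !(reD, imD, reM, imM, reJ, imJ, reN, imN).
have -> : re ('i : C) = 0 by []. have -> : im ('i : C) = 1 by [].
move=> e1 e2; apply: cplx_eq; rewrite ?reJ ?imJ; lra.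
Qed.

End Sesquilinear.

Lemma bounded_sum_small (R : realType) (a : nat -> R) (b e : R) :
  (forall n, \sum_(0 <= i < n) a i <= b) -> 0 < e -> exists n, a n <= e.
Proof.
move=> ab e0; apply: contrapT => /forallNP h.
have ha n : n%:R * e <= b.
  apply: le_trans (ab n); elim: n => [|n IH]; first by rewrite mul0r big_geq.
  rewrite big_nat_recr//= -natr1 mulrDl mul1r lerD//.
  by rewrite leNgt; apply/negP => /ltW /h.
have := ha (Num.truncn (b / e)).+1; apply/negP; rewrite -ltNge.
by rewrite -ltr_pdivrMr// truncnS_gt.
Qed.

Section OperatorAlgebras.
Context (R : realType) (H : completeNormedModType (Cplx R)).
Context (dot : {dot H for Num.conj}) (dotE : forall u : H, dot u u = `|u| ^+ 2).
Local Notation C := (Cplx R).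
Local Notation "<< u , v >>" := (dot u v).
Set Default Proof Using "All".

(** * Hilbert space *)

Section HilbertSpace.
Implicit Types (u v w : H) (x y p : H -> H) (c : R) (G : set H).

Definition Qd (u : H) : R := re (dot u u).
Definition cauchyH (u : nat -> H) := forall e : R, 0 < e ->
  exists N, forall m n, (N <= m)%N -> (N <= n)%N -> Qd (u m - u n) <= e.
Definition cvH (u : nat -> H) (l : H) :=
  forall e : R, 0 < e -> ev (fun n => Qd (u n - l) <= e).

Lemma sip_dot : sip [set: H] dot.
Proof.
split=> //.
- by move=> a u v w _ _ _; rewrite linearDl linearZl.
- by move=> u v _ _; have := @hermitian_subproof _ _ _ _ dot v u; rewrite expr0 mul1r.

Qed.

Lemma Q_norm u : cplx (Qd u) = `|u| ^+ 2.
Proof. by rewrite -dotE -(QE sip_dot). Qed.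

Lemma Qd_ge0 u : 0 <= Qd u. Proof. exact: (Q_ge0 sip_dot). Qed.

Lemma QdD2 u v : Qd (u + v) <= 2 * Qd u + 2 * Qd v. Proof. exact: (QD2 sip_dot). Qed.
Lemma QdD u v : Qd (u + v) = Qd u + Qd v + 2 * re << u, v >>. Proof. exact: (QD sip_dot). Qed.
Lemma QdB u v : Qd (u - v) = Qd u + Qd v - 2 * re << u, v >>. Proof. exact: (QB sip_dot). Qed.
Lemma QdC u v : Qd (u - v) = Qd (v - u). Proof. exact: (QC sip_dot). Qed.
Lemma QdZ (a : C) u : Qd (a *: u) = sqn a * Qd u. Proof. exact: (QZ sip_dot). Qed.
Lemma Qd0 : Qd 0 = 0. Proof. exact: (Q0 sip_dot). Qed.
Lemma re_dotC u v : re << u, v >> = re << v, u >>. Proof. exact: (reBC sip_dot). Qed.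

Lemma Qd_eq0 u : Qd u <= 0 -> u = 0.
Proof.
move=> u0; have {}u0 : Qd u = 0 by apply/eqP; rewrite eq_le u0 Qd_ge0.
by apply/eqP; rewrite -normr_eq0 -sqrf_eq0 -Q_norm u0.
Qed.

Lemma norm_lt_Q u (a : R) : 0 < a -> (`|u| < cplx a) = (Qd u < a ^+ 2).
Proof.
move=> a0.
have a0' : 0 <= cplx a by rewrite -[0]/(cplx 0) cplx_le_cplx ltW.
rewrite -ltr_sqr ?nnegrE// -Q_norm.
have -> : cplx a ^+ 2 = cplx (a ^+ 2).
  by apply: cplx_eq; rewrite !expr2 ?reM ?imM !re_cplx !im_cplx; ring.
by rewrite !lt_def cplx_le_cplx; congr (~~ _ && _); apply/eqP/eqP => [[]|->].
Qed.

Lemma H_complete (u : nat -> H) : cauchyH u -> exists l, cvH u l.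
Proof.
move=> cu.
have cvu : cvg (u @ \oo).
  apply: cauchy_cvg; apply/cauchy_ballP => e /cplx_gt0[-> e0].
  set a := re e.
  have [N hN] : exists N, forall m n, (N <= m)%N -> (N <= n)%N ->
      Qd (u m - u n) <= a ^+ 2 / 2.
    by apply: cu; rewrite divr_gt0// exprn_gt0.
  pose A := [set u n | n in [set n | (N <= n)%N]].
  have FA : (u @ \oo) A by exists N => // n nN; exists n.
  exists (A, A) => // -[_ _] /= [[m mN <-] [n nN <-]].
  rewrite -ball_normE /= norm_lt_Q//.
  apply: le_lt_trans (hN _ _ mN nN) _.
  by have := exprn_gt0 2 e0; rewrite -/a; lra.
exists (lim (u @ \oo)) => e e0.
pose d := Num.min 1 e.
have d0 : 0 < d by rewrite lt_min ltr01.
have [N _ hN] : \forall n \near \oo, `|lim (u @ \oo) - u n| < cplx d.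
  move/cvgrPdist_lt : cvu; apply.
  by rewrite lt_def -[0]/(cplx 0) cplx_le_cplx (ltW d0) andbT; apply/eqP => -[]; lra.
exists N => n nN; have := hN n nN => /=.
rewrite norm_lt_Q// QdC => h; apply: le_trans (ltW h) _.
have d1 : d <= 1 by rewrite ge_min lexx.
have d2 : d <= e by rewrite ge_min lexx orbT.
nra.
Qed.

Lemma dotDl u v w : << u + v, w >> = << u, w >> + << v, w >>. Proof. exact: (BDl sip_dot). Qed.
Lemma dotDr u v w : << w, u + v >> = << w, u >> + << w, v >>. Proof. exact: (BDr sip_dot). Qed.
Lemma dotBl u v w : << u - v, w >> = << u, w >> - << v, w >>. Proof. exact: (BBl sip_dot). Qed.
Lemma dotBr u v w : << w, u - v >> = << w, u >> - << w, v >>. Proof. exact: (BBr sip_dot). Qed.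
Lemma dotNr u w : << w, - u >> = - << w, u >>. Proof. exact: (BNr sip_dot). Qed.
Lemma dotZl (a : C) u w : << a *: u, w >> = a * << u, w >>. Proof. exact: (BZl sip_dot). Qed.
Lemma dotZr (a : C) u w : << w, a *: u >> = a^* * << w, u >>. Proof. exact: (BZr sip_dot). Qed.
Lemma dotC u v : << v, u >> = (<< u, v >>)^*. Proof. exact: (sip_sym sip_dot). Qed.
Lemma dot0l u : << 0, u >> = 0. Proof. exact: (B0l sip_dot). Qed.
Lemma dot0r u : << u, 0 >> = 0. Proof. exact: (B0r sip_dot). Qed.
Lemma dotQ u : << u, u >> = cplx (Qd u). Proof. exact: (QE sip_dot). Qed.
Lemma dotCS u v : sqn << u, v >> <= Qd u * Qd v. Proof. exact: (CS sip_dot). Qed.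

Lemma dot_inj u v : (forall w, << w, u >> = << w, v >>) -> u = v.
Proof.
move=> h; apply/eqP; rewrite -subr_eq0; apply/eqP/Qd_eq0.
by rewrite /Qd dotBr h subrr.
Qed.

Lemma cvH_unique (u : nat -> H) l l' : cvH u l -> cvH u l' -> l = l'.
Proof.
move=> ul ul'; apply/eqP; rewrite -subr_eq0; apply/eqP/Qd_eq0.
apply: (@ler_addeps _ _ _ 4) => // e e0.
have [n [h1 h2]] := ev_ex (evI (ul _ e0) (ul' _ e0)).
have := QdD2 (l - u n) (u n - l'); rewrite addrA subrK QdC; lra.
Qed.

Lemma cvH_eq (u v : nat -> H) l : (forall n, u n = v n) -> cvH u l -> cvH v l.
Proof. by move=> /funext->. Qed.

Lemma cvH_cst l : cvH (fun=> l) l.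
Proof. by move=> e e0; exists 0%N => n _; rewrite subrr Qd0 ltW. Qed.

Lemma cvHD (u v : nat -> H) l l' : cvH u l -> cvH v l' ->
  cvH (fun n => u n + v n) (l + l').
Proof.
move=> ul vl e e0; have h : 0 < e / 4 by lra.
apply: evW (evI (ul _ h) (vl _ h)) => n [h1 h2].
rewrite opprD addrACA.
by have := QdD2 (u n - l) (v n - l'); lra.
Qed.

Lemma cvH_map x c (u : nat -> H) l : (forall u v, x (u - v) = x u - x v) ->
  0 <= c -> (forall u, Qd (x u) <= c * Qd u) ->
  cvH u l -> cvH (fun n => x (u n)) (x l).
Proof.
move=> xB c0 xc ul e e0; have h : 0 < e / (c + 1) by rewrite divr_gt0//; lra.
apply: evW (ul _ h) => n hn; rewrite -xB; apply: le_trans (xc _) _.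
apply: le_trans (ler_wpM2l c0 hn) _.
rewrite mulrA ler_pdivrMr; last by lra.
nra.
Qed.

Lemma cvHZ (a : C) (u : nat -> H) l : cvH u l -> cvH (fun n => a *: u n) (a *: l).
Proof.
apply: (cvH_map (x := *:%R a) (c := sqn a)) => [? ?||?]; first by rewrite scalerBr.
  exact: sqn_ge0.
by rewrite QdZ.
Qed.

Lemma cvH_dotl (u : nat -> H) l w : cvH u l -> cvC (fun n => << u n, w >>) << l, w >>.
Proof. exact: (cvQ_Bl sip_dot (inT w) (fun n => inT (u n)) (inT l)). Qed.

Lemma cvH_dot (u : nat -> H) l : cvH u l -> cvC (fun n => << u n, u n >>) << l, l >>.
Proof. exact: (cvQ_diag sip_dot (fun n => inT (u n)) (inT l)). Qed.

Lemma cvH_dot2 (u v : nat -> H) l k : cvH u l -> cvH v k ->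
  cvC (fun n => << u n, v n >>) << l, k >>.
Proof.
exact: (cvQ_BB sip_dot (fun n => inT (u n)) (fun n => inT (v n)) (inT l) (inT k)).
Qed.

Lemma cvH_le (u : nat -> H) l c : cvH u l -> (forall n, Qd (u n) <= c) -> Qd l <= c.
Proof.
move=> ul uc.
have c0 : 0 <= c by apply: le_trans (uc 0%N); exact: Qd_ge0.
apply: (@ler_addeps _ _ _ (2 * c + 2)) => [|d d0]; first lra.
pose e := Num.min d 1.
have e0 : 0 < e by rewrite lt_min d0/=.
have e1 : e <= 1 by rewrite ge_min lexx orbT.
have ed : e <= d by rewrite ge_min lexx.
have [n hn] := ev_ex (ul _ (exprn_gt0 2 e0)).
have := QdB (u n) (u n - l); rewrite subKr => ->.
have h1 := sqn_re << u n, u n - l >>.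
have h2 := dotCS (u n) (u n - l).
have h3 := Qd_ge0 (u n); have h4 := Qd_ge0 (u n - l).
have h5 : re << u n, u n - l >> ^+ 2 <= c * e ^+ 2.
  by apply: le_trans h1 _; apply: le_trans h2 _; apply: ler_pM.
have h6 : - ((c + 1) * e / 2) <= re << u n, u n - l >>.
  rewrite leNgt; apply/negP => h.
  have : ((c + 1) * e / 2) ^+ 2 < (re << u n, u n - l >>) ^+ 2.
    rewrite -(sqrrN (re _)) ltr_sqr ?nnegrE; [lra|nra|nra].
  have : c * e ^+ 2 <= ((c + 1) * e / 2) ^+ 2.
    have -> : ((c + 1) * e / 2) ^+ 2 = (c + 1) ^+ 2 / 4 * e ^+ 2 by field.
    by rewrite ler_wpM2r ?sqr_ge0//; have := sqr_ge0 (c - 1); lra.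
  lra.
have h7 := uc n.
nra.
Qed.

Lemma riesz (l : H -> C) c :
  (forall (a : C) u v, l (a *: u + v) = a * l u + l v) ->
  (forall u, sqn (l u) <= c * Qd u) -> 0 <= c ->
  exists w, forall u, l u = << u, w >>.
Proof.
move=> llin lc c0.
have [//|//|//|g [_ cg gl]] := @riesz_seq R H setT dot sip_dot l c.
have [w hw] := H_complete cg.
exists w => u; apply: cvC_unique (gl u _) _ => //.
exact: (cvQ_B sip_dot).
Qed.

Lemma bounded_byP x c :
  bounded_by x c <-> 0 <= c /\ forall u, Qd (x u) <= c ^+ 2 * Qd u.
Proof.
have E u : (`|x u| <= cplx c * `|u|) = (Qd (x u) <= c ^+ 2 * Qd u) \/ ~ 0 <= c.
  have [c0|] := boolP (0 <= c); last by move=> /negP; right.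
  left; have c0' : 0 <= cplx c by rewrite -[0]/(cplx 0) cplx_le_cplx.
  rewrite -ler_sqr ?nnegrE ?mulr_ge0// exprMn -!Q_norm.
  have -> : cplx c ^+ 2 * cplx (Qd u) = cplx (c ^+ 2 * Qd u).
    by apply: cplx_eq; rewrite !expr2 ?(reM,imM) !re_cplx !im_cplx; ring.
  by rewrite cplx_le_cplx.
by split=> -[c0 h]; split=> // u; have := h u; have [->|] := E u.
Qed.

Lemma bddP x : bounded_operator x <-> linear x /\ exists2 c : R, 0 <= c & forall u, Qd (x u) <= c * Qd u.
Proof.
split=> -[xl]; [move=> [c /bounded_byP[c0 xc]]|move=> [c c0 xc]]; split=> //.
  by exists (c ^+ 2) => //; rewrite sqr_ge0.
exists (Num.sqrt c); apply/bounded_byP; split; first exact: sqrtr_ge0.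
by move=> u; rewrite sqr_sqrtr.
Qed.

Lemma bdd_id : bounded_operator (idfun : H -> H).
Proof. by apply/bddP; split=> //; exists 1 => // u; rewrite mul1r. Qed.

Lemma bdd_lin (a : C) x y : bounded_operator x -> bounded_operator y ->
  bounded_operator (a *: x + y).
Proof.
move=> /bddP[xl [c c0 xc]] /bddP[yl [d d0 yd]]; apply/bddP; split.
  move=> b u v.
  rewrite -[LHS]/(a *: x (b *: u + v) + y (b *: u + v)).
  rewrite -[RHS]/(b *: (a *: x u + y u) + (a *: x v + y v)).
  by rewrite xl yl !scalerDr !scalerA [b * a]mulrC addrACA.
have a0 := sqn_ge0 a.
exists (2 * sqn a * c + 2 * d) => [|u]; first nra.
rewrite -[(_ + _) u]/(a *: x u + y u).
apply: le_trans (QdD2 _ _) _; rewrite QdZ.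
have := ler_wpM2l a0 (xc u); have := yd u; lra.
Qed.

Lemma bdd_comp x y : bounded_operator x -> bounded_operator y ->
  bounded_operator (x \o y).
Proof.
move=> /bddP[xl [c c0 xc]] /bddP[yl [d d0 yd]]; apply/bddP; split.
  by move=> b u v /=; rewrite yl xl.
exists (c * d) => [|u /=]; first exact: mulr_ge0.
by apply: le_trans (xc _) _; rewrite -mulrA ler_wpM2l.
Qed.

Lemma bdd0 : bounded_operator (0 : H -> H).
Proof.
apply/bddP; split; first by move=> a u v; rewrite -[RHS]/(a *: 0 + 0) scaler0 addr0.
by exists 0 => // u; rewrite mul0r Qd0.
Qed.

Lemma is_adjointC x y : is_adjoint dot x y -> is_adjoint dot y x.
Proof. by move=> xy u v; rewrite dotC -xy -dotC. Qed.

Lemma is_adjoint_unique x y y' : is_adjoint dot x y -> is_adjoint dot x y' -> y = y'.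
Proof. by move=> h h'; apply/funext => v; apply: dot_inj => w; rewrite -h -h'. Qed.

Lemma adjoint_exists x : bounded_operator x ->
  exists y, is_adjoint dot x y /\ bounded_operator y.
Proof.
move=> /bddP[xl [c c0 xc]].
have ex v : exists w, forall u, << x u, v >> = << u, w >>.
  apply: (riesz (c := c * Qd v)) => [a u u'|u|].
  - by rewrite xl dotDl dotZl.
  - by apply: le_trans (dotCS _ _) _; rewrite mulrAC ler_wpM2r// Qd_ge0.
  - by rewrite mulr_ge0// Qd_ge0.
have [y hy] := choice ex.
have xy : is_adjoint dot x y by move=> u v; exact: hy.
exists y; split=> //; apply/bddP; split.
  move=> a u v; apply: dot_inj => w.
  by rewrite -xy !dotDr !dotZr !xy.
exists c => // v.
have h : sqn (cplx (Qd (y v))) <= Qd (x (y v)) * Qd v.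
  by rewrite -dotQ -(hy v (y v)); exact: dotCS.
rewrite sqn_cplx in h.
have h0 := Qd_ge0 (y v); have hv := Qd_ge0 v; have := xc (y v) => h1.
have [E|n0] := eqVneq (Qd (y v)) 0; first by rewrite E mulr_ge0.
have p : 0 < Qd (y v) by rewrite lt_def n0.
rewrite -(ler_pM2l p) -expr2; apply: le_trans h _.
have := ler_wpM2r hv h1; lra.
Qed.

(** Total by choice, with value 0 on operators that have no bounded adjoint, so that it can be
    written without a proof of boundedness. *)
Definition adj x : H -> H :=
  if pselect (exists y, is_adjoint dot x y /\ bounded_operator y) is left e
  then sval (cid e) else 0.

Lemma adjP x : bounded_operator x -> is_adjoint dot x (adj x).
Proof.
move=> /adjoint_exists e; rewrite /adj; case: pselect => // e'.
by case: cid => y [].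
Qed.

Lemma bdd_adj x : bounded_operator x -> bounded_operator (adj x).
Proof.
move=> /adjoint_exists e; rewrite /adj; case: pselect => // e'.
by case: cid => y [].
Qed.

Lemma adj_eq x y : bounded_operator x -> is_adjoint dot x y -> adj x = y.
Proof. by move=> bx xy; apply: is_adjoint_unique (adjP bx) xy. Qed.

Lemma dot_adjl x u v : bounded_operator x -> << adj x u, v >> = << u, x v >>.
Proof. by move=> /adjP/is_adjointC. Qed.

Lemma adjK x : bounded_operator x -> adj (adj x) = x.
Proof. by move=> bx; apply: adj_eq; [exact: bdd_adj|apply/is_adjointC/adjP]. Qed.

Lemma adjM x y : bounded_operator x -> bounded_operator y ->
  adj (x \o y) = adj y \o adj x.
Proof.
move=> bx by_; apply: adj_eq; first exact: bdd_comp.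
by move=> u v /=; rewrite adjP// adjP.
Qed.

Lemma adj_lin (a : C) x y : bounded_operator x -> bounded_operator y ->
  adj (a *: x + y) = a^* *: adj x + adj y.
Proof.
move=> bx by_; apply: adj_eq; first exact: bdd_lin.
move=> u v; rewrite -[(_ + _) u]/(a *: x u + y u).
rewrite -[(_ + _) v]/(a^* *: adj x v + adj y v).
by rewrite dotDl dotZl dotDr dotZr conjCK !adjP.
Qed.

Lemma adj_id : adj idfun = idfun.
Proof. by apply: adj_eq; first exact: bdd_id. Qed.

Definition subspace_of G := G 0 /\ forall (a : C) u v, G u -> G v -> G (a *: u + v).

Definition cl G u := exists2 g : nat -> H, (forall n, G (g n)) & cvH g u.

Lemma cl_sub G u : G u -> cl G u.
Proof. by move=> Gu; exists (fun=> u) => //; exact: cvH_cst. Qed.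

Lemma cl_ortho G u w : cl G u -> (forall g, G g -> << g, w >> = 0) -> << u, w >> = 0.
Proof.
move=> [g Gg gu] h; apply: cvC_unique (cvH_dotl w gu) _ => e e0.
exists 0%N => n _; rewrite h// subrr /sqn re0 im0; lra.
Qed.

(** [G] is not assumed closed. The projection of [u] is the limit of the Cauchy sequence in [G] that
    represents the functional [dot^~ u] on [G]. *)
Lemma projection_exists G : subspace_of G -> exists p,
  [/\ bounded_operator p, projection dot p, forall u, cl G (p u) &
      forall u g, G g -> << g, u - p u >> = 0].
Proof.
move=> [G0 Gl].
have SG : sip G dot.
  split=> // [a u v w _ _ _|u v _ _]; first by rewrite dotDl dotZl.
  exact: dotC.
have ex u : exists w, cl G w /\ forall g, G g -> << g, u - w >> = 0.
  have [|||g [Gg cg gl]] := @riesz_seq R H G dot SG (dot^~ u) (Qd u).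
  - by move=> a v w _ _; rewrite dotDl dotZl.
  - by move=> v _; rewrite mulrC; exact: dotCS.
  - exact: Qd_ge0.
  have [w gw] := H_complete cg.
  exists w; split; first by exists g.
  move=> k Gk; rewrite dotBr; apply/eqP; rewrite subr_eq0; apply/eqP.
  apply: cvC_unique (gl k Gk) _; exact: (cvQ_B sip_dot).
have [p hp] := choice ex.
have pc u : cl G (p u) by case: (hp u).
have po u g : G g -> << g, u - p u >> = 0 by case: (hp u) => _; apply.
have pu u w : cl G w -> (forall g, G g -> << g, u - w >> = 0) -> p u = w.
  move=> cw ow; apply/eqP; rewrite -subr_eq0; apply/eqP/Qd_eq0.
  rewrite /Qd.
  have h g : G g -> << g, p u - w >> = 0.
    move=> Gg; have := ow _ Gg; have := po u _ Gg; rewrite !dotBr.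
    by move=> /subr0_eq ->.
  by rewrite dotBl (cl_ortho (pc u) h) (cl_ortho cw h) subrr.
have clin (a : C) u v : cl G u -> cl G v -> cl G (a *: u + v).
  move=> [g Gg gu] [k Gk kv]; exists (fun n => a *: g n + k n) => [n|].
    exact: Gl.
  exact: cvHD (cvHZ _ gu) kv.
have plin : linear p.
  move=> a u v; apply: pu => [|g Gg]; first exact: clin.
  have -> : a *: u + v - (a *: p u + p v) = a *: (u - p u) + (v - p v).
    by rewrite scalerBr opprD addrACA.
  by rewrite dotDr dotZr !po// mulr0 addr0.
have pp u v : << p u, v >> = << p u, p v >>.
  rewrite -[in LHS](subrK (p v) v) dotDr (cl_ortho (pc u) (po v)).
  by rewrite add0r.
exists p; split=> //.
- apply/bddP; split=> //; exists 1 => // u; rewrite mul1r.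
  have := QdB u (p u); have := Qd_ge0 (u - p u).
  rewrite re_dotC pp -/(Qd (p u)); lra.
- split; last by move=> u v; rewrite pp [RHS]dotC [in RHS]pp -dotC.
  apply/funext => u /=; apply: pu => // g Gg; by rewrite subrr dot0r.
Qed.

Lemma projection_unique G p u w : subspace_of G ->
  (forall u, cl G (p u)) -> (forall u g, G g -> << g, u - p u >> = 0) ->
  cl G w -> (forall g, G g -> << g, u - w >> = 0) -> p u = w.
Proof.
move=> _ pc po cw ow; apply/eqP; rewrite -subr_eq0; apply/eqP/Qd_eq0.
have h g : G g -> << g, p u - w >> = 0.
  move=> Gg; have := ow _ Gg; have := po u _ Gg; rewrite !dotBr.
  by move=> /subr0_eq ->.
by rewrite /Qd dotBl (cl_ortho (pc u) h) (cl_ortho cw h) subrr.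
Qed.

(** [x] preserves [cl G]; as [adj x] preserves [G], the vector [x (u - p u)] stays orthogonal to
    [G]. Hence [x (p u)] is the projection of [x u]. *)
Lemma invariant_projection G (N : set (H -> H)) : subspace_of G ->
  (forall x, N x -> bounded_operator x /\ N (adj x)) ->
  (forall x u, N x -> G u -> G (x u)) ->
  exists p, [/\ commutant N p, projection dot p, forall u, cl G (p u) &
      forall u, cl G u -> p u = u].
Proof.
move=> sG Nb NG; have [p [bp pp pc po]] := projection_exists sG.
exists p; split=> // [|u cu]; last first.
  apply: (projection_unique sG) => // g Gg; by rewrite subrr dot0r.
split=> // x Nx; have [bx Nax] := Nb _ Nx.
have [xl [c c0 xc]] := (bddP _).1 bx.
apply/esym/funext => u /=; apply: (projection_unique sG) => // [|g Gg].
  have [g Gg gp] := pc u; exists (x \o g) => [n|]; first exact: NG.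
  by apply: (cvH_map (c := c)) => // v w; exact: linopB.
by rewrite -linopB// -dot_adjl// po//; exact: NG.
Qed.

End HilbertSpace.

(** * Square-summable sequences *)

Section SquareSummable.
Implicit Types (u v w : H) (x y p : H -> H) (c : R) (s t : nat -> H).

(** Extended-real valued, so that sums can be compared and rearranged without summability
    conditions; finiteness is what defines [l2]. *)
Definition N2 s : \bar R := (\sum_(n <oo) (Qd (s n))%:E)%E.

Lemma Qd_ge0E s n : (0 <= (Qd (s n))%:E)%E.
Proof. by rewrite lee_fin; exact: Qd_ge0. Qed.
Hint Resolve Qd_ge0E : core.

Lemma N2_ge0 s : (0 <= N2 s)%E.
Proof. by apply: nneseries_ge0 => n _ _. Qed.

Lemma N2_le s c : (forall n, \sum_(0 <= i < n) Qd (s i) <= c) -> (N2 s <= c%:E)%E.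
Proof.
move=> h; apply: lime_le; first by apply: is_cvg_nneseries => *.
by apply: nearW => n; rewrite sumEFin lee_fin.
Qed.

Lemma N2_ge s n : ((\sum_(0 <= i < n) Qd (s i))%:E <= N2 s)%E.
Proof. by rewrite -sumEFin; apply: nneseries_lim_ge => *. Qed.

Lemma N2_partial s c n : (N2 s <= c%:E)%E -> \sum_(0 <= i < n) Qd (s i) <= c.
Proof. by move=> h; rewrite -lee_fin; apply: le_trans (N2_ge s n) h. Qed.

Lemma N2_term s n : ((Qd (s n))%:E <= N2 s)%E.
Proof.
apply: le_trans (N2_ge s n.+1); rewrite lee_fin big_nat_recr//= lerDr.
by apply: sumr_ge0 => i _; exact: Qd_ge0.
Qed.

Lemma N2_mono s t c : 0 <= c -> (forall n, Qd (s n) <= c * Qd (t n)) ->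
  (N2 s <= c%:E * N2 t)%E.
Proof.
move=> c0 h; rewrite -nneseriesZl//; apply: lee_nneseries => // n _.
by rewrite -EFinM lee_fin.
Qed.

Lemma N2D s t : (N2 (fun n => (s n + t n)%R) <= 2%:E * N2 s + 2%:E * N2 t)%E.
Proof.
rewrite -!nneseriesZl// -nneseriesD//; try by move=> *; rewrite mule_ge0.
apply: lee_nneseries => [i _ _|n _]; first exact: (Qd_ge0E (fun n => s n + t n) i).
by rewrite -!EFinM -EFinD lee_fin QdD2.
Qed.

Lemma N2_fin s : (N2 s < +oo)%E -> N2 s = (fine (N2 s))%:E.
Proof. by move=> h; rewrite fineK// ge0_fin_numE// N2_ge0. Qed.

Lemma cvg_series_Q s : (N2 s < +oo)%E -> cvgn (series (fun n => Qd (s n))).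
Proof.
move=> /N2_fin h; apply: nondecreasing_is_cvgn.
  by apply: nondecreasing_series => n _ _; exact: Qd_ge0.
exists (fine (N2 s)) => _ [n _ <-]; apply: N2_partial; by rewrite -h.
Qed.

Lemma cvC_dot s t : (N2 s < +oo)%E -> (N2 t < +oo)%E ->
  cvC (series (fun n => << s n, t n >>)) (limn (series (fun n => << s n, t n >>))).
Proof.
move=> hs ht.
have hst : cvgn (series (fun n => Qd (s n) + Qd (t n))).
  have -> : series (fun n => Qd (s n) + Qd (t n)) =
    series (fun n => Qd (s n)) + series (fun n => Qd (t n)).
    by apply/funext => n; rewrite /series /= big_split.
  by apply: is_cvgD; exact: cvg_series_Q.
have cv (f : nat -> R) : (forall n, f n ^+ 2 <= Qd (s n) * Qd (t n)) -> cvgn (series f).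
  move=> fh; apply: normed_cvg; apply: series_le_cvg hst => n /=.
  - exact: normr_ge0.
  - by rewrite addr_ge0// Qd_ge0.
  - have h1 := Qd_ge0 (s n); have h2 := Qd_ge0 (t n).
    rewrite -ler_sqr ?nnegrE ?addr_ge0// real_normK ?num_real//.
    by have := fh n; nra.
have reS n : re (series (fun n => << s n, t n >>) n) = series (fun n => re << s n, t n >>) n.
  rewrite /series /=; elim: n => [|n IH]; first by rewrite !big_geq.
  by rewrite !big_nat_recr//= reD IH.
have imS n : im (series (fun n => << s n, t n >>) n) = series (fun n => im << s n, t n >>) n.
  rewrite /series /=; elim: n => [|n IH]; first by rewrite !big_geq.
  by rewrite !big_nat_recr//= imD IH.
have hc : cvC (series (fun n => << s n, t n >>))
   ((limn (series (fun n => re << s n, t n >>))) +i* (limn (series (fun n => im << s n, t n >>)))).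
  apply: cvC_parts.
    rewrite (_ : (fun n => _) = series (fun n => re << s n, t n >>)); last exact/funext.
    apply: cv => n; apply: le_trans (dotCS _ _); exact: sqn_re.
  rewrite (_ : (fun n => _) = series (fun n => im << s n, t n >>)); last exact/funext.
  apply: cv => n; apply: le_trans (dotCS _ _).
  by rewrite /sqn lerDr sqr_ge0.
apply/cvCP; have /cvCP := hc; exact: cvgP.
Qed.

Definition l2dot s t : C := limn (series (fun n => << s n, t n >>)).
Definition l2 : set (nat -> H) := [set s | (N2 s < +oo)%E].

Lemma l2_lin (a : C) s t : l2 s -> l2 t -> l2 (a *: s + t).
Proof.
move=> hs ht; rewrite /l2/=; apply: le_lt_trans (N2D (fun n => a *: s n) t) _.
apply: lte_add_pinfty; rewrite lte_mul_pinfty//.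
apply: le_lt_trans (N2_mono (t := s) (sqn_ge0 a) _) _.
  by move=> n; rewrite QdZ.
by rewrite lte_mul_pinfty// lee_fin sqn_ge0.
Qed.

Lemma l2_square_summable s : square_summable s <-> l2 s.
Proof.
have E : series (fun n => `|s n| ^+ 2) = (fun n => cplx (series (fun n => Qd (s n)) n)).
  apply/funext => n; rewrite /series /=; elim: n => [|n IH].
    by rewrite !big_geq.
  rewrite !big_nat_recr//= IH -Q_norm; apply: cplx_eq.
    by rewrite reD !re_cplx.
  by rewrite imD !im_cplx addr0.
split; rewrite /square_summable E.
  move=> /cvCP cv; have [N hN] := cv _ ltr01.
  pose l := re (limn (fun n => cplx (series (fun n => Qd (s n)) n))).
  apply: (@le_lt_trans _ _ (l + 1)%:E); last by rewrite ltry.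
  apply: N2_le => n.
  have := hN (maxn N n) (leq_maxl _ _) => h.
  have := sqn_re (cplx (series (fun n => Qd (s n)) (maxn N n)) -
     limn (fun n => cplx (series (fun n => Qd (s n)) n))).
  rewrite reB re_cplx -/l => h2.
  have h3 : \sum_(0 <= i < n) Qd (s i) <= series (fun n => Qd (s n)) (maxn N n).
    have : nondecreasing_seq (series (fun n => Qd (s n))).
      by apply: nondecreasing_series => i _ _; exact: Qd_ge0.
    by apply; exact: leq_maxr.
  apply: le_trans h3 _; move: h2; set r := series _ _ => h2.
  rewrite leNgt; apply/negP => h4.
  have : 1 < (r - l) ^+ 2 by rewrite -(expr1n _ 2) ltr_sqr ?nnegrE; lra.
  lra.
move=> /cvg_series_Q cv.
have h : cvC (fun n => cplx (series (fun n => Qd (s n)) n))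
   ((limn (series (fun n => Qd (s n)))) +i* 0).
  apply: cvC_parts => //; rewrite /im /=; exact: cvg_cst.
have /cvCP := h; exact: cvgP.
Qed.

Lemma sip_l2 : sip l2 l2dot.
Proof.
have cv s t : l2 s -> l2 t -> cvC (series (fun n => << s n, t n >>)) (l2dot s t).
  exact: cvC_dot.
split.
- rewrite /l2 /= (_ : N2 0 = 0%E) ?ltry//; apply: eseries0 => n _ _.
  by rewrite Qd0.
- exact: l2_lin.
- move=> a s t w hs ht hw; have hl := l2_lin a hs ht.
  apply: cvC_unique (cv _ _ hl hw) _.
  apply: cvC_eq (cvCD (cvCM a (cv _ _ hs hw)) (cv _ _ ht hw)) => n.
  rewrite /series /= mulr_sumr -big_split /=; apply: eq_bigr => i _.
  by rewrite -[(_ + t) i]/(a *: s i + t i) dotDl dotZl.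
- move=> s t hs ht; apply: cvC_unique (cv _ _ ht hs) _.
  apply: cvC_eq (cvCJ (cv _ _ hs ht)) => n.
  rewrite /series /= rmorph_sum /=; apply: eq_bigr => i _.
  by rewrite -dotC.
- move=> s hs; apply: cvC_ge0 (cv _ _ hs hs) _ => n.
  by apply: sumr_ge0 => i _; rewrite dotE exprn_ge0.
Qed.

Lemma Q_l2 s : l2 s -> N2 s = (Q l2dot s)%:E.
Proof.
move=> hs; have h := cvC_dot hs hs.
have E n : re (series (fun n => << s n, s n >>) n) = \sum_(0 <= i < n) Qd (s i).
  rewrite /series /=; elim: n => [|n IH]; first by rewrite !big_geq.
  by rewrite !big_nat_recr//= reD IH.
apply/eqP; rewrite eq_le; apply/andP; split.
  apply: N2_le => n; apply: (cvC_re_ge h); exists n => m nm.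
  rewrite E [leRHS](big_cat_nat (n := n))//= lerDl.
  by apply: sumr_ge0 => i _; exact: Qd_ge0.
rewrite (N2_fin hs) lee_fin; apply: (cvC_re_le h); exists 0%N => n _.
by rewrite E; apply: N2_partial; rewrite -N2_fin.
Qed.

Lemma l2_complete (f : nat -> nat -> H) : (forall n, l2 (f n)) -> cauchyQ l2dot f ->
  exists2 s, l2 s & cvQ l2dot f s.
Proof.
move=> lf cf.
have lB := sipB sip_l2.
have NE m n : N2 (f m - f n) = (Q l2dot (f m - f n))%:E by rewrite Q_l2//; exact: lB.
have ck k : cauchyH (fun n => f n k).
  move=> e e0; have [N hN] := cf _ e0; exists N => m n mN nN.
  rewrite -lee_fin; apply: le_trans (N2_term (f m - f n) k) _.
  by rewrite NE lee_fin; exact: hN.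
have [s hs] := choice (fun k => H_complete (ck k)).
have key e : 0 < e -> ev (fun n => (N2 (f n - s)%R <= e%:E)%E).
  move=> e0; have [N hN] := cf _ e0; exists N => n nN.
  apply: N2_le => K.
  have reS (v : nat -> H) : re (\sum_(0 <= i < K) << v i, v i >>) = \sum_(0 <= i < K) Qd (v i).
    elim: K => [|K IH]; first by rewrite !big_geq.
    by rewrite !big_nat_recr//= reD IH.
  rewrite -reS.
  have cvi i : cvC (fun m => << f n i - f m i, f n i - f m i >>) << f n i - s i, f n i - s i >>.
    apply: cvH_dot; apply: cvHD; first exact: cvH_cst.
    by have := cvHZ (-1) (hs i); under eq_fun do rewrite scaleN1r; rewrite scaleN1r.
  apply: (cvC_re_le (cvC_sum (index_iota 0 K) cvi)); exists N => m mN.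
  rewrite (reS (fun i => f n i - f m i)); apply: (N2_partial (s := f n - f m)).
  by rewrite NE lee_fin; exact: hN.
have [N hN] := key _ ltr01.
have ls : l2 s.
  rewrite (_ : s = -1 *: (f N - s) + f N); last first.
    by rewrite scaleN1r opprB subrK.
  by apply: l2_lin => //; apply: le_lt_trans (hN _ (leqnn N)) _; rewrite ltry.
exists s => // e e0; apply: evW (key _ e0) => n.
by rewrite Q_l2 ?lee_fin//; exact: lB.
Qed.

(** A countable sum of vector functionals [y |-> N2 (y \o v j)] is again of this kind: the double
    sequence is read along a bijection of [nat] with pairs, the same for all [g]. *)
Lemma N2_flatten (v : nat -> nat -> H) : exists s, forall g : H -> H,
  N2 (g \o s) = (\sum_(j <oo) N2 (g \o v j))%E.
Proof.
have /card_esym/card_set_bijP[e be] := card_nat2.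
exists (fun n => v (e n).1 (e n).2) => g.
rewrite nneseries_esumT; last by move=> j; exact: N2_ge0.
under eq_esum do rewrite /N2 nneseries_esumT//.
rewrite esum_esum; last by move=> *; rewrite lee_fin; exact: Qd_ge0.
transitivity (\esum_(k in [set: nat * nat]) (Qd (g (v k.1 k.2)))%:E).
  rewrite (reindex_esum setT setT e _ be) /N2; apply: nneseries_esumT => n.
  by rewrite lee_fin; exact: Qd_ge0.
by congr (esum _ _); apply/seteqP; split.
Qed.

End SquareSummable.

(** * Von Neumann algebras and normal functionals *)

Section Algebra.
Implicit Types (u v w : H) (x y p : H -> H) (c : R) (s t : nat -> H).

Lemma bdd_linear x : bounded_operator x -> linear x.
Proof. by move=> /bddP[]. Qed.

Lemma sip_op_ge0 x : linear x -> op_ge0 dot x -> sip [set: H] (fun u v => << x u, v >>).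
Proof.
move=> xl x0; apply: sip_positive => //.
- by move=> a u v w _ _ _; rewrite xl dotDl dotZl.
- by move=> a u v w _ _ _; rewrite dotDr dotZr.
Qed.

Lemma op_ge0_adjoint x : linear x -> op_ge0 dot x -> is_adjoint dot x x.
Proof.
move=> xl x0 u v.
by rewrite [RHS]dotC -(sip_sym (sip_op_ge0 xl x0) (inT v) (inT u)).
Qed.

(** The operator inequality [x^2 <= c x]: Cauchy-Schwarz for the form [dot (x u) v], tested at
    [v = x u]. *)
Lemma op_ge0_bound x c : linear x -> op_ge0 dot x ->
  (forall u, re << x u, u >> <= c * Qd u) -> 0 <= c ->
  forall u, Qd (x u) <= c * re << x u, u >>.
Proof.
move=> xl x0 xc c0 u.
have h := CS (sip_op_ge0 xl x0) (inT u) (inT (x u)).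
move: h; rewrite dotQ sqn_cplx /Q => h.
have h1 := xc (x u); have h2 := Qd_ge0 (x u).
have h3 : 0 <= re << x u, u >> by have /cplx_ge0P[] := x0 u.
have [E|n0] := eqVneq (Qd (x u)) 0; first by rewrite E mulr_ge0.
have p : 0 < Qd (x u) by rewrite lt_def n0.
rewrite -(ler_pM2r p) -expr2; apply: le_trans h _.
have := ler_wpM2l h3 h1; lra.
Qed.

Lemma l2_map x s : bounded_operator x -> l2 s -> l2 (x \o s).
Proof.
move=> /bddP[_ [c c0 xc]] ls; rewrite /l2/=.
apply: le_lt_trans (N2_mono (t := s) c0 (fun n => xc (s n))) _.
by rewrite lte_mul_pinfty// lee_fin.
Qed.

Lemma l2dot_adj x s t : bounded_operator x -> l2dot (x \o s) t = l2dot s (adj x \o t).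
Proof.
move=> bx; rewrite /l2dot; congr (limn (series _)); apply/funext => n /=.
by rewrite (adjP bx).
Qed.

Section Commutant.
Context (N : set (H -> H)) (bN : forall x, N x -> bounded_operator x).

Lemma commutant_lin (a : C) x y : commutant N x -> commutant N y ->
  commutant N (a *: x + y).
Proof.
move=> [bx cx] [by_ cy]; split=> [|b Nb]; first exact: bdd_lin.
have bl := bdd_linear (bN Nb).
apply/funext => u; rewrite -[LHS]/(b (a *: x u + y u)) bl.
by rewrite -[b (x u)]/((b \o x) u) cx// -[b (y u)]/((b \o y) u) cy.
Qed.

Lemma commutant_comp x y : commutant N x -> commutant N y -> commutant N (x \o y).
Proof.
move=> [bx cx] [by_ cy]; split=> [|b Nb]; first exact: bdd_comp.
by rewrite compA cx// -compA cy.
Qed.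

Lemma commutant_adj x : (forall y, N y -> N (adj y)) -> commutant N x ->
  commutant N (adj x).
Proof.
move=> aN [bx cx]; split=> [|b Nb]; first exact: bdd_adj.
rewrite -{1 2}[b](adjK (bN Nb)) -!adjM//; try exact/bN/aN.
by rewrite cx//; exact: aN.
Qed.

End Commutant.

Section VN.
Context (M : set (H -> H)) (vM : von_neumann_algebra dot M).

Lemma vn_bdd x : M x -> bounded_operator x.
Proof. by rewrite -(vna_bicommutant vM) => -[]. Qed.

Lemma comm_bdd x : commutant M x -> bounded_operator x.
Proof. by case. Qed.

Lemma vn_linear x : M x -> linear x.
Proof. by move=> /vn_bdd/bdd_linear. Qed.

Lemma vn_comm x y u : M x -> commutant M y -> x (y u) = y (x u).
Proof. by move=> Mx [_ /(_ _ Mx) h]; rewrite -[LHS]/((x \o y) u) h. Qed.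

Lemma vn_mem x : bounded_operator x ->
  (forall y u, commutant M y -> y (x u) = x (y u)) -> M x.
Proof.
move=> bx h; rewrite -(vna_bicommutant vM); split=> // y My.
by apply/funext => u /=; exact: h.
Qed.

Lemma vn_id : M idfun.
Proof. by apply: vn_mem; first exact: bdd_id. Qed.

Lemma vn_lin (a : C) x y : M x -> M y -> M (a *: x + y).
Proof.
have bN b : commutant M b -> bounded_operator b by case.
by have := @commutant_lin (commutant M) bN a x y; rewrite (vna_bicommutant vM); exact.
Qed.

Lemma vn_comp x y : M x -> M y -> M (x \o y).
Proof.
have bN b : commutant M b -> bounded_operator b by case.
by have := @commutant_comp (commutant M) bN x y; rewrite (vna_bicommutant vM); exact.
Qed.

Lemma vn_adj x : M x -> M (adj x).
Proof.
move=> Mx; have [y My xy] := vna_star vM Mx.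
by rewrite (adj_eq (vn_bdd Mx) xy).
Qed.

Lemma vnD x y : M x -> M y -> M (x + y).
Proof. by move=> Mx My; rewrite -[x]scale1r; exact: vn_lin. Qed.
Lemma vn0 : M 0.
Proof. by rewrite -(addNr idfun) -scaleN1r; apply: vn_lin; exact: vn_id. Qed.
Lemma vnZ (a : C) x : M x -> M (a *: x).
Proof. by move=> Mx; rewrite -[_ *: _]addr0; apply: vn_lin => //; exact: vn0. Qed.
Lemma vnB x y : M x -> M y -> M (x - y).
Proof. by move=> Mx My; rewrite addrC -scaleN1r; exact: vn_lin. Qed.

Lemma comm_adj x : commutant M x -> commutant M (adj x).
Proof. by apply: commutant_adj; [exact: vn_bdd|exact: vn_adj]. Qed.

(** The projection commutes with [commutant M], so the bicommutant property puts it in [M]. *)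
Lemma vn_projection (G : set H) : subspace_of G ->
  (forall y u, commutant M y -> G u -> G (y u)) ->
  exists p, [/\ M p, projection dot p, forall u, cl G (p u) &
    forall u, cl G u -> p u = u].
Proof.
move=> sG Gi; have [|p [cp pp pc pg]] := invariant_projection sG _ Gi.
  by move=> y cy; split; [case: cy|exact: comm_adj].
by exists p; split=> //; rewrite -(vna_bicommutant vM).
Qed.

Lemma vn_limit (x : nat -> H -> H) y c : (forall n, M (x n)) -> 0 <= c ->
  (forall n u, Qd (x n u) <= c * Qd u) ->
  (forall u, cvH (fun n => x n u) (y u)) -> M y.
Proof.
move=> Mx c0 xc xy; apply: vn_mem.
  apply/bddP; split; last first.
    by exists c => // u; apply: (cvH_le (xy u)) => n.
  move=> a u v; apply: (cvH_unique (xy (a *: u + v))).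
  apply: cvH_eq (cvHD (cvHZ a (xy u)) (xy v)) => n.
  by rewrite (vn_linear (Mx n)).
move=> b u cb; have /bddP[bl [d d0 bd]] := comm_bdd cb.
have /cvH_unique := cvH_map (fun u v => linopB u v bl) d0 bd (xy u).
apply; apply: cvH_eq (xy (b u)) => n; exact: (vn_comm u (Mx n) cb).
Qed.

Lemma l2dot_lin (a : C) x y s t : M x -> M y -> l2 s -> l2 t ->
  l2dot ((a *: x + y) \o s) t = a * l2dot (x \o s) t + l2dot (y \o s) t.
Proof.
move=> Mx My ls lt; have h1 := l2_map (vn_bdd Mx) ls; have h2 := l2_map (vn_bdd My) ls.
exact: (sip_lin sip_l2 a h1 h2 lt).
Qed.

Lemma sip_l2_map s : l2 s -> sip M (fun x y => l2dot (x \o s) (y \o s)).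
Proof.
move=> ls; have S := sip_l2; split.
- exact: vn0.
- exact: vn_lin.
- by move=> a x y w Mx My Mw; apply: l2dot_lin => //; apply: l2_map => //; exact: vn_bdd.
- by move=> x y Mx My; apply: (sip_sym S); apply: l2_map => //; exact: vn_bdd.
- by move=> x Mx; apply: (sip_ge0 S); apply: l2_map => //; exact: vn_bdd.
Qed.

Definition linear_on (f : (H -> H) -> C) :=
  forall (a : C) x y, M x -> M y -> f (a *: x + y) = a * f x + f y.

(** Here [M] carries the form [<x s, y s>], whose completion is realized inside [l2]: the operators
    [g n] need not converge, but [g n \o s] does, and [w] is its limit. *)
Lemma riesz_l2 (f : (H -> H) -> C) s c : linear_on f -> l2 s -> 0 <= c ->
  (forall x, M x -> ((sqn (f x))%:E <= c%:E * N2 (x \o s))%E) ->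
  exists (w : nat -> H) (g : nat -> H -> H), [/\ l2 w, forall n, M (g n),
    cvQ l2dot (fun n => g n \o s) w & forall x, M x -> f x = l2dot (x \o s) w].
Proof.
move=> fl ls c0 fc.
have lx x : M x -> l2 (x \o s) by move=> Mx; apply: l2_map => //; exact: vn_bdd.
have [|||g [Mg cg gf]] := @riesz_seq R _ M _ (sip_l2_map ls) f c => //.
  move=> x Mx; have := fc _ Mx; rewrite (Q_l2 (lx _ Mx)) -EFinM lee_fin.
  exact.
have [|//|w lw gw] := l2_complete (f := fun n => g n \o s).
  by move=> n; exact: lx.
exists w, g; split=> // x Mx.
apply: cvC_unique (gf _ Mx) _.
by apply: (cvQ_B sip_l2) gw; [exact: lx|move=> n; exact: lx|].
Qed.

(** Positivity on the elements [adj x \o x] is what Cauchy-Schwarz uses, so no square root of a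
    positive operator has to be taken. *)
Definition posf (f : (H -> H) -> C) :=
  linear_on f /\ forall x, M x -> 0 <= f (adj x \o x).

Lemma posf_sip f : posf f -> sip M (fun x y => f (adj y \o x)).
Proof.
move=> [fl f0]; apply: sip_positive => //.
- exact: vn0.
- exact: vn_lin.
- move=> a x y w Mx My Mw.
  have Ma := vn_adj Mw.
  rewrite (_ : adj w \o (a *: x + y) = a *: (adj w \o x) + (adj w \o y)).
    by rewrite fl//; exact: vn_comp.
  by apply/funext => u; exact: (vn_linear Ma).
- move=> a x y w Mx My Mw.
  rewrite (adj_lin _ (vn_bdd Mx) (vn_bdd My)).
  by rewrite -fl//; apply: vn_comp => //; exact: vn_adj.
Qed.

Lemma posf_CS f x y : posf f -> M x -> M y ->
  sqn (f (adj y \o x)) <= re (f (adj x \o x)) * re (f (adj y \o y)).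
Proof. by move=> pf Mx My; exact: (CS (posf_sip pf)). Qed.

Lemma posf_CS1 f x : posf f -> M x ->
  sqn (f x) <= re (f (adj x \o x)) * re (f idfun).
Proof.
move=> pf Mx; have := posf_CS pf Mx vn_id.
by rewrite adj_id.
Qed.

Lemma posf_ge0 f x : posf f -> M x -> 0 <= re (f (adj x \o x)).
Proof. by move=> [_ /[apply]/cplx_ge0P[]]. Qed.

Lemma posf_real f x : posf f -> M x -> f (adj x \o x) = cplx (re (f (adj x \o x))).
Proof. by move=> [_ /[apply]/cplx_ge0P[h _]]; exact: cplx_re. Qed.

Lemma posf_1_ge0 f : posf f -> 0 <= re (f idfun).
Proof. by move=> pf; have := posf_ge0 pf vn_id; rewrite adj_id. Qed.

(* Under the Riesz vector [w] one has [<x zeta, y w> = f (y^* x)], so the norm of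
   [y w] is controlled by the Cauchy-Schwarz inequality for [f]. *)
Lemma posf_minorant f s : posf f -> l2 s ->
  (forall y, M y -> ((re (f (adj y \o y)))%:E <= N2 (y \o s))%E) ->
  exists w : nat -> H, [/\ l2 w, forall x, M x -> f x = l2dot (x \o s) w &
    forall y, M y -> (N2 (y \o w) <= (re (f (adj y \o y)))%:E)%E].
Proof.
move=> pf ls fs; have [fl f0] := pf; have S := sip_l2.
have f1 := posf_1_ge0 pf.
have lx t x : l2 t -> M x -> l2 (x \o t) by move=> lt Mx; apply: l2_map => //; exact: vn_bdd.
have [|w [g [lw Mg gw fw]]] := riesz_l2 fl ls f1.
  move=> x Mx; apply: le_trans (lee_wpmul2l _ (fs _ Mx)); last by rewrite lee_fin.
  by rewrite -EFinM lee_fin mulrC; exact: posf_CS1.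
exists w; split=> // y My.
have lyw := lx _ _ lw My.
rewrite (Q_l2 lyw) lee_fin.
set q := Q l2dot (y \o w); set r := re _.
have q0 : 0 <= q by exact: (Q_ge0 S).
have r0 : 0 <= r by exact: posf_ge0.
have Mya := vn_adj My.
have gyw : cvQ l2dot (fun n => y \o (g n \o s)) (y \o w).
  have /bddP[yl [d d0 yd]] := vn_bdd My.
  move=> e e0; have h : 0 < e / (d + 1) by rewrite divr_gt0//; lra.
  apply: evW (gw _ h) => n.
  have lg : l2 (g n \o s - w) by apply: (sipB S) => //; exact: lx.
  have -> : (y \o (g n \o s)) - (y \o w) = y \o (g n \o s - w).
    by apply/funext => k; rewrite -[RHS]/(y (g n (s k) - w k)) linopB.
  rewrite -lee_fin -(Q_l2 lg) => hn.
  have lyg : l2 (y \o (g n \o s - w)) by exact: lx.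
  rewrite -lee_fin -(Q_l2 lyg).
  apply: le_trans (N2_mono d0 (fun k => yd ((g n \o s - w) k))) _.
  have dE : (0 <= d%:E)%E by rewrite lee_fin.
  apply: le_trans (lee_wpmul2l dE hn) _.
  rewrite -EFinM lee_fin mulrA ler_pdivrMr; last by lra.
  nra.
have lyg n : l2 (y \o (g n \o s)) by apply: (lx) => //; exact: lx.
(* By Cauchy-Schwarz for [f] and the domination by [s]. As [g n \o s] tends to [w], the two sides
   become [2 q] and [r + q]. *)
have key n : 2 * re (l2dot (y \o w) (y \o (g n \o s))) <=
    r + Q l2dot (y \o (g n \o s)).
  have h : sqn (l2dot (y \o w) (y \o (g n \o s))) <= r * Q l2dot (y \o (g n \o s)).
    rewrite (sip_sym S (lyg n) lyw) sqnJ.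
    have -> : l2dot (y \o (g n \o s)) (y \o w) = f (adj y \o (y \o g n)).
      rewrite fw; last by apply: vn_comp => //; exact: vn_comp.
      rewrite -[(adj y \o (y \o g n)) \o s]/(adj y \o (y \o (g n \o s))).
      by rewrite [RHS]l2dot_adj ?adjK//; exact: vn_bdd.
    have Myg := vn_comp My (Mg n).
    apply: le_trans (posf_CS pf Myg My) _; rewrite mulrC ler_wpM2l//.
    by rewrite -lee_fin -(Q_l2 (lyg n)); exact: fs.
  have hb : 0 <= Q l2dot (y \o (g n \o s)) by exact: (Q_ge0 S).
  have := sqn_re (l2dot (y \o w) (y \o (g n \o s))).
  move: h hb; set a := re _; set b := Q _ _; set sq := sqn _ => h hb h2.
  rewrite leNgt; apply/negP => h3.
  have : (r + b) ^+ 2 < (2 * a) ^+ 2 by rewrite ltr_sqr ?nnegrE; lra.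
  have := sqr_ge0 (r - b); nra.
have c1 := cvQ_B S lyw lyg lyw gyw.
have c2 := cvQ_diag S lyg lyw gyw.
have c3 := cvCD (cvCM (cplx 2) c1) (cvCM (-1) c2).
have : re (cplx 2 * l2dot (y \o w) (y \o w) + -1 * l2dot (y \o w) (y \o w)) <= r.
  apply: (cvC_re_le c3); exists 0%N => n _.
  rewrite reD mulN1r reN reM re_cplx im_cplx mul0r subr0.
  by have := key n; rewrite /Q; lra.
rewrite reD mulN1r reN reM re_cplx im_cplx mul0r subr0 -/(Q l2dot (y \o w)) -/q.
lra.
Qed.

End VN.
End Algebra.

(** * Positive normal functionals as sums of vector functionals *)

Section Functionals.
Implicit Types (u v : H) (x y p : H -> H) (c : R) (s t w : nat -> H).

(** The finite list is continued by zero sequences before flattening, whence the condition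
    [g 0 = 0]. *)
Lemma N2_merge (L : seq (nat -> H)) : exists s, forall g : H -> H, g 0 = 0 ->
  N2 (g \o s) = (\sum_(t <- L) N2 (g \o t))%E.
Proof.
have [s hs] := N2_flatten (nth (fun=> 0 : H) L).
exists s => g g0; rewrite hs.
rewrite (nneseries_split 0 (size L)); last by move=> k _; exact: N2_ge0.
rewrite [X in (_ + X)%E]eseries0 ?adde0 ?add0n.
  by rewrite (big_nth (fun=> 0 : H)).
move=> k Lk _; rewrite nth_default//.
by apply: eseries0 => i _ _ /=; rewrite g0 Qd0.
Qed.

Section Vector.
Context (M : set (H -> H)) (vM : von_neumann_algebra dot M).

(* Greedily subtracting the vector functionals of posf_minorant exhausts f,
   because the norms of the vectors telescope against f idfun. *)
Lemma posf_vector (f : (H -> H) -> C) s : posf M f -> l2 s ->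
  (forall y, M y -> ((re (f (adj y \o y)))%:E <= N2 (y \o s))%E) ->
  exists2 t, l2 t & forall y, M y -> (re (f (adj y \o y)))%:E = N2 (y \o t).
Proof.
move=> pf ls fs.
pose good (g : (H -> H) -> C) := posf M g /\
  forall y, M y -> ((re (g (adj y \o y)))%:E <= N2 (y \o s))%E.
pose wit g w := [/\ l2 w, forall x, M x -> g x = l2dot (x \o s) w &
    forall y, M y -> (N2 (y \o w) <= (re (g (adj y \o y)))%:E)%E].
have exW g : exists w, good g -> wit g w.
  (* Outside [good] the zero sequence serves as default, so that [W] is a total function and [next]
     can be iterated. *)
  have [gg|ng] := pselect (good g); last by exists (fun=> 0).
  have [pg gs] := gg.
  by have [w hw] := posf_minorant vM pg ls gs; exists w.
have [W hW] := choice exW.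
pose next g := fun x => g x - l2dot (x \o W g) (W g).
have lx t x : l2 t -> M x -> l2 (x \o t) by move=> lt /(vn_bdd vM) bx; exact: l2_map.
have nextE g y : good g -> M y ->
    re (g (adj y \o y)) = re (next g (adj y \o y)) + Q l2dot (y \o W g) /\
    0 <= next g (adj y \o y).
  move=> gg My; have [lw gw mw] := hW _ gg; have [pg gs] := gg.
  have E : l2dot (adj y \o y \o W g) (W g) = cplx (Q l2dot (y \o W g)).
    rewrite -(QE sip_l2 (lx _ _ lw My)).
    rewrite -[adj y \o y \o W g]/(adj y \o (y \o W g)).
    rewrite l2dot_adj ?adjK//; [exact: (vn_bdd vM)|].
    exact/(vn_bdd vM)/(vn_adj vM).
  split; first by rewrite /next E reB re_cplx subrK.
  rewrite /next E (posf_real vM pg My); apply/cplx_ge0P.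
  rewrite imB reB !im_cplx !re_cplx subr0; split=> //; rewrite subr_ge0 -lee_fin.
  by rewrite -(Q_l2 (lx _ _ lw My)); exact: mw.
have good_next g : good g -> good (next g).
  move=> gg; have [lw gw mw] := hW _ gg; have [pg gs] := gg.
  split; first split.
  - move=> a x y Mx My; rewrite /next (l2dot_lin vM)// (pg.1 a x y Mx My).
    by ring.
  - by move=> y My; case: (nextE _ _ gg My).
  - move=> y My; apply: le_trans (gs _ My); rewrite lee_fin.
    have [-> _] := nextE _ _ gg My; rewrite lerDl.
    by apply: (Q_ge0 sip_l2); exact: lx.
pose F n := iter n next f.
have gF n : good (F n) by elim: n => [|n IH]; [split|exact: good_next].
pose w n := W (F n).
have lw n : l2 (w n) by case: (hW _ (gF n)).
have step n y : M y -> re (F n (adj y \o y)) =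
    re (F n.+1 (adj y \o y)) + Q l2dot (y \o w n).
  by move=> My; case: (nextE _ _ (gF n) My).
have part n y : M y -> \sum_(0 <= j < n) Q l2dot (y \o w j) =
    re (f (adj y \o y)) - re (F n (adj y \o y)).
  move=> My; elim: n => [|n IH]; first by rewrite big_geq// subrr.
  by rewrite big_nat_recr//= IH (step n y My); ring.
have Fge n y : M y -> 0 <= re (F n (adj y \o y)).
  by move=> My; have [pg _] := gF n; exact: (posf_ge0 vM pg).
have sumE n y : M y -> (\sum_(0 <= j < n) N2 (y \o w j) =
    (re (f (adj y \o y)) - re (F n (adj y \o y)))%:E)%E.
  move=> My; rewrite -part// -sumEFin; apply: eq_bigr => j _.
  by rewrite Q_l2//; exact: lx.
(* The squared norms of the [w n] sum to at most [f idfun], so some [w n] is small, and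
   [F n (adj y \o y)] is the pairing of [adj y \o y \o s] with it. *)
have small y : M y -> forall e : R, 0 < e -> exists n, re (F n (adj y \o y)) <= e.
  move=> My e e0.
  have lyy : l2 (adj y \o y \o s).
    by apply: lx => //; apply: (vn_comp vM) => //; exact: (vn_adj vM).
  pose K := Q l2dot (adj y \o y \o s).
  have K0 : 0 <= K by exact: (Q_ge0 sip_l2).
  have h : 0 < e ^+ 2 / (K + 1) by rewrite divr_gt0 ?exprn_gt0//; lra.
  have [n hn] : exists n, Q l2dot (w n) <= e ^+ 2 / (K + 1).
    apply: (@bounded_sum_small R (fun n => Q l2dot (w n)) (re (f idfun))) h => n.
    have := part n _ (vn_id vM).
    rewrite adj_id -[idfun \o idfun]/(idfun : H -> H).
    under eq_bigr do rewrite -[idfun \o w _]/(w _).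
    move=> ->; have := Fge n _ (vn_id vM).
    by rewrite adj_id -[idfun \o idfun]/(idfun : H -> H); lra.
  exists n; have [_ Fw _] := hW _ (gF n).
  rewrite Fw; last by apply: (vn_comp vM) => //; exact: (vn_adj vM).
  have h1 := CS sip_l2 lyy (lw n).
  have h2 := sqn_re (l2dot (adj y \o y \o s) (w n)).
  have h3 : K * Q l2dot (w n) <= e ^+ 2.
    apply: le_trans (ler_wpM2l K0 hn) _.
    rewrite mulrA ler_pdivrMr; last by lra.
    by have := sqr_ge0 e; nra.
  rewrite leNgt; apply/negP => h4.
  have : e ^+ 2 < re (l2dot (adj y \o y \o s) (w n)) ^+ 2.
    by rewrite ltr_sqr ?nnegrE; move: h4; rewrite /w; lra.
  by move: h1 h2 h3; rewrite /K /w; lra.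
have [t ht] := N2_flatten w.
have key y : M y -> (re (f (adj y \o y)))%:E = N2 (y \o t).
  move=> My; rewrite ht; apply/eqP; rewrite eq_le; apply/andP; split.
    apply/lee_addgt0Pr => e e0; have [n hn] := small _ My _ e0.
    apply: (@le_trans _ _ (\sum_(0 <= j < n) N2 (y \o w j) + e%:E)%E).
      by rewrite sumE// -EFinD lee_fin; lra.
    rewrite leeD2r//; apply: nneseries_lim_ge => j _ _; exact: N2_ge0.
  apply: lime_le; first by apply: is_cvg_nneseries => j _ _; exact: N2_ge0.
  apply: nearW => n; rewrite sumE// lee_fin.
  by have := Fge n _ My; lra.
exists t => //; rewrite /l2/= -[t]/(idfun \o t) -key ?ltry//.
exact: (vn_id vM).
Qed.

Lemma predual_evalE x (q : predual_index H) :
  predual_eval dot x q = l2dot (x \o (sval q).1) (sval q).2.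
Proof. by []. Qed.

Lemma cvg_weakstar (F : set_system (H -> H)) (x : H -> H) : Filter F ->
  (forall q : predual_index H, (fun y => predual_eval dot y q : C) @ F --> (predual_eval dot x q : C)) ->
  F --> (x : weakstar dot).
Proof.
move=> FF Fx.
have cvp : (fun y => predual_eval dot y : {ptws predual_index H -> C}) @ F -->
    (predual_eval dot x : {ptws predual_index H -> C}).
  apply/cvg_sup => q A [_ [[B Bop <-] Bx] BA].
  have /Fx FB : nbhs (predual_eval dot x q : C) B by exact: open_nbhs_nbhs.
  exact: filterS BA FB.
move=> A [_ [[B Bop <-] Bx] BA].
have /cvp FB : nbhs (predual_eval dot x : {ptws predual_index H -> C}) B.
  exact: open_nbhs_nbhs.
exact: filterS BA FB.
Qed.

Lemma continuous_predual_eval (q : predual_index H) (x : weakstar dot) :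
  (fun y : weakstar dot => predual_eval dot y q : C) @ nbhs x --> (predual_eval dot x q : C).
Proof.
have h := @initial_continuous _ _ (predual_eval dot) x.
have Fx := @nbhs_filter _ x.
have FF := @fmap_filter _ _ (predual_eval dot) _ Fx.
have hc := @initial_continuous _ _ (fun f : predual_index H -> C => f q) (predual_eval dot x).
move=> A nA; have hq := (cvg_sup _ _ FF).1 h q.
exact: (hq _ (hc _ nA)).
Qed.

(** The sets [B L e] generate a filter that contains [M] and converges weak* to 0, so continuity at
    0 puts one of them into the preimage of the unit disc. *)
Lemma normal_functional_nbhs (f : (H -> H) -> C) : linear_on M f ->
  normal_functional dot M f ->
  exists (L : seq (predual_index H)) (e : R), 0 < e /\ forall x, M x ->
    \sum_(q <- L) sqn (predual_eval dot x q : C) <= e -> sqn (f x) <= 1.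
Proof.
move=> fl /subspace_continuousP fc.
pose B (L : seq (predual_index H)) (e : R) : set (H -> H) :=
  [set x | M x /\ \sum_(q <- L) sqn (predual_eval dot x q : C) <= e].
pose F : set_system (H -> H) := [set A | exists L (e : R), 0 < e /\ B L e `<=` A].
have sq0 (L : seq (predual_index H)) x :
    0 <= \sum_(q <- L) sqn (predual_eval dot x q : C).
  by apply: sumr_ge0 => q _; exact: sqn_ge0.
have FF : Filter F.
  split.
  - by exists [::], 1.
  - move=> A A' [L [e [e0 BA]]] [L' [e' [e0' BA']]].
    exists (L ++ L'), (Num.min e e'); split; first by rewrite lt_min e0.
    move=> x [Mx]; rewrite big_cat/= le_min => /andP[h1 h2].
    have h3 := sq0 L x; have h4 := sq0 L' x.
    by split; [apply: BA|apply: BA']; split=> //; lra.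
  - by move=> A A' AA' [L [e [e0 BA]]]; exists L, e; split=> // x /BA/AA'.
have f0 : f 0 = 0.
  have M0 := vn0 vM.
  have := fl 1 0 0 M0 M0; rewrite scale1r mul1r addr0 -[LHS]addr0.
  by move/addrI.
have pe0 q : predual_eval dot 0 q = 0 :> C.
  rewrite predual_evalE; have [h1 h2] := svalP q.
  by apply: (B0l sip_l2); apply/l2_square_summable.
have F0 : F --> (0 : weakstar dot).
  apply: cvg_weakstar => q; rewrite pe0; apply/cvgrPdist_lt => e /cplx_gt0[-> e0].
  exists [:: q], (re e ^+ 2 / 2); split; first by rewrite divr_gt0// exprn_gt0.
  move=> x [Mx]; rewrite big_seq1 /= sub0r normrN norm_lt_sqn// => h.
  by apply: le_lt_trans h _; have := exprn_gt0 2 e0; lra.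
have /cvgrPdist_lt /(_ 1 ltr01) h := fc _ (vn0 vM).
have FM : F M by exists [::], 1; split=> // x [].
have [L [e [e0 BL]]] : F [set x | M x -> `|f 0 - f x| < 1].
  by apply: F0; exact: h.
exists L, e; split=> // x Mx hx.
have := BL x (conj Mx hx) Mx; rewrite f0 sub0r normrN.
rewrite -[X in _ < X]/(cplx 1) norm_lt_sqn// expr1n; exact: ltW.
Qed.

Lemma sum_mul_le (I : Type) (L : seq I) (a b : I -> R) :
  (forall i, 0 <= a i) -> (forall i, 0 <= b i) ->
  \sum_(i <- L) a i * b i <= (\sum_(i <- L) (a i + b i)) ^+ 2.
Proof.
move=> a0 b0.
have s0 K : 0 <= \sum_(i <- K) (a i + b i).
  by apply: sumr_ge0 => i _; rewrite addr_ge0.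
elim: L => [|i L IH]; first by rewrite !big_nil expr0n.
rewrite !big_cons; have := s0 L; have := a0 i; have := b0 i; nra.
Qed.

(** Homogeneity: a multiple [k] of [adj y \o y] enters the neighbourhood of 0 on which [f] is at
    most 1, because each functional defining it pairs [y \o xi] with [y \o eta]. The bounding
    sequence collects all these [xi] and [eta], rescaled. *)
Lemma posf_normal_bound (f : (H -> H) -> C) : posf M f ->
  normal_functional dot M f ->
  exists2 s, l2 s & forall y, M y -> ((re (f (adj y \o y)))%:E <= N2 (y \o s))%E.
Proof.
move=> pf nf; have [fl f0] := pf.
have [L [e [e0 hL]]] := normal_functional_nbhs fl nf.
pose d := Num.min 1 e.
have d0 : 0 < d by rewrite lt_min ltr01.
have d1 : d <= 1 by rewrite ge_min lexx.
have d2 : d <= e by rewrite ge_min lexx orbT.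
have lq1 (q : predual_index H) : l2 (sval q).1.
  by apply/l2_square_summable; case: (svalP q).
have lq2 (q : predual_index H) : l2 (sval q).2.
  by apply/l2_square_summable; case: (svalP q).
have [s hs] := N2_merge (flatten [seq [:: (sval q).1; (sval q).2] | q <- L]).
pose b y := \sum_(q <- L) (Q l2dot (y \o (sval q).1) + Q l2dot (y \o (sval q).2)).
have lx t x : l2 t -> M x -> l2 (x \o t) by move=> lt /(vn_bdd vM) bx; exact: l2_map.
have Qge y t : M y -> l2 t -> 0 <= Q l2dot (y \o t).
  by move=> My lt; apply: (Q_ge0 sip_l2); exact: lx.
have N2s y : M y -> N2 (y \o s) = (b y)%:E.
  move=> My; rewrite hs; last by rewrite linop0//; exact: (vn_linear vM My).
  rewrite big_flatten/= big_map /b -sumEFin; apply: eq_bigr => q _.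
  by rewrite big_cons big_seq1 EFinD !Q_l2//; exact: lx.
have ls : l2 s by rewrite /l2/= -[s]/(idfun \o s) N2s ?ltry//; exact: (vn_id vM).
have bound y : M y -> re (f (adj y \o y)) <= b y / d.
  move=> My; have Mya := vn_adj vM My; have Myy := vn_comp vM Mya My.
  have b0 : 0 <= b y.
    by apply: sumr_ge0 => q _; rewrite addr_ge0// Qge.
  apply: (@ler_addeps _ _ _ d^-1) => [|r r0]; first by rewrite invr_ge0 ltW.
  (* [r] keeps the denominator positive when [b y = 0]; it tends to 0 at the end. *)
  pose k := d / (b y + r).
  have p : 0 < b y + r by lra.
  have k0 : 0 < k by rewrite divr_gt0.
  have := hL (cplx k *: (adj y \o y)) (vnZ vM _ Myy).
  have pe q : sqn (predual_eval dot (cplx k *: (adj y \o y)) q : C) <=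
      k ^+ 2 * (Q l2dot (y \o (sval q).1) * Q l2dot (y \o (sval q).2)).
    rewrite predual_evalE.
    have -> : (cplx k *: (adj y \o y)) \o (sval q).1 =
       cplx k *: (adj y \o y \o (sval q).1) by [].
    rewrite (BZl sip_l2) ?sqnM ?sqn_cplx//; last exact: lx.
    rewrite ler_wpM2l ?sqr_ge0//.
    rewrite -[adj y \o y \o (sval q).1]/(adj y \o (y \o (sval q).1)).
    rewrite l2dot_adj ?adjK//; [|exact: (vn_bdd vM)|exact: (vn_bdd vM)].
    by apply: (CS sip_l2); exact: lx.
  have hsum : \sum_(q <- L) sqn (predual_eval dot (cplx k *: (adj y \o y)) q : C) <= e.
    apply: le_trans (ler_sum _ (fun q _ => pe q)) _.
    rewrite -mulr_sumr.
    apply: (@le_trans _ _ (k ^+ 2 * b y ^+ 2)).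
      rewrite ler_wpM2l ?sqr_ge0//; apply: sum_mul_le => q; exact: Qge.
    rewrite -exprMn; have : k * b y <= d.
      rewrite /k mulrAC ler_pdivrMr//; nra.
    have : 0 <= k * b y by rewrite mulr_ge0// ltW.
    nra.
  move=> /(_ hsum).
  have M0 := vn0 vM.
  have f00 : f 0 = 0.
    have := fl 1 0 0 M0 M0; rewrite scale1r mul1r addr0 -[LHS]addr0.
    by move/addrI.
  have := fl (cplx k) _ _ Myy M0; rewrite addr0 f00 addr0 => ->.
  rewrite sqnM sqn_cplx (posf_real vM pf My) sqn_cplx re_cplx.
  have := posf_ge0 vM pf My; set a := re _ => a0 h.
  have : k * a <= 1.
    rewrite leNgt; apply/negP => h1.
    have : 1 < (k * a) ^+ 2 by rewrite -(expr1n _ 2) ltr_sqr ?nnegrE; nra.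
    by rewrite exprMn; lra.
  rewrite /k mulrAC ler_pdivrMr// mul1r => h2.
  by rewrite [d^-1 * r]mulrC -mulrDl ler_pdivlMr// mulrC.
exists (cplx (Num.sqrt d^-1) *: s).
  by apply: (sipZ sip_l2).
move=> y My; have yl := vn_linear vM My.
have -> : y \o (cplx (Num.sqrt d^-1) *: s) = cplx (Num.sqrt d^-1) *: (y \o s).
  by apply/funext => n; exact: linopZ.
have lys := lx _ _ ls My.
rewrite (Q_l2 (sipZ sip_l2 _ lys)) (QZ sip_l2)// sqn_cplx.
rewrite sqr_sqrtr ?invr_ge0 ?(ltW d0)// lee_fin mulrC.
by have := bound _ My; have := N2s _ My; rewrite (Q_l2 lys) => -[->].
Qed.

Lemma normal_l2dot s t : l2 s -> l2 t ->
  normal_functional dot M (fun x => l2dot (x \o s) t).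
Proof.
move=> ls lt; apply/subspace_continuousP => x Mx.
have h : square_summable (s, t).1 /\ square_summable (s, t).2.
  by split; apply/l2_square_summable.
have := @continuous_predual_eval (exist _ (s, t) h) x.
exact: cvg_within_filter.
Qed.

End Vector.
End Functionals.

Section States.
Implicit Types (u v : H) (x y p : H -> H) (c : R) (s t w : nat -> H).

Lemma projection_linear p : projection dot p -> linear p.
Proof.
move=> [_ pa] a u v; apply: dot_inj => w; rewrite -pa.
by rewrite !dotDr !dotZr !pa.
Qed.

Lemma projection_Q p u : projection dot p -> << p u, u >> = cplx (Qd (p u)).
Proof. by move=> [pp pa]; rewrite -{1}pp /= pa dotQ. Qed.

Lemma projection_pythagoras p u : projection dot p -> Qd u = Qd (p u) + Qd (u - p u).
Proof.
move=> pr; have h := projection_Q u pr; have [pp pa] := pr.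
rewrite (QdB u) re_dotC h re_cplx; ring.
Qed.

Lemma projection_le p u : projection dot p -> Qd (p u) <= Qd u.
Proof.
by move=> pr; rewrite [leRHS](projection_pythagoras u pr) lerDl Qd_ge0.
Qed.

Lemma projection_ge0 p : projection dot p -> op_ge0 dot p.
Proof.
move=> pr u; rewrite projection_Q//; apply/cplx_ge0P; split=> //.
exact: Qd_ge0.
Qed.

Lemma projection_bdd p : projection dot p -> bounded_operator p.
Proof.
move=> pr; apply/bddP; split; first exact: projection_linear.
by exists 1 => // u; rewrite mul1r projection_le.
Qed.

Lemma projection_adj p : projection dot p -> adj p = p.
Proof. by move=> pr; apply: adj_eq pr.2; exact: projection_bdd. Qed.

Lemma projection_sq p : projection dot p -> adj p \o p = p.
Proof. by move=> pr; rewrite projection_adj//; case: pr. Qed.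

Lemma projection_compl p : projection dot p -> projection dot (idfun - p).
Proof.
move=> pr; have pl := projection_linear pr; have [pp pa] := pr; split.
  apply/funext => u; rewrite -[LHS]/((u - p u) - p (u - p u)) linopB//.
  by rewrite -[p (p u)]/((p \o p) u) pp subrr subr0.
move=> u v; rewrite -[LHS]/<< u - p u, v >> -[RHS]/<< u, v - p v >>.
by rewrite dotBl dotBr pa.
Qed.

Lemma op_le_compl q p u : projection dot q -> projection dot p ->
  op_le dot q (idfun - p) -> q (p u) = 0.
Proof.
move=> pq pr h; apply: Qd_eq0.
have := h (p u); rewrite -[(_ - q) _]/(p u - p (p u) - q (p u)).
have [pp _] := pr; rewrite -[p (p u)]/((p \o p) u) pp subrr sub0r.
rewrite -[- _]scaleN1r dotZl projection_Q// mulN1r => /cplx_ge0P[_].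
by rewrite reN re_cplx; lra.
Qed.

Lemma op_ge0_sq x : bounded_operator x -> op_ge0 dot (adj x \o x).
Proof.
by move=> bx u /=; rewrite dot_adjl.
Qed.

Lemma op_ge0_conj x y : bounded_operator y -> op_ge0 dot x ->
  op_ge0 dot (adj y \o x \o y).
Proof. by move=> by_ x0 u /=; rewrite dot_adjl. Qed.

Lemma op_ge0_re x u : op_ge0 dot x -> << x u, u >> = cplx (re << x u, u >>) /\ 0 <= re << x u, u >>.
Proof. by move=> /(_ u) /cplx_ge0P[h1 h2]; split=> //; exact: cplx_re. Qed.

Section OneAlgebra.
Context (M : set (H -> H)) (vM : von_neumann_algebra dot M).

Lemma state_posf f : normal_state dot M f -> posf M f.
Proof.
move=> nf; split; first exact: (state_linear nf).
move=> x Mx; apply: (state_ge0 nf).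
  by apply: (vn_comp vM) => //; exact: (vn_adj vM).
exact/op_ge0_sq/(vn_bdd vM).
Qed.

Lemma state_vector f : normal_state dot M f ->
  exists2 t, l2 t & forall y, M y -> (re (f (adj y \o y)))%:E = N2 (y \o t).
Proof.
move=> nf; have pf := state_posf nf.
have [s ls fs] := posf_normal_bound vM pf (state_normal nf).
exact: (posf_vector vM pf ls fs).
Qed.

Lemma lin0 f : linear_on M f -> f 0 = 0.
Proof.
move=> fl; have M0 := vn0 vM.
have := fl 1 0 0 M0 M0; rewrite scale1r mul1r addr0 -[LHS]addr0.
by move/addrI.
Qed.

Lemma linD f x y : linear_on M f -> M x -> M y -> f (x + y) = f x + f y.
Proof. by move=> fl Mx My; have := fl 1 x y Mx My; rewrite scale1r mul1r. Qed.

Lemma linB f x y : linear_on M f -> M x -> M y -> f (x - y) = f x - f y.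
Proof.
move=> fl Mx My; have := fl (-1) y x My Mx.
by rewrite scaleN1r mulN1r addrC => ->; rewrite addrC.
Qed.

Lemma linZ f (a : C) x : linear_on M f -> M x -> f (a *: x) = a * f x.
Proof.
move=> fl Mx; have := fl a x 0 Mx (vn0 vM).
by rewrite !addr0 lin0// addr0.
Qed.

Lemma posf_null f a p : posf M f -> M a -> M p -> re (f (adj p \o p)) = 0 ->
  f (a \o p) = 0.
Proof.
move=> pf Ma Mp h; apply/sqn_eq0.
have := posf_CS vM pf Mp (vn_adj vM Ma).
by rewrite (adjK (vn_bdd vM Ma)) h mul0r.
Qed.

Lemma posf_adj f x : posf M f -> M x -> f (adj x) = (f x)^*.
Proof.
move=> pf Mx; have := sip_sym (posf_sip vM pf) (vn_id vM) Mx.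
by rewrite adj_id -[f (idfun \o x)]/(f x) => ->; rewrite conjCK.
Qed.

Lemma form_bound x : M x -> exists2 c : R, 0 < c &
  forall u, `|re << x u, u >>| <= c * Qd u.
Proof.
move=> Mx; have /bddP[xl [c c0 xc]] := vn_bdd vM Mx.
exists (c + 1) => [|u]; first lra.
have h := dotCS (x u) u; have h2 := sqn_re << x u, u >>.
have q0 := Qd_ge0 u; have h3 := xc u.
rewrite -ler_sqr ?nnegrE ?mulr_ge0//; last by lra.
rewrite real_normK ?num_real// exprMn.
have : Qd (x u) * Qd u <= c * Qd u * Qd u by rewrite ler_wpM2r.
have : 0 <= Qd u * Qd u by rewrite mulr_ge0.
nra.
Qed.

End OneAlgebra.

End States.

Section OperatorNorm.
Implicit Types (u v : H) (x y p : H -> H) (c : R) (s t w : nat -> H).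

Lemma opnorm_bound x : bounded_operator x -> bounded_by x (opnorm x).
Proof.
move=> [_ [c xc]].
have hA : has_inf [set c | bounded_by x c].
  by split; [exists c|exists 0 => d [d0 _]].
have o0 : 0 <= opnorm x by apply: lb_le_inf => [|d [d0 _]//]; case: hA.
apply/bounded_byP; split=> // u.
have q0 := Qd_ge0 u; set m := opnorm x.
apply: (@ler_addeps _ _ _ ((2 * m + 1) * Qd u)) => [|e e0].
  by rewrite mulr_ge0// addr_ge0// mulr_ge0.
pose d := Num.min e 1.
have d0 : 0 < d by rewrite lt_min e0/=.
have d1 : d <= 1 by rewrite ge_min lexx orbT.
have de : d <= e by rewrite ge_min lexx.
have [b /bounded_byP[b0 xb] bm] := inf_adherent d0 hA.
apply: le_trans (xb u) _.
have h : b ^+ 2 <= (m + d) ^+ 2 by rewrite ler_sqr ?nnegrE ?addr_ge0 ?(ltW d0)//; exact: ltW.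
have h2 : (m + d) ^+ 2 <= m ^+ 2 + (2 * m + 1) * e.
  have : 0 <= m by []; nra.
have := ler_wpM2r q0 (le_trans h h2); lra.
Qed.

Lemma opnorm_le x c : bounded_by x c -> opnorm x <= c.
Proof. by move=> xc; apply: ge_inf => //; exists 0 => d []. Qed.

Lemma opnorm_Q x u : bounded_operator x -> Qd (x u) <= opnorm x ^+ 2 * Qd u.
Proof. by move=> /opnorm_bound/bounded_byP[]. Qed.

Lemma N2Z (a : C) s : N2 (fun n => a *: s n) = ((sqn a)%:E * N2 s)%E.
Proof.
rewrite /N2 -nneseriesZl//; last by move=> n _; rewrite lee_fin Qd_ge0.
by apply: eq_eseriesr => n _; rewrite QdZ EFinM.
Qed.

(** Iteration of [QdD2]. The weights are squares, so that each can later be absorbed as the scalar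
    [2 ^+ j.+1] multiplying a sequence of vectors. *)
Lemma sum_Q_le (a : nat -> H) n :
  Qd (\sum_(0 <= j < n) a j) <= \sum_(0 <= j < n) 4 ^+ j.+1 * Qd (a j).
Proof.
elim: n a => [|n IH] a; first by rewrite !big_geq// Qd0.
rewrite !big_nat_recl//; apply: le_trans (QdD2 _ _) _.
apply: lerD; first by have := Qd_ge0 (a 0%N); rewrite expr1; lra.
apply: (@le_trans _ _ (2 * \sum_(0 <= j < n) 4 ^+ j.+1 * Qd (a j.+1))).
  by have := IH (fun j => a j.+1); lra.
rewrite mulr_sumr; apply: ler_sum_nat => j _.
have q0 := Qd_ge0 (a j.+1).
have p : 0 <= (4 : R) ^+ j.+1 by rewrite exprn_ge0.
rewrite [4 ^+ j.+2]exprS mulrA ler_wpM2r//; lra.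
Qed.

End OperatorNorm.

(** * Positivity of operator matrices over [D] *)

Section CompletePositivity.
Implicit Types (u v : H) (x y p : H -> H) (c : R) (s t w : nat -> H).
Lemma dot_suml (I : Type) (r : seq I) (f : I -> H) (w : H) :
  << \sum_(i <- r) f i, w >> = \sum_(i <- r) << f i, w >>.
Proof.
exact: (big_morph (fun u => << u, w >>) (fun u v => dotDl u v w) (dot0l w)).
Qed.

Context (D : set (H -> H)) (vD : von_neumann_algebra dot D).

(* Since the projection onto the closure of D xi commutes with every a i j, the
   form decouples along it; removing one cyclic subspace at a time reduces
   positivity to vectors in a common D xi. *)
Lemma cyclic_positive n (a : 'I_n -> 'I_n -> H -> H) : (forall i j, D (a i j)) ->
  (forall (b : 'I_n -> H -> H) (xi : H), (forall i, D (b i)) ->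
     0 <= \sum_i \sum_j << a i j (b j xi), b i xi >>) ->
  forall u : 'I_n -> H, 0 <= \sum_i \sum_j << a i j (u j), u i >>.
Proof.
move=> Da pos u; have [m] := ubnP #|[pred i | u i != 0]|.
elim: m u => // m IH u um.
have [i0 ui0|u0] := pickP [pred i | u i != 0]; last first.
  rewrite big1// => i _; rewrite big1// => j _.
  by move/negbFE/eqP: (u0 i) => ->; rewrite dot0r.
pose G := [set v | exists2 b, D b & v = b (u i0)].
have sG : subspace_of G.
  split; first by exists 0; [exact: (vn0 vD)|].
  move=> c _ _ [b Db ->] [b' Db' ->].
  by exists (c *: b + b'); [exact: (vn_lin vD)|].
have [p [cp pp pc pg]] : exists p, [/\ commutant D p, projection dot p,
    forall u, cl G (p u) & forall u, cl G u -> p u = u].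
  apply: (invariant_projection sG) => [x Dx|x _ Dx [b Db ->]].
    by split; [exact: (vn_bdd vD)|exact: (vn_adj vD)].
  by exists (x \o b) => //; exact: (vn_comp vD).
have pl := projection_linear pp.
have ppE v : p (p v) = p v by have [h _] := pp; rewrite -[LHS]/((p \o p) v) h.
have pu0 : p (u i0) = u i0.
  by apply/pg/cl_sub; exists idfun => //; exact: (vn_id vD).
(* [p] commutes with [a i j], so the two cross terms vanish. *)
have split_ i j : << a i j (u j), u i >> = << a i j (p (u j)), p (u i) >> +
    << a i j (u j - p (u j)), u i - p (u i) >>.
  have al := vn_linear vD (Da i j).
  rewrite (linopB _ _ al) (vn_comm vD (u j) (Da i j) cp).
  have [_ pa] := pp; set v := a i j (u j).
  rewrite dotBl !dotBr !pa ppE; ring.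
under eq_bigr => i _ do (under eq_bigr => j _ do rewrite split_; rewrite big_split/=).
rewrite big_split/= addr_ge0//; last first.
  (* Passing to [u i - p (u i)] kills the entry [i0] and revives no zero entry, so the number of
     nonzero entries drops. *)
  apply: (IH (fun i => u i - p (u i))); rewrite -ltnS; apply: leq_trans um.
  rewrite ltnS; apply/proper_card/fintype.properP; split.
    by apply/fintype.subsetP => i; rewrite !inE; apply: contraNneq => ->; rewrite (linop0 pl) subrr.
  by exists i0; rewrite !inE// pu0 subrr eqxx.
have exg i : exists g : nat -> H -> H, (forall k, D (g k)) /\
    cvH (fun k => g k (u i0)) (p (u i)).
  have [g Gg gu] := pc (u i).
  have exb k : exists b, D b /\ g k = b (u i0) by have [b] := Gg k; exists b.
  have [b hb] := choice exb; exists b; split=> [k|]; first by case: (hb k).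
  by apply: cvH_eq gu => k; case: (hb k).
have [g hg] := choice exg.
have Dg i k : D (g i k) by case: (hg i).
apply: (@cvC_ge0 _ (fun k => \sum_i \sum_j << a i j (g j k (u i0)), g i k (u i0) >>)).
  apply: cvC_sum => i; apply: cvC_sum => j; apply: cvH_dot2; last by case: (hg i).
  have /bddP[al [c c0 ac]] := vn_bdd vD (Da i j).
  by apply: (cvH_map (fun u v => linopB u v al) c0 ac); case: (hg j).
by move=> k; apply: (pos (fun i => g i k)).
Qed.

End CompletePositivity.

(** * The support of the centralized state *)

Section Support.
Context (M D : set (H -> H)) (vM : von_neumann_algebra dot M)
  (vD : von_neumann_algebra dot D) (subDM : D `<=` M).
Context (omega : (H -> H) -> C) (nomega : normal_state dot M omega).
Context (tr : in_centralizer D M omega).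
Context (z : H -> H) (zsupp : is_support dot D omega z).

Lemma Dz : D z. Proof. by case: zsupp. Qed.
Lemma proj_z : projection dot z. Proof. by case: zsupp. Qed.
Lemma omega_z0 : omega (idfun - z) = 0. Proof. by case: zsupp. Qed.
Lemma zz u : z (z u) = z u.
Proof. by have [h _] := proj_z; rewrite -[z (z u)]/((z \o z) u) h. Qed.

Lemma omega_posf : posf M omega. Proof. exact: state_posf. Qed.

Lemma omega_pos_D : posf D omega.
Proof.
have [l p] := omega_posf; split=> [a x y Dx Dy|x Dx]; last by apply: p; exact: subDM.
by apply: l; exact: subDM.
Qed.

(* The projection onto a closed D'-invariant subspace lies in D; when the
   subspace contains the vectors s k of omega, it is a projection on whose
   complement omega vanishes, so it dominates z. *)
Lemma dense_invariant s (L : set H) : l2 s ->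
  (forall y, D y -> (re (omega (adj y \o y)))%:E = N2 (y \o s)) ->
  subspace_of L -> (forall u, cl L u -> L u) ->
  (forall y u, commutant D y -> L u -> L (y u)) ->
  (forall k, L (s k)) -> forall u, L (z u).
Proof.
move=> ls hs sL cL iL Ls u.
have [p [Dp pp pc pg]] := vn_projection vD sL iL.
have Dq : D (idfun - p) by apply: (vnB vD) => //; exact: (vn_id vD).
have pq := projection_compl pp.
have om0 : omega (idfun - p) = 0.
  rewrite -(projection_sq pq) (posf_real vD omega_pos_D Dq).
  have := hs _ Dq; rewrite (_ : _ \o s = (fun=> 0)); last first.
    apply/funext => k; rewrite -[LHS]/(s k - p (s k)) pg ?subrr//.
    exact: cl_sub.
  rewrite (_ : N2 _ = 0%E) => [[->]//|].
  by apply: eseries0 => n _ _; rewrite Qd0.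
have [_ _ _ /(_ _ Dq pq om0) le] := zsupp.
have := op_le_compl u pq proj_z le.
rewrite -[(_ - p) _]/(z u - p (z u)) => /eqP; rewrite subr_eq0 => /eqP ->.
exact/cL/pc.
Qed.

Lemma omega_vector : exists2 s, l2 s &
  forall y, M y -> (re (omega (adj y \o y)))%:E = N2 (y \o s).
Proof. exact: state_vector. Qed.

(** The hypothesis makes [y] vanish on every vector [s k] of [omega], and the kernel of [y] is
    closed and invariant under the commutant of [D]. *)
Lemma faithful y : D y -> re (omega (adj y \o y)) = 0 -> y \o z = 0.
Proof.
move=> Dy y0; have [s ls hs] := omega_vector.
have /bddP[yl [c c0 yc]] := vn_bdd vD Dy.
have ys k : y (s k) = 0.
  apply: Qd_eq0; rewrite -lee_fin -y0 hs; last exact: subDM.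
  exact: (N2_term (y \o s)).
apply/funext => u.
apply: (@dense_invariant s [set u | y u = 0]) => //.
- by move=> b Db; apply: hs; exact: subDM.
- split; first exact: linop0.
  by move=> a v w /= yv yw; rewrite yl yv yw scaler0 addr0.
- move=> v [g g0 gv] /=; apply: (cvH_unique (cvH_map (fun u v => linopB u v yl) c0 yc gv)).
  by apply: cvH_eq (cvH_cst 0) => n; rewrite g0.
- move=> b v cb /= yv; rewrite (vn_comm vD v Dy cb) yv linop0//.
  by case: cb => /bdd_linear.
Qed.

Lemma omega_compl a : M a -> omega (a \o (idfun - z)) = 0.
Proof.
have pc := projection_compl proj_z.
move=> Ma; apply: (posf_null vM omega_posf Ma).
  by apply: (vnB vM); [exact: (vn_id vM)|exact/subDM/Dz].
by rewrite (projection_sq pc) omega_z0.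
Qed.

Lemma omega_mulz a : M a -> omega (a \o z) = omega a.
Proof.
move=> Ma; have := omega_compl Ma.
have Maz : M (a \o z) by apply: (vn_comp vM) => //; exact/subDM/Dz.
rewrite (_ : a \o (idfun - z) = a - (a \o z)).
  rewrite (linB vM (state_linear nomega))//.
  by move/eqP; rewrite subr_eq0 => /eqP.
apply/funext => u; rewrite -[LHS]/(a (u - z u)).
exact/linopB/(vn_linear vM Ma).
Qed.

(** By the trace property [(1 - z) e z] is null for [omega], hence zero by faithfulness. So every
    [e] in [D] preserves the range of [z], and using this for [adj d] as well gives commutation. *)
Lemma central d u : D d -> d (z u) = z (d u).
Proof.
have step e v : D e -> z (e (z v)) = e (z v).
  move=> De; pose p := idfun - z.
  have pp : projection dot p by exact: projection_compl proj_z.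
  have Dp : D p by apply: (vnB vD); [exact: (vn_id vD)|exact: Dz].
  have Dez : D (e \o z) by apply: (vn_comp vD) => //; exact: Dz.
  have Dx : D (p \o (e \o z)) by exact: (vn_comp vD).
  have /faithful : re (omega (adj (p \o (e \o z)) \o (p \o (e \o z)))) = 0.
    rewrite (adjM (vn_bdd vD Dp) (vn_bdd vD Dez)) (projection_adj pp).
    have Da := vn_adj vD Dez.
    have -> : (adj (e \o z) \o p) \o (p \o (e \o z)) = (adj (e \o z)) \o (p \o (e \o z)).
      by have [h _] := pp; apply/funext => w /=; rewrite -[p (p _)]/((p \o p) _) h.
    rewrite tr//; last exact: subDM.
    rewrite -compA tr//; last by apply/subDM/(vn_comp vD).
    by rewrite omega_compl//; apply/subDM/(vn_comp vD).
  move=> /(_ Dx) /(congr1 (fun x => x v)).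
  rewrite -[LHS]/(e (z (z v)) - z (e (z (z v)))) -[RHS]/(0 : H) zz => /eqP.
  by rewrite subr_eq0 => /eqP <-.
move=> Dd; rewrite -[LHS]step//; apply: dot_inj => w.
have [_ pa] := proj_z.
have bd := vn_bdd vD Dd; have Da := vn_adj vD Dd.
by rewrite -[LHS]pa -(dot_adjl (z w) (z u) bd) -pa step// dot_adjl// pa.
Qed.

(** Pairing with an arbitrary vector turns an identity of vectors into one of complex numbers, where
    [ring] applies. *)
Ltac vec := apply: dot_inj => ?;
  rewrite !(dotBr, dotDr, dotZr, dotNr); ring.

Ltac inalg := repeat first
  [ assumption
  | match goal with
    | |- M (_ \o _) => apply: (vn_comp vM)
    | |- M (_ - _) => apply: (vnB vM)
    | |- M (_ + _) => apply: (vnD vM)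
    | |- M (_ *: _) => apply: (vnZ vM)
    | |- M (adj _) => apply: (vn_adj vM)
    | |- M idfun => exact: (vn_id vM)
    | |- M z => exact: (subDM Dz)
    | |- D (_ \o _) => apply: (vn_comp vD)
    | |- D (_ - _) => apply: (vnB vD)
    | |- D (_ + _) => apply: (vnD vD)
    | |- D (_ *: _) => apply: (vnZ vD)
    | |- D (adj _) => apply: (vn_adj vD)
    | |- D idfun => exact: (vn_id vD)
    | |- D z => exact: Dz
    | |- M _ => apply: subDM
    end ].

(** * The operator interval of [D] and its completeness *)

Definition unit_interval : set (H -> H) :=
  [set h | [/\ D h, op_ge0 dot h & op_ge0 dot (idfun - h)]].
Local Notation K := unit_interval.

Lemma K_compl h : K h -> K (idfun - h).
Proof.
move=> [Dh h0 h1]; split=> //; first by inalg.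
by rewrite (_ : _ - _ = h)// opprB addrCA subrr addr0.
Qed.

Lemma K_linear h : K h -> linear h.
Proof. by move=> [Dh _ _]; exact: (vn_linear vD Dh). Qed.

Lemma K_adjoint h : K h -> is_adjoint dot h h.
Proof. by move=> Kh; have [_ h0 _] := Kh; apply: op_ge0_adjoint h0; exact: K_linear. Qed.

Lemma K_adj h : K h -> adj h = h.
Proof.
move=> Kh; apply: adj_eq (K_adjoint Kh); have [Dh _ _] := Kh.
exact: (vn_bdd vD Dh).
Qed.

Lemma K_le1 h u : K h -> re << h u, u >> <= Qd u.
Proof.
move=> [_ _ /(_ u)]; rewrite -[X in << X, _ >>]/(u - h u) dotBl dotQ.
by move=> /cplx_ge0P[_]; rewrite reB re_cplx subr_ge0.
Qed.

Lemma K_sq h u : K h -> Qd (h u) <= re << h u, u >>.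
Proof.
move=> Kh; have [_ h0 _] := Kh.
have := op_ge0_bound (c := 1) (K_linear Kh) h0 _ ler01 u.
by rewrite mul1r; apply=> v; rewrite mul1r; exact: K_le1.
Qed.

Lemma K_contr h u : K h -> Qd (h u) <= Qd u.
Proof. by move=> Kh; apply: le_trans (K_sq u Kh) (K_le1 u Kh). Qed.

(** With [b = adj y \o y <= c] one has [h b h <= c h^2 <= c h], so a small multiple of [h b h] can
    be subtracted from [h]. This supplies the admissible directions for the Euler inequality. *)
Lemma K_perturb h y : K h -> D y -> exists2 t : R, 0 < t &
  K (h - cplx t *: (h \o (adj y \o y) \o h)).
Proof.
move=> Kh Dy; have [Dh h0 h1] := Kh.
have /bddP[yl [c c0 yc]] := vn_bdd vD Dy.
have t0 : 0 < (c + 1)^-1 by rewrite invr_gt0; lra.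
exists (c + 1)^-1 => //; set t := (c + 1)^-1.
have tc : t * c <= 1 by rewrite /t mulrC ler_pdivrMr; lra.
have E u : << (h \o (adj y \o y) \o h) u, u >> = cplx (Qd (y (h u))).
  by rewrite /= (K_adjoint Kh) dot_adjl ?dotQ//; exact: (vn_bdd vD Dy).
split; first by inalg.
- move=> u; rewrite -[X in << X, _ >>]/(h u - cplx t *: (h \o (adj y \o y) \o h) u).
  rewrite dotBl dotZl E.
  have [-> p] := op_ge0_re u h0.
  apply/cplx_ge0P; rewrite imB imM reB reM !im_cplx !re_cplx; split; first lra.
  have := yc (h u); have := K_sq u Kh; have := Qd_ge0 (h u).
  move: p; set a := re _; set b := Qd (h u); set d := Qd _ => p b0 ba dc.
  have : t * d <= t * (c * b) by rewrite ler_wpM2l// ltW.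
  have : t * c * b <= 1 * b by rewrite ler_wpM2r.
  lra.
- move=> u; rewrite -[X in << X, _ >>]/(u - (h u - cplx t *: (h \o (adj y \o y) \o h) u)).
  rewrite opprB addrCA dotDl dotZl E.
  have [-> p] := op_ge0_re u h1.
  apply/cplx_ge0P; rewrite imD imM reD reM !im_cplx !re_cplx; split; first lra.
  rewrite mul0r subr0; apply: addr_ge0; last exact: p.
  by apply: mulr_ge0; [exact: ltW|exact: Qd_ge0].
Qed.

Lemma K_limit (f : nat -> H -> H) y : (forall n, K (f n)) ->
  (forall u, cvH (fun n => f n u) (y u)) -> K y.
Proof.
move=> Kf fy; have Df n : D (f n) by case: (Kf n).
split.
- apply: (vn_limit vD (x := f) (c := 1)) => // n u.
  by rewrite mul1r; exact: K_contr.
- move=> u; apply: cvC_ge0 (cvH_dotl u (fy u)) _ => n.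
  by case: (Kf n).
- move=> u.
  have h : cvH (fun n => u - f n u) (u - y u).
    have := cvHD (cvH_cst u) (cvHZ (-1) (fy u)); rewrite scaleN1r.
    by apply: cvH_eq => n; rewrite scaleN1r.
  apply: cvC_ge0 (cvH_dotl u h) _ => n.
  by case: (Kf n) => _ _ /(_ u).
Qed.

Lemma K_mulz h : K h -> K (h \o z).
Proof.
move=> Kh; have [D1 h0 h1] := Kh; have hl := K_linear Kh.
have [zp za] := proj_z.
have E u : << (h \o z) u, u >> = << h (z u), z u >>.
  by rewrite -za -(central _ D1) /= zz.
split; first by inalg.
  by move=> u; rewrite E.
move=> u; rewrite -[X in << X, _ >>]/(u - (h \o z) u) dotBl E dotQ.
have [-> p] := op_ge0_re (z u) h0; apply/cplx_ge0P.
rewrite imB reB !im_cplx !re_cplx subrr subr_ge0; split=> //.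
exact: le_trans (K_le1 (z u) Kh) (projection_le u proj_z).
Qed.

(** A Cauchy sequence converges on each vector [s k]. The [f n] are contractions commuting with the
    commutant of [D], so the vectors on which they converge form a closed invariant subspace, which
    contains the range of [z]; the strong limit of [f n \o z] is the candidate. *)
Lemma K_complete (f : nat -> H -> H) : (forall n, K (f n)) ->
  cauchyQ (fun a b => omega (adj b \o a)) f ->
  exists2 y, K y & cvQ (fun a b => omega (adj b \o a)) f y.
Proof.
move=> Kf cf; have Df n : D (f n) by case: (Kf n).
have fl n := K_linear (Kf n).
have [s ls hs] := omega_vector.
have om y : D y -> (Q (fun a b => omega (adj b \o a)) y)%:E = N2 (y \o s).
  by move=> Dy; apply: hs; exact: subDM.
have lx y : D y -> l2 (y \o s).
  by move=> Dy; apply: l2_map => //; exact: (vn_bdd vD).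
have cs k : cauchyH (fun n => f n (s k)).
  move=> e e0; have [N hN] := cf _ e0; exists N => m n mN nN.
  rewrite -lee_fin; apply: le_trans (N2_term ((f m - f n) \o s) k) _.
  by rewrite -om ?lee_fin; [exact: hN|inalg].
have cz u : cauchyH (fun n => f n (z u)).
  apply: (dense_invariant (L := [set v | cauchyH (fun n => f n v)]) ls) => //.
  - split=> /= [e e0|a v w /= cv cw].
      by exists 0%N => m n _ _; rewrite (linop0 (fl m)) (linop0 (fl n)) subrr Qd0 ltW.
    have [lv hv] := H_complete cv; have [lw hw] := H_complete cw.
    have := cvHD (cvHZ a hv) hw.
    move=> /(cvQ_cauchy sip_dot (fun n => inT _) (inT _)).
    by congr (cauchyQ _ _); apply/funext => n; rewrite fl.
  - move=> v [g cg gv] e e0 /=.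
    have h : 0 < e / 16 by lra.
    have [n hn] := ev_ex (gv _ h); have [N hN] := cg n _ h.
    exists N => i j iN jN.
    have hij := hN _ _ iN jN.
    have h1 m : Qd (f m v - f m (g n)) <= e / 16.
      rewrite -(linopB _ _ (fl m)); apply: le_trans (K_contr _ (Kf m)) _.
      by rewrite QdC.
    have := QdD2 (f i v - f i (g n)) (f i (g n) - f j v).
    have := QdD2 (f i (g n) - f j (g n)) (f j (g n) - f j v).
    rewrite ![_ - _ + (_ - _)]addrA !subrK (QdC (f j (g n))).
    by have := h1 i; have := h1 j; lra.
  - move=> y v cy /= cv e e0.
    have /bddP[yl [c c0 yc]] := comm_bdd vD cy.
    have h : 0 < e / (c + 1) by rewrite divr_gt0//; lra.
    have [N hN] := cv _ h; exists N => m n mN nN.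
    rewrite !(vn_comm vD v (Df _) cy) -(linopB _ _ yl).
    apply: le_trans (yc _) _; apply: le_trans (ler_wpM2l c0 (hN _ _ mN nN)) _.
    by rewrite mulrA ler_pdivrMr; [nra|lra].
have [y hy] := choice (fun u => H_complete (cz u)).
have Ky : K y by apply: (K_limit (f := fun n => f n \o z)) => // n; exact: K_mulz.
have Dy : D y by case: Ky.
exists y => //.
have zs k : z (s k) = s k.
  have Dc : D (idfun - z) by inalg.
  have := hs _ (subDM Dc).
  rewrite (projection_sq (projection_compl proj_z)) omega_z0 re0 => h.
  have := N2_term ((idfun - z) \o s) k; rewrite -h lee_fin => h'.
  have := Qd_eq0 h'; rewrite -[LHS]/(s k - z (s k)) => /eqP.
  by rewrite subr_eq0 => /eqP.
have omQ x : D x -> Q l2dot (x \o s) = Q (fun a b => omega (adj b \o a)) x.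
  by move=> Dx; have := om _ Dx; rewrite (Q_l2 (lx _ Dx)) => -[].
have [n|e e0|t lt ft] := l2_complete (f := fun n => f n \o s).
- exact: lx.
- have [N hN] := cf _ e0; exists N => m n mN nN.
  have Dmn : D (f m - f n) by apply: (vnB vD).
  rewrite -[(f m \o s) - (f n \o s)]/((f m - f n) \o s) omQ//; exact: hN.
(* The [l2] limit and the strong limit agree on each [s k], which [z] fixes. *)
have ts : t = y \o s.
  apply/funext => k; apply: (cvH_unique (u := fun n => f n (s k))).
    move=> e e0; apply: evW (ft _ e0) => n; apply: le_trans.
    have ln : l2 ((f n \o s) - t) by apply: (sipB sip_l2) => //; exact: lx.
    by rewrite -lee_fin -(Q_l2 ln); exact: (N2_term ((f n \o s) - t) k).
  by have := hy (s k); rewrite zs.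
move=> e e0; apply: evW (ft _ e0) => n; rewrite ts => h.
have Dn : D (f n - y) by apply: (vnB vD).
by rewrite -omQ.
Qed.

(** * The expectation of a centralizing extension *)

Section Centralizing.
Context (rho : (H -> H) -> C) (nrho : normal_state dot M rho).
Context (rhoD : forall d, D d -> rho d = omega d) (ctr : in_centralizer D M rho).

Lemma rho_posf : posf M rho. Proof. exact: (state_posf vM). Qed.

Lemma rho_lin : linear_on M rho. Proof. exact: (state_linear nrho). Qed.

Lemma sip_form x : M x -> op_ge0 dot x -> sip M (fun p q => rho (adj q \o (x \o p))).
Proof.
move=> Mx x0; have xl := vn_linear vM Mx; apply: sip_positive.
- exact: (vn0 vM).
- exact: (vn_lin vM).
- move=> a p q r Mp Mq Mr.
  rewrite (_ : adj r \o _ = a *: (adj r \o (x \o p)) + (adj r \o (x \o q))).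
    by apply: rho_lin; inalg.
  have rl : linear (adj r) by apply: (vn_linear vM); inalg.
  by apply/funext => u; rewrite -[LHS]/(adj r (x (a *: p u + q u))) xl rl.
- move=> a p q r Mp Mq Mr.
  rewrite (adj_lin _ (vn_bdd vM Mp) (vn_bdd vM Mq)).
  by rewrite -rho_lin//; inalg.
- move=> p Mp; apply: (state_ge0 nrho); first by inalg.
  by apply: op_ge0_conj => //; exact: (vn_bdd vM).
Qed.

(** * One-sided inequality at a minimizer *)

Section Half.
Context (x h : H -> H) (Mx : M x) (x0 : op_ge0 dot x) (Kh : K h).
Context (var : forall k, K k -> 0 <= re (rho ((k - h) \o (h - x)))).

Lemma Dh : D h. Proof. by case: Kh. Qed.
Lemma Ma : M (h - x). Proof. by have := Dh => ?; inalg. Qed.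

(** The Euler inequality in the direction [- h b h] of [K_perturb], with [b = adj y \o y]. *)
Lemma var_below y : D y -> re (rho ((h \o (adj y \o y) \o h) \o (h - x))) <= 0.
Proof.
move=> Dy; have [t t0 Kk] := K_perturb Kh Dy; have Da := Dh; have Mb := Ma.
have := var Kk; rewrite addrAC subrr add0r.
set b := h \o _ \o h; have Db : D b by rewrite /b; inalg.
have -> : (- (cplx t *: b)) \o (h - x) = cplx (- t) *: (b \o (h - x)).
  apply/funext => u.
  rewrite -[LHS]/(- (cplx t *: b ((h - x) u))) -[RHS]/(cplx (- t) *: b ((h - x) u)).
  by rewrite -scaleNr; congr (_ *: _); apply: cplx_eq; rewrite ?reN ?imN ?re_cplx ?im_cplx ?oppr0.
rewrite (linZ vM _ rho_lin); last by inalg.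
by rewrite reM re_cplx im_cplx; nra.
Qed.

(** [K_perturb] is applied at [idfun - h]: subtracting there means adding [(1 - h) b (1 - h)] to
    [h], whence the opposite sign. *)
Lemma var_above y : D y ->
  0 <= re (rho (((idfun - h) \o (adj y \o y) \o (idfun - h)) \o (h - x))).
Proof.
move=> Dy; have [t t0 /K_compl Kk] := K_perturb (K_compl Kh) Dy.
have Da := Dh; have Mb := Ma.
have := var Kk.
set b := (idfun - h) \o _ \o (idfun - h); have Db : D b by rewrite /b; inalg.
have -> : (idfun - ((idfun - h) - cplx t *: b) - h) \o (h - x) = cplx t *: (b \o (h - x)).
  apply/funext => u; set v := (h - x) u.
  rewrite -[LHS]/(v - (v - h v - cplx t *: b v) - h v) -[RHS]/(cplx t *: b v).
  by vec.
rewrite (linZ vM _ rho_lin); last by inalg.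
by rewrite reM re_cplx im_cplx; nra.
Qed.

(** Cauchy-Schwarz for the form of [x']; [e + 1] stands in for the square root of [e]. *)
Lemma form_le (x' p q : H -> H) (e f : R) : M x' -> op_ge0 dot x' -> M p -> M q ->
  0 <= e -> 0 <= f ->
  re (rho (adj p \o (x' \o p))) <= f ^+ 2 -> re (rho (adj q \o (x' \o q))) <= e ->
  `|re (rho (adj q \o (x' \o p)))| <= (e + 1) * f.
Proof.
move=> Mx' x0' Mp Mq e0 f0 pf qe.
have S := sip_form Mx' x0'.
have h1 := CS S Mp Mq; have h2 := sqn_re (rho (adj q \o (x' \o p))).
have h3 := Q_ge0 S Mp; have h4 := Q_ge0 S Mq.
rewrite -ler_sqr ?nnegrE ?mulr_ge0//; last by lra.
rewrite real_normK ?num_real// exprMn.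
apply: le_trans h2 _; apply: le_trans h1 _.
rewrite mulrC; apply: ler_pM => //; apply: le_trans qe _; nra.
Qed.

Definition pow n : H -> H := iter n (idfun - h).

Lemma pow_D n : D (pow n).
Proof.
have Da := Dh; elim: n => [|n IH]; first exact: (vn_id vD).
have -> : pow n.+1 = (idfun - h) \o pow n by [].
by inalg.
Qed.

Lemma pow_h n u : pow n (h u) = h (pow n u).
Proof.
have hl := K_linear Kh; rewrite /pow; elim: n => //= n ->; set w := iter n _ u.
by rewrite -[LHS]/(h w - h (h w)) -[RHS]/(h (w - h w)) (linopB _ _ hl).
Qed.

Lemma powSr n u : pow n.+1 u = pow n (u - h u).
Proof. by rewrite /pow iterSr. Qed.

Lemma pow_adj n : adj (pow n) = pow n.
Proof.
have Kc := K_adjoint (K_compl Kh).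
apply: adj_eq; first exact/(vn_bdd vD)/pow_D.
elim: n => [|n IH] u v //.
by rewrite -[LHS]/<< (idfun - h) (pow n u), v >> Kc IH powSr.
Qed.

(** [t] is the geometric sum of the powers [(1 - h)^j] with [j < n]; it exhibits [1 - (1 - h)^n] as
    divisible by [h] on either side. *)
Lemma pow_decomp n : exists t : H -> H, [/\ D t, adj t = t &
  forall u, [/\ u - pow n u = h (t u) & u - pow n u = t (h u)]].
Proof.
have hl := K_linear Kh.
elim: n => [|n [t [Dt ta tE]]].
  exists 0; split; first exact: (vn0 vD).
    apply: adj_eq => [|u v]; first exact: bdd0.
    by rewrite dot0l dot0r.
  by move=> u; rewrite /= -[X in h X]/(0 : H) linop0// subrr.
have Dp := pow_D n.
exists (t + pow n); split; first by inalg.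
  have := adj_lin 1 (vn_bdd vD Dt) (vn_bdd vD Dp).
  by rewrite rmorph1 !scale1r ta pow_adj.
move=> u; have [e1 e2] := tE u.
have E : u - pow n.+1 u = (u - pow n u) + h (pow n u).
  rewrite -[pow n.+1 u]/(pow n u - h (pow n u)); vec.
split; rewrite E; first by rewrite e1 -[(t + _) u]/(t u + pow n u) (linopD _ _ hl).
by rewrite e2 -pow_h.
Qed.

(** Since [h^2 <= h], one has [r h r <= r (2 h - h^2) r = r^2 - ((1 - h) r)^2] for [r = (1 - h)^n].
    The right-hand sides telescope under [rho], so the terms have bounded sums and one of them is
    small. *)
Lemma pow_small e : 0 < e -> exists n,
  re (rho (adj (pow n.+1) \o (h \o pow n.+1))) <= e.
Proof.
have Da := Dh; have hl := K_linear Kh; have [_ h0 h1] := Kh.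
pose b n := re (rho (adj (pow n) \o pow n)).
have step n : re (rho (adj (pow n) \o (h \o pow n))) <= b n - b n.+1.
  have Dp := pow_D n; have Dp' := pow_D n.+1.
  have pl : linear (pow n) by apply: (vn_linear vD).
  have pos : op_ge0 dot (h - (h \o h)).
    move=> u; rewrite -[X in << X, _ >>]/(h u - h (h u)) dotBl.
    rewrite (K_adjoint Kh (h u)) dotQ.
    have [-> _] := op_ge0_re u h0; apply/cplx_ge0P.
    by rewrite imB reB !im_cplx !re_cplx subrr subr_ge0; split=> //; exact: K_sq.
  have := state_ge0 nrho _ (op_ge0_conj (vn_bdd vD Dp) pos).
  have -> : adj (pow n) \o (h - (h \o h)) \o pow n =
     (adj (pow n) \o pow n) - (adj (pow n.+1) \o pow n.+1) - (adj (pow n) \o (h \o pow n)).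
    rewrite (pow_adj n.+1); apply/funext => u; set v := pow n u.
    rewrite -[LHS]/(adj (pow n) (h v - h (h v))).
    rewrite -[RHS]/(adj (pow n) v - pow n.+1 (v - h v) - adj (pow n) (h v)).
    rewrite pow_adj powSr -!(linopB _ _ pl); congr (pow n _).
    by rewrite (linopB _ _ hl); vec.
  have Mdiff : M ((adj (pow n) \o pow n) - (adj (pow n.+1) \o pow n.+1)) by inalg.
  have Ma' : M (adj (pow n) \o pow n) by inalg.
  have Mb' : M (adj (pow n.+1) \o pow n.+1) by inalg.
  have Mc' : M (adj (pow n) \o (h \o pow n)) by inalg.
  have Md' : M ((adj (pow n) \o pow n) - (adj (pow n.+1) \o pow n.+1) - (adj (pow n) \o (h \o pow n))).
    by inalg.
  move=> /(_ Md'); rewrite (linB vM rho_lin Mdiff Mc') (linB vM rho_lin Ma' Mb').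
  by move=> /cplx_ge0P[_]; rewrite !reB /b; lra.
apply: (@bounded_sum_small R (fun n => re (rho (adj (pow n.+1) \o (h \o pow n.+1)))) (b 1%N)) => n.
apply: (@le_trans _ _ (b 1%N - b n.+1)).
  elim: n => [|n IH]; first by rewrite big_geq// subrr.
  by rewrite big_nat_recr//=; have := step n.+1; lra.
have := posf_ge0 vM rho_posf (subDM (pow_D n.+1)); rewrite /b; lra.
Qed.

(* For a >= 0 in D the claim would follow from the variational inequality if a
   were of the form h b h; the powers r of idfun - h measure the failure, and
   rho (r h r) tends to 0. *)
Lemma half_le y : D y -> re (rho ((adj y \o y) \o (h - x))) <= 0.
Proof.
move=> Dy; have Da := Dh; have Mb := Ma; have hl := K_linear Kh.
have [_ h0 h1] := Kh.
pose c0 := adj y \o y.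
have Dc0 : D c0 by rewrite /c0; inalg.
have c0l := vn_linear vD Dc0.
have c0a : adj c0 = c0.
  have Dya : D (adj y) by inalg.
  by rewrite /c0 adjM ?adjK//; apply: (vn_bdd vD).
pose Cx := re (rho (adj c0 \o (x \o c0))).
pose Ch := re (rho (adj c0 \o (h \o c0))).
have Cx0 : 0 <= Cx by exact: (Q_ge0 (sip_form Mx x0) (subDM Dc0)).
have Ch0 : 0 <= Ch by exact: (Q_ge0 (sip_form (subDM Da) h0) (subDM Dc0)).
apply: (@ler_addeps _ _ _ (2 * (Cx + 1) + 2 * (Ch + 1))) => [|d d0]; first lra.
have [n hn] := pow_small (exprn_gt0 2 d0).
(* The exponent is positive so that [r] contains a factor [1 - h], as [var_above] requires. *)
pose r := pow n.+1.
have Dr : D r by exact: pow_D.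
have rl := vn_linear vD Dr.
have ra : adj r = r by exact: pow_adj.
have [t [Dt ta tE]] := pow_decomp n.+1.
have rE u : r u = pow n (u - h u) by exact: powSr.
have rE' u : r u = pow n u - h (pow n u) by [].
have Dpn := pow_D n.
have pa := pow_adj n.
(* c0 = s c0 s + r c0 + c0 r - r c0 r with s = 1 - r *)
pose A1 := (h \o (adj (y \o t) \o (y \o t)) \o h) \o (h - x).
pose A2 := (r \o c0) \o (h - x).
pose A3 := (c0 \o r) \o (h - x).
pose A4 := ((idfun - h) \o (adj (y \o pow n) \o (y \o pow n)) \o (idfun - h)) \o (h - x).
have bD q : D q -> bounded_operator q by exact: (vn_bdd vD).
have E : c0 \o (h - x) = A1 + (A2 + (A3 - A4)).
  apply/funext => u; set v := (h - x) u.
  have e1 : A1 u = c0 v - c0 (r v) - r (c0 v) + r (c0 (r v)).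
    rewrite -[LHS]/(h (adj (y \o t) (y (t (h v))))) adjM//; [|exact: bD|exact: bD].
    rewrite /= ta -(tE _).2 -(tE _).1 -/r.
    rewrite -[adj y (y _)]/(c0 (v - r v)) (linopB _ _ c0l) (linopB _ _ rl); vec.
  have e4 : A4 u = r (c0 (r v)).
    rewrite -[LHS]/((idfun - h) (adj (y \o pow n) (y (pow n (v - h v))))).
    rewrite adjM//; [|exact: bD|exact: bD].
    by rewrite /= pa -powSr -/r.
  rewrite -[RHS]/(A1 u + (A2 u + (A3 u - A4 u))) e1 e4 -[A2 u]/(r (c0 v)).
  by rewrite -[A3 u]/(c0 (r v)) -[LHS]/(c0 v); vec.
have M1 : M A1 by rewrite /A1; inalg.
have M2 : M A2 by rewrite /A2; inalg.
have M3 : M A3 by rewrite /A3; inalg.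
have M4 : M A4 by rewrite /A4; inalg.
have M34 : M (A3 - A4) by inalg.
have M234 : M (A2 + (A3 - A4)) by inalg.
rewrite E (linD vM rho_lin M1 M234) (linD vM rho_lin M2 M34).
rewrite (linB vM rho_lin M3 M4) !reD reN.
have b1 : re (rho A1) <= 0 by apply: var_below; inalg.
have b4 : 0 <= re (rho A4) by apply: var_above; inalg.
have fh : re (rho (adj r \o (h \o r))) <= d ^+ 2 by exact: hn.
(* [var_above] at [pow n] reads [re (rho (r r (h - x))) >= 0], so smallness passes from
   [rho (r h r)] to [rho (r x r)]. *)
have fx : re (rho (adj r \o (x \o r))) <= d ^+ 2.
  apply: le_trans _ fh.
  have := var_above Dpn.
  have -> : (idfun - h) \o (adj (pow n) \o pow n) \o (idfun - h) = r \o r.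
    apply/funext => u; rewrite pa -[LHS]/((idfun - h) (pow n (pow n (u - h u)))).
    by rewrite -powSr.
  rewrite -[(r \o r) \o (h - x)]/(r \o (r \o (h - x))) ctr//; last by inalg.
  have -> : r \o (h - x) \o r = (adj r \o (h \o r)) - (adj r \o (x \o r)).
    apply/funext => u; rewrite ra -[LHS]/(r (h (r u) - x (r u))).
    by rewrite -[RHS]/(r (h (r u)) - r (x (r u))) (linopB _ _ rl).
  have Mh' : M (adj r \o (h \o r)) by inalg.
  have Mx' : M (adj r \o (x \o r)) by inalg.
  by rewrite (linB vM rho_lin Mh' Mx') reB subr_ge0.
have d0' := ltW d0.
have swap x' : M x' -> op_ge0 dot x' -> forall e : R, 0 <= e ->
    re (rho (adj r \o (x' \o r))) <= d ^+ 2 ->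
    re (rho (adj c0 \o (x' \o c0))) <= e ->
    `|re (rho (adj r \o (x' \o c0)))| <= (e + 1) * d.
  move=> Mx' x0' e e0 h1' h2'; have Mr := subDM Dr; have Mc := subDM Dc0.
  have S := sip_form Mx' x0'.
  have -> : re (rho (adj r \o (x' \o c0))) = re (rho (adj c0 \o (x' \o r))).
    exact: (reBC S).
  exact: form_le.
have b2 : re (rho A2) <= (Cx + 1) * d + (Ch + 1) * d.
  rewrite /A2 -[X in rho X]/(r \o (c0 \o (h - x))) ctr//; last by inalg.
  have -> : c0 \o (h - x) \o r = (adj c0 \o (h \o r)) - (adj c0 \o (x \o r)).
    apply/funext => u; rewrite c0a -[LHS]/(c0 (h (r u) - x (r u))).
    by rewrite -[RHS]/(c0 (h (r u)) - c0 (x (r u))) (linopB _ _ c0l).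
  have Mh' : M (adj c0 \o (h \o r)) by inalg.
  have Mx' : M (adj c0 \o (x \o r)) by inalg.
  rewrite (linB vM rho_lin Mh' Mx') reB.
  have Mr := subDM Dr; have Mc := subDM Dc0.
  have := form_le (subDM Da) h0 Mr Mc Ch0 d0' fh (lexx _).
  have := form_le Mx x0 Mr Mc Cx0 d0' fx (lexx _).
  by move=> /ler_normlP[h1' _] /ler_normlP[_ h2']; lra.
have b3 : re (rho A3) <= (Cx + 1) * d + (Ch + 1) * d.
  rewrite /A3 -[X in rho X]/(c0 \o (r \o (h - x))) ctr//; last by inalg.
  have -> : r \o (h - x) \o c0 = (adj r \o (h \o c0)) - (adj r \o (x \o c0)).
    apply/funext => u; rewrite ra -[LHS]/(r (h (c0 u) - x (c0 u))).
    by rewrite -[RHS]/(r (h (c0 u)) - r (x (c0 u))) (linopB _ _ rl).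
  have Mh' : M (adj r \o (h \o c0)) by inalg.
  have Mx' : M (adj r \o (x \o c0)) by inalg.
  rewrite (linB vM rho_lin Mh' Mx') reB.
  have := swap _ (subDM Da) h0 _ Ch0 fh (lexx _).
  have := swap _ Mx x0 _ Cx0 fx (lexx _).
  by move=> /ler_normlP[h1' _] /ler_normlP[_ h2']; lra.
lra.
Qed.

End Half.

(** Cauchy-Schwarz produces [omega (a \o adj a)], which the trace property turns into
    [omega (adj a \o a)]. So [a |-> rho (a \o x)] is bounded for the norm of [omega]. *)
Lemma rho_bound a x : D a -> M x ->
  sqn (rho (a \o x)) <= re (rho (adj x \o x)) * Q (fun a b => omega (adj b \o a)) a.
Proof.
move=> Da Mx; have Daa : D (adj a) by inalg.
have := posf_CS vM rho_posf Mx (subDM Daa).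
rewrite (adjK (vn_bdd vD Da)) (rhoD (d := a \o adj a)); last by inalg.
by rewrite tr//; exact: subDM.
Qed.

Lemma op_ge0_conv (t : R) x y : 0 <= t <= 1 -> op_ge0 dot x -> op_ge0 dot y ->
  op_ge0 dot (x + cplx t *: (y - x)).
Proof.
move=> /andP[t0 t1] x0 y0 u.
rewrite -[X in << X, _ >>]/(x u + cplx t *: (y u - x u)).
rewrite dotDl dotZl dotBl.
have [-> p] := op_ge0_re u x0; have [-> q] := op_ge0_re u y0.
apply/cplx_ge0P; rewrite !(imD, imM, imN, reD, reM, reN, im_cplx, re_cplx).
split; [ring|nra].
Qed.

(** [x] enters through the functional [a |-> rho (a \o x)] on [D]. The trace property and [rhoD]
    merge the two terms of the Euler inequality into one value of [rho]. *)
Lemma K_variational x : M x -> exists2 h, K h &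
  forall k, K k -> 0 <= re (rho ((k - h) \o (h - x))).
Proof.
move=> Mx.
have S := posf_sip vD omega_pos_D.
have c0 : 0 <= re (rho (adj x \o x)) by exact: (posf_ge0 vM rho_posf Mx).
have [|||||h Kh var] := variational S (K := K) (l := fun a => rho (a \o x)) _ _ _ K_complete _ _ c0.
- by move=> k [].
- exists 0; split; first exact: (vn0 vD).
    by move=> u; rewrite dot0l.
  by move=> u; rewrite subr0 dotE exprn_ge0.
- move=> t u v t01 [Du u0 u1] [Dv v0 v1]; split; first by inalg.
    exact: op_ge0_conv.
  have := op_ge0_conv t01 u1 v1; congr (op_ge0 _ _); apply/funext => w.
  rewrite -[LHS]/(w - u w + cplx t *: ((w - v w) - (w - u w))).
  by rewrite -[RHS]/(w - (u w + cplx t *: (v w - u w))); vec.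
- move=> a p q Dp Dq.
  by rewrite -rho_lin//; apply: (vn_comp vM) => //; exact: subDM.
- by move=> u Du; exact: rho_bound.
exists h => // k Kk; have [Dk _ _] := Kk; have [Dh _ _] := Kh.
have Dkh : D (k - h) by inalg.
have := var _ Kk; rewrite (K_adj Kh) tr//; last exact: subDM.
rewrite -rhoD; last by inalg.
rewrite -(linB vM rho_lin); [|by inalg|by inalg].
congr (0 <= re (rho _)); apply/funext => u.
rewrite -[RHS]/((k - h) (h u - x u)) (linopB _ _ (vn_linear vD Dkh)).
by [].
Qed.

(* The minimizer h for x makes idfun - h the minimizer for idfun - x, so that
   half_le applies to both and gives equality. *)
Lemma radon_nikodym x : M x -> op_ge0 dot x -> op_ge0 dot (idfun - x) ->
  exists h, [/\ D h, op_ge0 dot h, h \o z = h &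
    forall d, D d -> rho (d \o x) = omega (d \o h)].
Proof.
move=> Mx x0 x1; have [h Kh var] := K_variational Mx.
have [Dh h0 h1] := Kh.
have Mhx : M (h - x) by inalg.
have zeroD y : D y -> re (rho ((adj y \o y) \o (h - x))) = 0.
  move=> Dy; apply/eqP; rewrite eq_le; apply/andP; split.
    exact: (half_le Mx x0 Kh var).
  have M1x : M (idfun - x) by inalg.
  (* [k |-> idfun - k] maps the interval onto itself and changes the sign of both factors. *)
  have var' k : K k -> 0 <= re (rho ((k - (idfun - h)) \o ((idfun - h) - (idfun - x)))).
    move=> Kk; have [Dk _ _] := Kk; have := var _ (K_compl Kk).
    have Dkh : D (k - (idfun - h)) by inalg.
    congr (0 <= re (rho _)); apply/funext => u; set v := h u - x u.
    have -> : ((k - (idfun - h)) \o ((idfun - h) - (idfun - x))) u =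
        (k - (idfun - h)) (- v).
      rewrite -[LHS]/((k - (idfun - h)) (u - h u - (u - x u))).
      by congr ((_ - (_ - _)) _); rewrite /v; vec.
    have kl := vn_linear vD Dkh.
    rewrite -[- v]scaleN1r (linopZ _ _ kl) scaleN1r -[(k - (idfun - h)) v]/(k v - (v - h v)).
    by rewrite -[LHS]/(v - k v - h v); vec.
  have := half_le M1x x1 (K_compl Kh) var' Dy.
  have -> : (adj y \o y) \o ((idfun - h) - (idfun - x)) = -1 *: ((adj y \o y) \o (h - x)).
    have yl : linear (adj y \o y) by apply: (vn_linear vD); inalg.
    apply/funext => u; rewrite -[RHS]/(-1 *: (adj y \o y) (h u - x u)) -(linopZ _ _ yl).
    rewrite -[LHS]/((adj y \o y) (u - h u - (u - x u))).
    by congr ((_ \o _) _); vec.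
  rewrite (linZ vM _ rho_lin); last by inalg.
  by rewrite mulN1r reN; lra.
(* Polarization at [d + idfun]: the square terms vanish, leaving [d] and [adj d], whose real parts
   agree because [h - x] is self-adjoint and [D] is in the centralizer of [rho]. *)
have reD0 d : D d -> re (rho (d \o (h - x))) = 0.
  move=> Dd; have Da : D (adj d) by inalg.
  have Md := subDM Dd.
  have := zeroD (d + idfun) ltac:(inalg).
  have bd := vn_bdd vD Dd.
  have -> : adj (d + idfun) = adj d + idfun.
    have := adj_lin 1 bd bdd_id.
    by rewrite rmorph1 !scale1r adj_id.
  have dl := vn_linear vD Dd; have al := vn_linear vD Da.
  have -> : ((adj d + idfun) \o (d + idfun)) \o (h - x) =
     ((adj d \o d) \o (h - x)) + ((adj d \o (h - x)) + ((d \o (h - x)) + (h - x))).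
    apply/funext => u; set v := (h - x) u.
    rewrite -[LHS]/(adj d (d v + v) + (d v + v)) (linopD _ _ al).
    by rewrite -[RHS]/(adj d (d v) + (adj d v + (d v + v))); vec.
  do 3 (rewrite (linD vM rho_lin); [|by inalg|by inalg]).
  have z1 := zeroD idfun (vn_id vD).
  rewrite adj_id -[(idfun \o idfun) \o (h - x)]/(h - x) in z1.
  rewrite !reD z1 (zeroD _ Dd) addr0 add0r.
  have -> : re (rho (adj d \o (h - x))) = re (rho (d \o (h - x))).
    have hxa : adj (h - x) = h - x.
      apply: adj_eq; first exact: (vn_bdd vM).
      have ha := op_ge0_adjoint (vn_linear vD Dh) h0.
      have xa := op_ge0_adjoint (vn_linear vM Mx) x0.
      move=> u v; rewrite -[LHS]/(<< h u - x u, v >>) -[RHS]/(<< u, h v - x v >>).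
      by rewrite dotBl dotBr ha xa.
    rewrite ctr// -[X in X \o adj d]hxa -(adjM bd (vn_bdd vM Mhx)).
    by rewrite (posf_adj vM rho_posf) ?reJ//; inalg.
  lra.
have zero d : D d -> rho (d \o (h - x)) = 0.
  move=> Dd; apply: cplx_eq; first exact: reD0.
  have := reD0 _ (vnZ vD ('i : C) Dd).
  have -> : ('i *: d) \o (h - x) = ('i : C) *: (d \o (h - x)) by [].
  rewrite (linZ vM _ rho_lin); last by inalg.
  rewrite reM (_ : re ('i : C) = 0)// (_ : im ('i : C) = 1)// mul0r mul1r sub0r im0.
  by move/eqP; rewrite oppr_eq0 => /eqP.
exists (h \o z); split.
- by inalg.
- by case: (K_mulz Kh).
- by apply/funext => u /=; rewrite zz.
- move=> d Dd; rewrite compA omega_mulz; last by inalg.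
  have dl := vn_linear vD Dd.
  have := zero _ Dd.
  have -> : d \o (h - x) = (d \o h) - (d \o x).
    by apply/funext => u; exact: (linopB _ _ dl).
  rewrite (linB vM rho_lin); [|by inalg|by inalg].
  by move/eqP; rewrite subr_eq0 => /eqP <-; apply: rhoD; inalg.
Qed.

(** The graph of [E]. The condition [e \o z = e] selects the representative in [D z], on which
    [omega] is faithful, so that [x] determines [e]. *)
Definition expected x e := [/\ D e, e \o z = e &
  forall d, D d -> rho (d \o x) = omega (d \o e)].

Lemma expected_lin (a : C) x y e f : M x -> M y -> expected x e -> expected y f ->
  expected (a *: x + y) (a *: e + f).
Proof.
move=> Mx My [De ez eh] [Df fz fh]; split.
- exact: (vn_lin vD).
- by rewrite -{2}ez -{2}fz.
- move=> d Dd; have dl := vn_linear vD Dd.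
  have E p q : d \o (a *: p + q) = a *: (d \o p) + (d \o q).
    by apply/funext => u; exact: dl.
  have ol := state_linear nomega.
  rewrite !E rho_lin ?ol ?eh ?fh//; by inalg.
Qed.

Lemma expectedZ (a : C) x e : M x -> expected x e -> expected (a *: x) (a *: e).
Proof.
move=> Mx xe; have M0 := vn0 vM.
have e0 : expected 0 0.
  split; [exact: (vn0 vD)|by []|].
  move=> d Dd; have dl := vn_linear vD Dd.
  have -> : d \o (0 : H -> H) = (0 : H -> H) by apply: funext => u; exact: linop0.
  by rewrite rhoD//; exact: (vn0 vD).
by have := expected_lin a Mx M0 xe e0; rewrite !addr0.
Qed.

Lemma expected_id : expected idfun z.
Proof.
split; first exact: Dz; first by apply/funext => u /=; rewrite zz.
by move=> d Dd; rewrite omega_mulz ?rhoD//; exact: subDM.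
Qed.

Lemma expected_unique x e f : expected x e -> expected x f -> e = f.
Proof.
move=> [De ez eh] [Df fz fh]; have Def : D (e - f) by inalg.
have Da : D (adj (e - f)) by inalg.
have al := vn_linear vD Da.
have /(faithful Def) : re (omega (adj (e - f) \o (e - f))) = 0.
  have -> : adj (e - f) \o (e - f) = (adj (e - f) \o e) - (adj (e - f) \o f).
    by apply/funext => u; exact: (linopB _ _ al).
  rewrite (linB vM (state_linear nomega)); [|by inalg|by inalg].
  by rewrite -eh// -fh// subrr re0.
move=> h; apply/eqP; rewrite -subr_eq0; apply/eqP; rewrite -[RHS]h.
by rewrite -{1}ez -{1}fz.
Qed.

Lemma expected_pos x : M x -> op_ge0 dot x -> exists2 e, op_ge0 dot e & expected x e.
Proof.
move=> Mx x0; have [c c0 xc] := form_bound vM Mx.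
have xl := vn_linear vM Mx.
have Mx' : M (cplx c^-1 *: x) by inalg.
have E u : << (cplx c^-1 *: x) u, u >> = cplx (c^-1 * re << x u, u >>).
  rewrite -[X in << X, _ >>]/(cplx c^-1 *: x u) dotZl.
  have /cplx_ge0P[i0 _] := x0 u.
  apply: cplx_eq; rewrite ?reM ?imM ?re_cplx ?im_cplx.
    by rewrite mul0r subr0.
  by rewrite i0 mulr0 mul0r addr0.
have ci : 0 <= c^-1 by rewrite invr_ge0 ltW.
have [|u|h [Dh h0 hz hh]] := radon_nikodym Mx'.
- move=> u; rewrite E; apply/cplx_ge0P; split=> //; rewrite re_cplx mulr_ge0//.
  by have [_] := op_ge0_re u x0.
- rewrite -[X in << X, _ >>]/(u - (cplx c^-1 *: x) u) dotBl E dotQ.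
  apply/cplx_ge0P; rewrite imB reB !im_cplx !re_cplx subrr subr_ge0; split=> //.
  rewrite mulrC ler_pdivrMr// mulrC; apply: le_trans (xc u); exact: ler_norm.
exists (cplx c *: h).
  move=> u; rewrite -[X in << X, _ >>]/(cplx c *: h u) dotZl mulr_ge0//.
  by apply/cplx_ge0P; split=> //; rewrite re_cplx ltW.
have -> : x = cplx c *: (cplx c^-1 *: x).
  rewrite scalerA (_ : cplx c * _ = 1) ?scale1r//.
  by apply: cplx_eq; rewrite ?reM ?imM ?re_cplx ?im_cplx ?re1 ?im1 ?mulr0 ?mul0r ?addr0// subr0 divff// gt_eqF.
by apply: expectedZ.
Qed.

Lemma expected_sa x : M x -> adj x = x -> exists e, expected x e.
Proof.
move=> Mx xa; have [c c0 xc] := form_bound vM Mx.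
have bx := vn_bdd vM Mx.
have Mi := vn_id vM.
have My : M (cplx c *: idfun + x) by exact: (vn_lin vM).
have [u|e _ he] := expected_pos My.
  rewrite -[X in << X, _ >>]/(cplx c *: u + x u) dotDl dotZl dotQ.
  have im0' : im << x u, u >> = 0.
    have : << x u, u >> = (<< x u, u >>)^*.
      by rewrite -dotC -{1}xa dot_adjl.
    by move/(congr1 (@im R)); rewrite imJ; lra.
  apply/cplx_ge0P; rewrite imD reD imM reM im0' !im_cplx !re_cplx.
  split; first by ring.
  by have /ler_normlP[h _] := xc u; lra.
exists (cplx (- c) *: z + e).
have -> : x = cplx (- c) *: idfun + (cplx c *: idfun + x).
  apply/funext => u; rewrite -[RHS]/(cplx (- c) *: u + (cplx c *: u + x u)).
  rewrite addrA -scalerDl (_ : cplx (- c) + cplx c = 0) ?scale0r ?add0r//.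
  by apply: cplx_eq; rewrite ?reD ?imD ?re_cplx ?im_cplx ?addNr// addr0.
by apply: expected_lin => //; exact: expected_id.
Qed.

Lemma expected_exists x : M x -> exists e, expected x e.
Proof.
move=> Mx; have Mxa : M (adj x) by inalg.
have bx := vn_bdd vM Mx; have bxa := vn_bdd vM Mxa.
have M1 : M (1 *: x + adj x) by exact: (vn_lin vM).
have M2 : M ('i *: x + (- 'i) *: adj x).
  by apply: (vn_lin vM) => //; exact: (vnZ vM).
have [|e he] := expected_sa M1.
  by rewrite adj_lin// adjK// rmorph1 !scale1r addrC.
have [|f hf] := expected_sa M2.
  have bz : bounded_operator ((- 'i) *: adj x) by apply: (vn_bdd vM); inalg.
  rewrite adj_lin//.
  have -> : adj ((- 'i) *: adj x) = (- 'i)^* *: x.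
    have := adj_lin (- 'i) bxa bdd0; rewrite !addr0 adjK// => ->.
    suff -> : adj 0 = 0 :> (H -> H) by rewrite addr0.
    apply: adj_eq => [|u v]; first exact: bdd0.
    by rewrite dot0l dot0r.
  have -> : ('i : C)^* = - 'i by apply: cplx_eq; rewrite ?reJ ?imJ ?reN ?imN// oppr0.
  have -> : (- 'i : C)^* = 'i.
    by apply: cplx_eq; rewrite ?reJ ?imJ ?reN ?imN ?opprK// oppr0.
  by rewrite addrC.
(* Cartesian decomposition; [f] belongs to the self-adjoint operator ['i (x - adj x)], whence the
   factor [- 'i]. *)
exists (cplx 2^-1 *: e + (cplx 2^-1 * - 'i) *: f).
have -> : x = cplx 2^-1 *: (1 *: x + adj x) + (cplx 2^-1 * - 'i) *: ('i *: x + (- 'i) *: adj x).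
  have e1 : cplx 2^-1 * - 'i * 'i = cplx 2^-1 :> C.
    by apply: cplx_eq; rewrite !(reM, imM, reN, imN) ?re_cplx ?im_cplx /re /im /=; ring.
  have e2 : cplx 2^-1 * - 'i * - 'i = - cplx 2^-1 :> C.
    by apply: cplx_eq; rewrite !(reM, imM, reN, imN) ?re_cplx ?im_cplx /re /im /=; ring.
  rewrite !scalerDr !scalerA e1 e2 mulr1 scaleNr addrACA subrr addr0 -scalerDl.
  rewrite (_ : cplx 2^-1 + cplx 2^-1 = 1) ?scale1r//.
  by apply: cplx_eq; rewrite ?reD ?imD ?re_cplx ?im_cplx ?im1 ?re1; [field|rewrite addr0].
apply: expected_lin => //; first exact: (vnZ vM).
exact: expectedZ.
Qed.

Lemma expectation_exists : exists E : (H -> H) -> (H -> H),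
  vanishes_off M E /\ forall x, M x -> expected x (E x).
Proof.
have ex x : exists e, (M x -> expected x e) /\ (~ M x -> e = 0).
  have [Mx|nMx] := pselect (M x); last by exists 0.
  by have [e he] := expected_exists Mx; exists e.
have [E hE] := choice ex.
by exists E; split=> x; case: (hE x).
Qed.

(** * Properties of the constructed expectation *)

Section Constructed.
Context (E : (H -> H) -> (H -> H)) (Eoff : vanishes_off M E)
  (Eexp : forall x, M x -> expected x (E x)).

Lemma E_eq x e : M x -> expected x e -> E x = e.
Proof. by move=> Mx; exact/expected_unique/Eexp. Qed.

Lemma ED x : M x -> D (E x). Proof. by move=> /Eexp[]. Qed.
Lemma EM x : M x -> M (E x). Proof. by move=> /ED/subDM. Qed.
Lemma Ez x u : M x -> E x (z u) = E x u.
Proof. by move=> /Eexp[_ h _]; exact: (congr1 (fun f => f u) h). Qed.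
Lemma El x : M x -> linear (E x).
Proof. by move=> /ED/(vn_linear vD). Qed.

Lemma E_lin (a : C) x y : M x -> M y -> E (a *: x + y) = a *: E x + E y.
Proof.
move=> Mx My; apply: E_eq; first exact: (vn_lin vM).
by apply: expected_lin => //; exact: Eexp.
Qed.

Lemma EB x y : M x -> M y -> E (x - y) = E x - E y.
Proof.
move=> Mx My; have := E_lin (-1) My Mx.
by rewrite !scaleN1r addrC => ->; rewrite addrC.
Qed.

Lemma E_D d : D d -> E d = d \o z.
Proof.
move=> Dd; apply: E_eq; first exact: subDM.
split; [by inalg|by apply/funext => u /=; rewrite zz|].
by move=> d' Dd'; rewrite compA omega_mulz ?rhoD//; inalg.
Qed.

Lemma E_1 : E idfun = z. Proof. by rewrite E_D//; exact: (vn_id vD). Qed.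

Lemma E_modl d x : D d -> M x -> E (d \o x) = d \o E x.
Proof.
move=> Dd Mx; have [De ez eh] := Eexp Mx; apply: E_eq; first by inalg.
split; [by inalg|by rewrite -compA ez|].
by move=> d' Dd'; rewrite compA eh//; inalg.
Qed.

(** [d] is moved around cyclically, by [ctr] under [rho] and back by [tr] under [omega]; centrality
    of [z] keeps the result in [D z]. *)
Lemma E_modr d x : D d -> M x -> E (x \o d) = E x \o d.
Proof.
move=> Dd Mx; have [De ez eh] := Eexp Mx; apply: E_eq; first by inalg.
split; first by inalg.
  by apply/funext => u /=; rewrite (central _ Dd) Ez.
move=> d' Dd'; rewrite compA -ctr//; last by inalg.
rewrite compA eh; last by inalg.
by rewrite -[(d \o d') \o E x]/(d \o (d' \o E x)) tr//; inalg.
Qed.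

Lemma E_pos x : M x -> op_ge0 dot x -> op_ge0 dot (E x).
Proof.
move=> Mx x0; have [e e0 he] := expected_pos Mx x0.
by rewrite (E_eq Mx he).
Qed.

Lemma E_adj x : M x -> E (adj x) = adj (E x).
Proof.
move=> Mx; have [De ez eh] := Eexp Mx; apply: E_eq; first by inalg.
have be := vn_bdd vD De; have Dae : D (adj (E x)) by inalg.
split=> //.
  rewrite -{1}(projection_adj proj_z) -adjM//; last first.
    exact: (vn_bdd vD Dz).
  congr (adj _); apply/funext => u /=; rewrite -(central _ De).
  exact: Ez.
move=> d Dd; have Da : D (adj d) by inalg.
have bd := vn_bdd vD Dd; have bx := vn_bdd vM Mx.
have ba := vn_bdd vD Da.
have -> : d \o adj x = adj (x \o adj d) by rewrite adjM// adjK.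
have -> : d \o adj (E x) = adj (E x \o adj d) by rewrite adjM// adjK.
rewrite (posf_adj vM rho_posf); last by inalg.
rewrite (posf_adj vM omega_posf); last by inalg.
congr (_^*); rewrite -ctr// eh// tr//; exact: subDM.
Qed.

Lemma rhoE x : M x -> rho x = omega (E x).
Proof.
by move=> Mx; have [_ _ /(_ idfun (vn_id vD))] := Eexp Mx.
Qed.

(** Positivity of [E] at [adj (y - E y) \o (y - E y)]; the module property evaluates the cross terms
    and leaves [E (adj y \o y) - adj (E y) \o E y]. *)
Lemma schwarz y u : M y -> Qd (E y u) <= re << E (adj y \o y) u, u >>.
Proof.
move=> My; have Me := EM My; have De := ED My; have Mya : M (adj y) by inalg.
have Da : D (adj (E y)) by inalg.
have be := vn_bdd vM Me; have by_ := vn_bdd vM My.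
have Mw : M (y - E y) by inalg.
have yal := vn_linear vM Mya; have eal := vn_linear vD Da.
have eq1 : adj (y - E y) \o (y - E y) =
    ((adj y \o y) - (adj y \o E y)) - ((adj (E y) \o y) - (adj (E y) \o E y)).
  have -> : adj (y - E y) = adj y - adj (E y).
    have := adj_lin (-1) be by_; rewrite !scaleN1r addrC => ->.
    by rewrite rmorphN rmorph1 scaleN1r addrC.
  apply/funext => v; rewrite -[LHS]/(adj y (y v - E y v) - adj (E y) (y v - E y v)).
  by rewrite (linopB _ _ yal) (linopB _ _ eal).
have M1 : M (adj y \o y) by inalg.
have M2 : M (adj y \o E y) by inalg.
have M3 : M (adj (E y) \o y) by inalg.
have M4 : M (adj (E y) \o E y) by inalg.
have M12 : M ((adj y \o y) - (adj y \o E y)) by inalg.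
have M34 : M ((adj (E y) \o y) - (adj (E y) \o E y)) by inalg.
have := E_pos (vnB vM M12 M34).
rewrite -eq1 => /(_ (op_ge0_sq (vn_bdd vM Mw)) u).
rewrite eq1 (EB M12 M34) (EB M1 M2) (EB M3 M4) (E_modr De Mya) (E_modl Da My) (E_modl Da Me).
rewrite (E_D De) (E_adj My).
have -> : adj (E y) \o (E y \o z) = adj (E y) \o E y.
  by apply/funext => v /=; rewrite Ez.
rewrite subrr subr0 -[X in << X, _ >>]/(E (adj y \o y) u - adj (E y) (E y u)).
rewrite dotBl dot_adjl ?dotQ//.
by move=> /cplx_ge0P[_]; rewrite reB re_cplx subr_ge0.
Qed.

Lemma E_contractive x : M x -> opnorm (E x) <= opnorm x.
Proof.
move=> Mx; have bx := vn_bdd vM Mx.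
apply: opnorm_le; apply/bounded_byP.
have [m0 xo] := (bounded_byP x (opnorm x)).1 (opnorm_bound bx).
split=> // u; set m := opnorm x.
apply: le_trans (schwarz u Mx) _.
have Mxx : M (adj x \o x) by inalg.
have Mi := vn_id vM.
have Mc : M (cplx (m ^+ 2) *: idfun) by inalg.
have pos : op_ge0 dot (cplx (m ^+ 2) *: idfun - (adj x \o x)).
  move=> v; rewrite -[X in << X, _ >>]/(cplx (m ^+ 2) *: v - adj x (x v)).
  rewrite dotBl dotZl dot_adjl// !dotQ.
  apply/cplx_ge0P; rewrite !(imD, imN, imM, reD, reN, reM, re_cplx, im_cplx).
  by split; [ring|have := xo v; rewrite -/m; lra].
have := E_pos (vnB vM Mc Mxx) pos u.
rewrite EB//; have := E_lin (cplx (m ^+ 2)) Mi (vn0 vM).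
have E0 : E 0 = 0.
  have := E_lin 1 (vn0 vM) (vn0 vM).
  by rewrite !scale1r addr0 -[LHS]addr0 => /addrI.
rewrite E0 !addr0 E_1 => ->.
rewrite -[X in << X, _ >>]/(cplx (m ^+ 2) *: z u - E (adj x \o x) u).
rewrite dotBl dotZl (projection_Q u proj_z).
move=> /cplx_ge0P[_]; rewrite !(reD, reN, reM, re_cplx, im_cplx).
have := projection_le u proj_z; have := sqr_ge0 m.
set a := Qd (z u); set b := Qd u; nra.
Qed.

(* Normality of E reduces to this estimate, since a functional dominated by a
   vector functional is itself given by a vector of l2. *)
Definition dominated u := exists2 s, l2 s &
  forall y, M y -> ((Qd (E y u))%:E <= N2 (y \o s))%E.

(** The functional [f x = <E x u, u>] is bounded by the given sequence, so it is [<x s, w>] for some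
    [w]. Then [f (adj y \o y) = <y s, y w>] is dominated by [s] and [w] together, and [posf_vector]
    represents it exactly. The mass of the new sequence is [f idfun = <z u, u>]. *)
Lemma dominated_sharp u : dominated u -> exists2 s, (N2 s <= (Qd u)%:E)%E &
  forall y, M y -> ((Qd (E y u))%:E <= N2 (y \o s))%E.
Proof.
move=> [s ls us].
pose f x := << E x u, u >>.
have fl : linear_on M f.
  move=> a x y Mx My; rewrite /f E_lin//.
  by rewrite -[X in << X, _ >>]/(a *: E x u + E y u) dotDl dotZl.
have pf : posf M f.
  split=> // x Mx; apply: E_pos; first by inalg.
  by apply: op_ge0_sq; exact: (vn_bdd vM).
have lx t x : l2 t -> M x -> l2 (x \o t).
  by move=> lt Mx; apply: l2_map => //; exact: (vn_bdd vM).
have S := sip_l2.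
have [|w [g [lw _ _ fw]]] := riesz_l2 vM fl ls (Qd_ge0 u).
  move=> x Mx; apply: le_trans (lee_wpmul2l _ (us x Mx)); last first.
    by rewrite lee_fin Qd_ge0.
  by rewrite -EFinM lee_fin mulrC; exact: dotCS.
have [t ht] := N2_merge [:: s; w].
have hty y : M y -> N2 (y \o t) = (N2 (y \o s) + N2 (y \o w))%E.
  move=> My; rewrite ht ?big_cons ?big_nil ?adde0//.
  exact: (linop0 (vn_linear vM My)).
have lt : l2 t.
  rewrite /l2/= -[t]/(idfun \o t) hty; last exact: (vn_id vM).
  exact: lte_add_pinfty.
have [|s' ls' hs'] := posf_vector vM pf lt.
  move=> y My; have lys := lx _ _ ls My; have lyw := lx _ _ lw My.
  rewrite hty// (Q_l2 lys) (Q_l2 lyw) -EFinD lee_fin.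
  rewrite fw; last by inalg.
  rewrite -[(adj y \o y) \o s]/(adj y \o (y \o s)) l2dot_adj; last first.
    by apply: (vn_bdd vM); inalg.
  rewrite (adjK (vn_bdd vM My)).
  have := Q_ge0 S (sipB S lys lyw); rewrite (QB S lys lyw).
  have := Q_ge0 S lys; have := Q_ge0 S lyw; lra.
exists s' => [|y My].
  rewrite -[s']/(idfun \o s') -hs'; last exact: (vn_id vM).
  rewrite adj_id -[idfun \o idfun]/(idfun : H -> H) /f E_1.
  by rewrite (projection_Q u proj_z) re_cplx lee_fin (projection_le u proj_z).
by rewrite -hs'// lee_fin; exact: schwarz.
Qed.

Lemma dominated_sub : subspace_of dominated.
Proof.
split.
  exists (fun=> 0) => [|y My].
    rewrite /l2/= /N2 eseries0 ?ltry// => n _ _; by rewrite Qd0.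
  by rewrite (linop0 (El My)) Qd0 N2_ge0.
move=> a u v [s ls us] [t lt vt].
pose as_ : nat -> H := fun n => a *: s n.
(* Each sequence is listed twice to realize the factor 2 of [QdD2]. *)
have [r hr] := N2_merge [:: as_; as_; t; t].
have hry y : M y -> N2 (y \o r) = (2%:E * ((sqn a)%:E * N2 (y \o s)) + 2%:E * N2 (y \o t))%E.
  move=> My; have yl := vn_linear vM My.
  rewrite hr ?(linop0 yl)// !big_cons big_nil adde0.
  rewrite (_ : y \o as_ = fun n => a *: (y \o s) n); last first.
    by apply/funext => n; exact: (linopZ _ _ yl).
  have h2 (e : \bar R) : (0 <= e -> 2%:E * e = e + e)%E.
    by move=> e0; rewrite -[2]/(1 + 1)%R EFinD ge0_muleDl// mul1e.
  rewrite N2Z !h2 ?addeA//; first exact: N2_ge0.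
  by rewrite mule_ge0// ?lee_fin ?sqn_ge0//; exact: N2_ge0.
exists r.
  rewrite /l2/= -[r]/(idfun \o r) hry; last exact: (vn_id vM).
  rewrite -[idfun \o s]/s -[idfun \o t]/t.
  apply: lte_add_pinfty; rewrite lte_mul_pinfty//.
  by rewrite lte_mul_pinfty// lee_fin sqn_ge0.
move=> y My; rewrite hry// (El My).
apply: (@le_trans _ _ (2 * (sqn a * Qd (E y u)) + 2 * Qd (E y v))%:E).
  by rewrite lee_fin -QdZ; exact: QdD2.
rewrite EFinD !EFinM; apply: leeD; apply: lee_wpmul2l => //; last exact: vt.
by apply: lee_wpmul2l; [rewrite lee_fin sqn_ge0|exact: us].
Qed.

(** A limit is a telescoping sum of dominated vectors [d j]. Their sharp dominators have mass at
    most [Qd (d j)], so even with the weights of [sum_Q_le] they combine into one sequence of finite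
    mass. *)
Lemma dominated_closed u : cl dominated u -> dominated u.
Proof.
move=> [g dg gu].
(* The rate 16 beats the weights [4 ^+ j.+1] of [sum_Q_le]: the weighted masses still decay like the
   inverse of [4 ^+ j]. *)
have ex j : exists n, Qd (g n - u) <= (16 ^+ j)^-1.
  by apply: ev_ex; apply: gu; rewrite invr_gt0 exprn_gt0.
have [k hk] := choice ex.
pose v j := g (k j).
pose d j := if j is i.+1 then v i.+1 - v i else v 0%N.
have dd j : dominated (d j).
  have [d0 dl] := dominated_sub.
  case: j => [|j]; first exact: dg.
  rewrite /d (_ : _ - _ = -1 *: v j + v j.+1); last by rewrite scaleN1r addrC.
  by apply: dl; exact: dg.
have sumd n : \sum_(0 <= j < n.+1) d j = v n.
  elim: n => [|n IH]; first by rewrite big_nat1.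
  by rewrite big_nat_recr//= IH addrCA subrr addr0.
have Qdd j : Qd (d j.+1) <= 4 * (16 ^+ j)^-1.
  have := QdD2 (v j.+1 - u) (u - v j); rewrite addrA subrK (QdC u).
  have := hk j; have := hk j.+1; rewrite -/(v j) -/(v j.+1) exprS invfM.
  have : 0 <= (16 ^+ j : R)^-1 by rewrite invr_ge0 exprn_ge0.
  rewrite /d; set p := (16 ^+ j)^-1; lra.
have exs j : exists s, (N2 s <= (Qd (d j))%:E)%E /\
    forall y, M y -> ((Qd (E y (d j)))%:E <= N2 (y \o s))%E.
  by have [s s1 s2] := dominated_sharp (dd j); exists s.
have [s hs] := choice exs.
have sN j : (N2 (s j) <= (Qd (d j))%:E)%E by case: (hs j).
have sE j y : M y -> ((Qd (E y (d j)))%:E <= N2 (y \o s j))%E.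
  by case: (hs j) => _ /[apply].
pose r j := fun n => cplx (2 ^+ j.+1) *: s j n.
have [t ht] := N2_flatten r.
have hty y j : M y -> N2 (y \o r j) = ((4 ^+ j.+1)%:E * N2 (y \o s j))%E.
  move=> My; have yl := vn_linear vM My.
  have -> : (4 : R) ^+ j.+1 = sqn (cplx (2 ^+ j.+1)).
    by rewrite sqn_cplx exprAC; congr (_ ^+ _); ring.
  rewrite -N2Z; congr (N2 _).
  by apply/funext => n; exact: (linopZ _ _ yl).
have p4 j : (0 <= (4 ^+ j.+1 : R)%:E)%E by rewrite lee_fin exprn_ge0.
have N0 w : (0 <= N2 w)%E by exact: N2_ge0.
have lt : l2 t.
  (* 128 is the factor 64 of [q4] times the bound 2 for the geometric sum. *)
  apply: (@le_lt_trans _ _ (4 * Qd (d 0%N) + 128)%:E); last by rewrite ltry.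
  rewrite -[t]/(idfun \o t) ht; apply: lime_le.
    by apply: is_cvg_nneseries => j _ _; exact: N0.
  apply: nearW => n.
  apply: (@le_trans _ _ (\sum_(0 <= j < n) 4 ^+ j.+1 * Qd (d j))%:E).
    rewrite -sumEFin; apply: lee_sum => j _.
    rewrite hty; last exact: (vn_id vM).
    by rewrite EFinM; apply: lee_wpmul2l => //; exact: sN.
  rewrite lee_fin; case: n => [|n].
    by rewrite big_geq//; have := Qd_ge0 (d 0%N); lra.
  rewrite big_nat_recl// expr1 lerD2l.
  have q4 j : 4 ^+ j.+2 * Qd (d j.+1) <= 64 * (4 ^+ j)^-1.
    have h : 4 ^+ j.+2 * Qd (d j.+1) <= 4 ^+ j.+2 * (4 * (16 ^+ j)^-1).
      by rewrite ler_wpM2l ?exprn_ge0.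
    apply: le_trans h _.
    have -> : (16 : R) ^+ j = 4 ^+ j * 4 ^+ j by rewrite -exprMn; congr (_ ^+ _); ring.
    rewrite !exprS invfM; set p := 4 ^+ j.
    have p0 : p != 0 by rewrite expf_neq0.
    by rewrite (_ : _ * _ = 64 * p^-1) ?lexx//; field.
  apply: (@le_trans _ _ (\sum_(0 <= j < n) 64 * (4 ^+ j)^-1)).
    by apply: ler_sum_nat => j _; exact: q4.
  rewrite -mulr_sumr.
  have : \sum_(0 <= j < n) (4 ^+ j : R)^-1 <= 2 - 2 * (4 ^+ n)^-1.
    elim: n => [|n IH]; first by rewrite big_geq// expr0 invr1; lra.
    rewrite big_nat_recr//= exprS invfM.
    have : 0 <= (4 ^+ n : R)^-1 by rewrite invr_ge0 exprn_ge0.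
    by move: IH; set p := (4 ^+ n)^-1; lra.
  have : 0 <= (4 ^+ n : R)^-1 by rewrite invr_ge0 exprn_ge0.
  by set p := (4 ^+ n)^-1; lra.
exists t => // y My.
have lty : (N2 (y \o t) < +oo)%E by apply: l2_map => //; exact: (vn_bdd vM).
have yl := El My.
have /bddP[_ [c c0 yc]] := vn_bdd vD (ED My).
have vu : cvH v u.
  move=> e e0; have [N hN] := ev_small e0; exists N => n nN.
  apply: le_trans (hk n) _; apply: le_trans _ (hN n nN).
  by rewrite lef_pV2 ?posrE ?exprn_gt0// -natrX ler_nat ltn_expl.
have vE n : E y (v n) = \sum_(0 <= j < n.+1) E y (d j).
  elim: n => [|n IH]; first by rewrite big_nat1.
  by rewrite big_nat_recr//= -IH /d (linopB _ _ yl) addrCA subrr addr0.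
rewrite (N2_fin lty) lee_fin.
apply: (cvH_le (cvH_map (fun u v => linopB u v yl) c0 yc vu)) => n.
rewrite -lee_fin -(N2_fin lty) vE.
apply: (@le_trans _ _ (\sum_(0 <= j < n.+1) 4 ^+ j.+1 * Qd (E y (d j)))%:E).
  by rewrite lee_fin; exact: sum_Q_le.
rewrite ht; apply: le_trans (nneseries_lim_ge n.+1 _); last by move=> j _ _; exact: N0.
rewrite -sumEFin; apply: lee_sum => j _.
by rewrite hty// EFinM; apply: lee_wpmul2l => //; exact: sE.
Qed.

Lemma dominated_invariant y u : commutant D y -> dominated u -> dominated (y u).
Proof.
move=> cy [s ls us]; have /bddP[yl [c c0 yc]] := comm_bdd vD cy.
have N2Zs x : M x -> N2 (x \o (fun n => cplx (c + 1) *: s n)) =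
    (((c + 1) ^+ 2)%:E * N2 (x \o s))%E.
  move=> Mx; rewrite -sqn_cplx -N2Z; congr (N2 _).
  by apply/funext => n; exact: (linopZ _ _ (vn_linear vM Mx)).
have p0 : (0 <= ((c + 1) ^+ 2)%:E)%E by rewrite lee_fin sqr_ge0.
exists (fun n => cplx (c + 1) *: s n).
  rewrite /l2/= -[fun n => _]/(idfun \o (fun n => cplx (c + 1) *: s n)).
  by rewrite N2Zs ?lte_mul_pinfty//; exact: (vn_id vM).
move=> x Mx; rewrite N2Zs// (vn_comm vD u (ED Mx) cy).
apply: le_trans (lee_wpmul2l p0 (us _ Mx)); rewrite -EFinM lee_fin.
apply: le_trans (yc _) _; have := Qd_ge0 (E x u); nra.
Qed.

(** By [dense_invariant] it suffices to treat the vectors [s k], and the sequence of [rho] dominates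
    them: [|E y (s k)|^2 <= omega (adj (E y) \o E y) <= omega (E (adj y \o y)) = rho (adj y \o
    y)]. *)
Lemma dominated_z u : dominated (z u).
Proof.
have [s ls hs] := omega_vector; have [t lt ht] := state_vector vM nrho.
apply: (dense_invariant ls) => //.
- by move=> y Dy; apply: hs; exact: subDM.
- exact: dominated_sub.
- exact: dominated_closed.
- exact: dominated_invariant.
move=> k; exists t => // y My; have My' := EM My; have Myy : M (adj y \o y) by inalg.
have Mee : M (adj (E y) \o E y) by inalg.
apply: le_trans (N2_term (E y \o s) k) _.
rewrite -hs// -ht// lee_fin rhoE// -subr_ge0 -reB.
rewrite -(linB vM (state_linear nomega)) //; last exact: EM.
have h : M (E (adj y \o y) - (adj (E y) \o E y)) by apply: (vnB vM) => //; exact: EM.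
suff /(state_ge0 nomega h)/cplx_ge0P[] : op_ge0 dot (E (adj y \o y) - (adj (E y) \o E y)) by [].
move=> v; rewrite -[X in << X, _ >>]/(E (adj y \o y) v - adj (E y) (E y v)).
rewrite dotBl dot_adjl; last exact: (vn_bdd vM).
have pos := E_pos Myy (op_ge0_sq (vn_bdd vM My)).
rewrite dotQ; have := schwarz v My; have /cplx_ge0P[i0 _] := pos v.
by move=> h'; apply/cplx_ge0P; rewrite imB reB i0 !im_cplx !re_cplx subrr subr_ge0.
Qed.

(** Pulled back by [E], the predual functional of [xi] and [eta] is bounded by the flattened
    dominators of the [xi n]; by [riesz_l2] it is then a predual functional itself. *)
Lemma E_normal : normal_map dot M E.
Proof.
apply/subspace_continuousP => x Mx.
have Fx := within_filter M (@nbhs_filter _ (x : weakstar dot)).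
have FF := @fmap_filter _ _ E _ Fx.
apply: (cvg_weakstar vM FF) => -[[xi eta] [sxi seta]] A.
have lxi := (l2_square_summable xi).1 sxi.
have leta := (l2_square_summable eta).1 seta.
have exs n : exists s, (N2 s <= (Qd (xi n))%:E)%E /\
    forall y, M y -> ((Qd (E y (xi n)))%:E <= N2 (y \o s))%E.
  have [s s1 s2] := dominated_sharp (dominated_z (xi n)); exists s; split.
    by apply: le_trans s1 _; rewrite lee_fin; exact: (projection_le _ proj_z).
  by move=> y My; rewrite -(Ez (xi n) My); exact: s2.
have [s hs] := choice exs.
have [t ht] := N2_flatten s.
have N0 w : (0 <= N2 w)%E by exact: N2_ge0.
have lt : l2 t.
  apply: le_lt_trans lxi; rewrite -[t]/(idfun \o t) ht; apply: lee_nneseries => // n _.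
  by case: (hs n).
have Et y : M y -> (N2 (E y \o xi) <= N2 (y \o t))%E.
  move=> My; rewrite ht; apply: lee_nneseries => [n _ _|n _].
    by rewrite lee_fin; exact: Qd_ge0.
  by case: (hs n) => _; apply.
have lEx y : M y -> l2 (E y \o xi).
  by move=> My; apply: l2_map => //; exact/(vn_bdd vM)/EM.
have S := sip_l2.
pose f y := l2dot (E y \o xi) eta.
have fl : linear_on M f.
  move=> a p q Mp Mq; rewrite /f E_lin//.
  by rewrite (l2dot_lin vM)//; exact: EM.
have [|w [g [lw _ _ fw]]] := riesz_l2 vM fl lt (Q_ge0 S leta).
  move=> y My; apply: le_trans (lee_wpmul2l _ (Et y My)); last first.
    by rewrite lee_fin; exact: (Q_ge0 S).
  rewrite (Q_l2 (lEx _ My)) -EFinM lee_fin mulrC.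
  exact: (CS S (lEx _ My) leta).
have /subspace_continuousP/(_ x Mx) nw := normal_l2dot vM lt lw.
rewrite (_ : predual_eval dot (E x) _ = f x)// fw// => /nw.
move=> h; have {}h : nbhs (x : weakstar dot) [set y | M y -> A (l2dot (y \o t) w)] := h.
suff : nbhs (x : weakstar dot) [set y | M y -> A (f y)] by [].
apply: (@filterS _ _ (@nbhs_filter _ (x : weakstar dot)) _ _ _ h) => y hy My.
by rewrite fw//; exact: hy.
Qed.

(** [L] consists of the vectors killed by all [rho]-null projections. The projection onto it is the
    support of [E], because [rho] and [E] annihilate the same projections. *)
Lemma E_support : exists2 s, is_support dot M E s & op_le dot s z.
Proof.
have [t lt ht] := state_vector vM nrho.
pose L : set H := [set u | forall p, M p -> projection dot p -> rho p = 0 -> p u = 0].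
have sL : subspace_of L.
  split=> [p Mp pp _|a u v Lu Lv p Mp pp rp]; first exact: (linop0 (vn_linear vM Mp)).
  by rewrite (vn_linear vM Mp) Lu// Lv// scaler0 addr0.
have cL u : cl L u -> L u.
  move=> [g Lg gu] p Mp pp rp; have /bddP[pl [c c0 pc]] := vn_bdd vM Mp.
  apply: (cvH_unique (cvH_map (fun u v => linopB u v pl) c0 pc gu)).
  by apply: cvH_eq (cvH_cst 0) => n; rewrite Lg.
have iL y u : commutant M y -> L u -> L (y u).
  move=> cy Lu p Mp pp rp; rewrite (vn_comm vM u Mp cy) Lu//.
  by apply: linop0; exact/bdd_linear/(comm_bdd vM).
have [s [Ms ps sc sg]] := vn_projection vM sL iL.
have Lt k : L (t k).
  move=> p Mp pp rp; apply: Qd_eq0; rewrite -lee_fin.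
  apply: le_trans (N2_term (p \o t) k) _.
  by rewrite -ht// (projection_sq pp) rp re0.
have Mc : M (idfun - s) by inalg.
have pc := projection_compl ps.
have rc : rho (idfun - s) = 0.
  rewrite -(projection_sq pc) (posf_real vM rho_posf Mc).
  have := ht _ Mc; rewrite (_ : _ \o t = (fun=> 0)); last first.
    apply/funext => k; rewrite -[LHS]/(t k - s (t k)) sg ?subrr//.
    by apply: cl_sub; exact: Lt.
  rewrite (_ : N2 _ = 0%E) => [[->]//|].
  by apply: eseries0 => n _ _; rewrite Qd0.
have Enull p : M p -> projection dot p -> rho p = 0 -> E p = 0.
  move=> Mp pp rp; apply: E_eq => //; split; [exact: (vn0 vD)|by []|].
  move=> d Dd; have dl := vn_linear vD Dd.
  have -> : d \o (0 : H -> H) = (0 : H -> H) by apply: funext => u; exact: linop0.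
  rewrite (lin0 vM (state_linear nomega)).
  apply: (posf_null vM rho_posf (subDM Dd) Mp).
  by rewrite (projection_sq pp) rp re0.
have supp : is_support dot M E s.
  split=> //; first exact: Enull.
  move=> p Mp pp Ep u.
  have rp : rho p = 0 by rewrite rhoE// Ep (lin0 vM (state_linear nomega)).
  have psu : p (s u) = 0 by apply: cL (sc u) p Mp pp rp.
  rewrite -[X in << X, _ >>]/(u - s u - p u) !dotBl.
  rewrite (projection_Q u ps) (projection_Q u pp) dotQ.
  apply/cplx_ge0P; rewrite !(imB, reB) !im_cplx !re_cplx !subrr; split=> //.
  have pl := projection_linear pp.
  have := projection_le (u - s u) pp; rewrite (linopB _ _ pl) psu subr0.
  by rewrite (projection_pythagoras u ps); lra.
exists s => //.
have [_ _ _ /(_ (idfun - z))] := supp.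
have Mz : M (idfun - z) by inalg.
have E0 : E (idfun - z) = 0.
  have Mi := vn_id vM; have Mz' := subDM Dz.
  rewrite EB// E_1 (E_D Dz); apply/funext => u.
  by rewrite -[LHS]/(z u - z (z u)) zz subrr.
move=> /(_ Mz (projection_compl proj_z) E0) h u; have := h u.
congr (0 <= << _, _ >>).
rewrite -[LHS]/(u - s u - (u - z u)) -[RHS]/(z u - s u); vec.
Qed.

Lemma constructed_expectation : module_expectation dot M D z E.
Proof.
split=> //.
- apply/seteqP; split=> [_ [x Mx <-]|_ [d Dd <-]].
    by exists (E x); [exact: ED|apply/funext => u; exact: Ez].
  by exists d; [exact: subDM|exact: E_D].
- exact: E_lin.
- exact: E_modl.
- exact: E_modr.
- exact: E_normal.
- move=> x Mx; rewrite (E_D (ED Mx)).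
  by apply/funext => u; exact: Ez.
- exact: E_contractive.
- exact: E_support.
Qed.

End Constructed.

End Centralizing.

(** * The state of an expectation *)

Section GivenExpectation.

Context (E : (H -> H) -> (H -> H)) (ME : module_expectation dot M D z E).

Lemma me_D x : M x -> D (E x).
Proof.
move=> Mx; have : (E @` M) (E x) by exists x.
by rewrite (me_image ME) => -[d Dd <-]; inalg.
Qed.

Lemma me_zr x u : M x -> E x (z u) = E x u.
Proof.
move=> Mx; have : (E @` M) (E x) by exists x.
by rewrite (me_image ME) => -[d Dd <-] /=; rewrite zz.
Qed.

Lemma me_zl x u : M x -> z (E x u) = E x u.
Proof. by move=> Mx; rewrite -(central _ (me_D Mx)) me_zr. Qed.

Lemma me_M x : M x -> M (E x).
Proof. by move=> Mx; exact/subDM/me_D. Qed.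

Lemma me_0 : E 0 = 0.
Proof.
have M0 := vn0 vM.
have := me_linear ME 1 M0 M0; rewrite !scale1r addr0 -[LHS]addr0.
by move/addrI.
Qed.

Lemma meD x y : M x -> M y -> E (x + y) = E x + E y.
Proof. by move=> Mx My; have := me_linear ME 1 Mx My; rewrite !scale1r. Qed.

Lemma meZ (a : C) x : M x -> E (a *: x) = a *: E x.
Proof.
by move=> Mx; have := me_linear ME a Mx (vn0 vM); rewrite me_0 !addr0.
Qed.

(** [z] is in the image, so idempotence gives [E z = z], while the module property gives
    [E z = z \o E idfun], which is [E idfun]. *)
Lemma me_1 : E idfun = z.
Proof.
have Mi := vn_id vM.
have [x Mx xz] : (E @` M) z.
  by rewrite (me_image ME); exists idfun => //; exact: (vn_id vD).
have Ez : E z = z by rewrite -xz (me_idem ME).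
rewrite -Ez -[z]/(z \o idfun) (me_modl ME Dz Mi).
by apply/funext => u; rewrite -[RHS]/(z (E idfun u)) me_zl.
Qed.

Lemma me_sum (I : Type) (r : seq I) (f : I -> H -> H) : (forall i, M (f i)) ->
  M (\sum_(i <- r) f i) /\ E (\sum_(i <- r) f i) = \sum_(i <- r) E (f i).
Proof.
move=> Mf; apply: (big_ind2 (fun x y => M x /\ E x = y)) => [|x _ y _ [Mx <-] [My <-]|i _].
- by split; [exact: (vn0 vM)|exact: me_0].
- by split; [exact: (vnD vM)|exact: meD].
- by split.
Qed.

Lemma me_Q x k u : M x -> 0 <= k -> (forall u, Qd (x u) <= k * Qd u) ->
  Qd (E x u) <= k * Qd u.
Proof.
move=> Mx k0 xk.
have hx : opnorm x <= Num.sqrt k.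
  apply: opnorm_le; apply/bounded_byP; split; first exact: sqrtr_ge0.
  by move=> v; rewrite sqr_sqrtr.
have he := le_trans (me_contractive ME Mx) hx.
have be := vn_bdd vD (me_D Mx).
have [h0 _] := (bounded_byP (E x) (opnorm (E x))).1 (opnorm_bound be).
apply: le_trans (opnorm_Q u be) _; rewrite ler_wpM2r ?Qd_ge0//.
by rewrite -[leRHS]sqr_sqrtr// ler_sqr ?nnegrE ?sqrtr_ge0.
Qed.

(* Contractivity bounds E (x + i t) and E (c - x) in terms of c and t; letting t
   vary forces <E x v, v> to be real, and the second bound makes it >= 0. *)
Lemma me_ge0 x : M x -> op_ge0 dot x -> op_ge0 dot (E x).
Proof.
move=> Mx x0 u; have xl := vn_linear vM Mx.
have [c c0 xc] := form_bound vM Mx; have c0' := ltW c0.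
have Mi := vn_id vM.
(* Compression to the range of [z], where [E idfun = z] acts as the identity. *)
pose v := z u; have zv : z v = v by exact: zz.
have -> : << E x u, u >> = << E x v, v >>.
  by rewrite me_zr//; have [_ za] := proj_z; rewrite -za me_zl.
set al := << _, v >>; pose V := Qd v; have V0 : 0 <= V := Qd_ge0 v.
have xre u1 : re << x u1, u1 >> <= c * Qd u1 by have /ler_normlP[] := xc u1.
have xQ u1 : Qd (x u1) <= c ^+ 2 * Qd u1.
  have := op_ge0_bound xl x0 xre c0' u1.
  have := xre u1; have := Qd_ge0 u1; nra.
have [V1|Vp] := leP V 0.
  by rewrite /al (Qd_eq0 V1) dot0r.
have key (y : H -> H) k (b : C) : M y -> 0 <= k -> (forall u1, Qd (y u1) <= k * Qd u1) ->
    << E y v, v >> = b -> sqn b <= k * V ^+ 2.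
  move=> My k0 yk <-; have := dotCS (E y v) v.
  have := me_Q v My k0 yk; rewrite -/V; nra.
apply/cplx_ge0P; split.
  have re_i : re ('i : C) = 0 by [].
  have im_i : im ('i : C) = 1 by [].
  have line (t : R) : re al ^+ 2 + (t * V + im al) ^+ 2 <= (c ^+ 2 + t ^+ 2) * V ^+ 2.
    pose y := ('i * cplx t : C) *: idfun + x.
    have My : M y by exact: (vn_lin vM).
    have k0 : 0 <= c ^+ 2 + t ^+ 2 by rewrite addr_ge0 ?sqr_ge0.
    have yk u1 : Qd (y u1) <= (c ^+ 2 + t ^+ 2) * Qd u1.
      have -> : Qd (y u1) = t ^+ 2 * Qd u1 + Qd (x u1).
        rewrite QdD QdZ dotZl -(op_ge0_adjoint xl x0).
        have /cplx_ge0P[i0 _] := x0 u1.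
        rewrite /sqn !(reM, imM) re_i im_i !(re_cplx, im_cplx) i0; ring.
      by have := xQ u1; lra.
    have := key y _ ('i * cplx t * cplx V + al) My k0 yk.
    rewrite /sqn !(reD, imD, reM, imM) re_i im_i !(re_cplx, im_cplx).
    rewrite !mul0r !mulr0 !mul1r ?subr0 ?addr0 ?add0r ?sub0r mul0r add0r; apply.
    rewrite /y (me_linear ME)// me_1.
    by rewrite -[X in << X, _ >>]/(_ *: z v + E x v) zv dotDl dotZl dotQ.
  apply/eqP/negP => /negP b0.
  (* This [t] makes the cross term [2 t V im al] equal to [c^2 V^2 + 1], more than [line] allows. *)
  have := line ((c ^+ 2 * V ^+ 2 + 1) / (2 * im al * V)).
  set t := _ / _.
  have tE : 2 * (t * V * im al) = c ^+ 2 * V ^+ 2 + 1.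
    by rewrite /t; field; rewrite b0 gt_eqF.
  have := sqr_ge0 (im al); have := sqr_ge0 (re al); nra.
(* [c - x] again lies between 0 and [c], so [|c V - al| <= c V], which forces [re al >= 0]. *)
pose y := cplx c *: idfun - x.
have Mc : M (cplx c *: idfun) by inalg.
have My : M y by exact: (vnB vM).
have yE u1 : << y u1, u1 >> = cplx (c * Qd u1) - << x u1, u1 >>.
  rewrite -[X in << X, _ >>]/(cplx c *: u1 - x u1) dotBl dotZl dotQ.
  by congr (_ - _); rewrite /cplx -rmorphM.
have y0 : op_ge0 dot y.
  move=> u1; rewrite yE; apply/cplx_ge0P; have /cplx_ge0P[i0 _] := x0 u1.
  by rewrite imB reB im_cplx re_cplx i0 subrr subr_ge0.
have yk u1 : Qd (y u1) <= c ^+ 2 * Qd u1.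
  have yre u2 : re << y u2, u2 >> <= c * Qd u2.
    rewrite yE reB re_cplx; have /cplx_ge0P[_] := x0 u2; lra.
  have := op_ge0_bound (vn_linear vM My) y0 yre c0' u1.
  have := yre u1; have := Qd_ge0 u1; nra.
have := key y _ (cplx (c * V) - al) My (sqr_ge0 c) yk.
rewrite /sqn reB re_cplx => h.
suff : (c * V - re al) ^+ 2 <= c ^+ 2 * V ^+ 2.
  have : 0 < c * V by rewrite mulr_gt0.
  by nra.
apply: le_trans (h _); first by rewrite lerDl sqr_ge0.
have -> : y = (- 1) *: x + cplx c *: idfun by rewrite scaleN1r addrC.
rewrite (me_linear ME)// meZ ?me_1//.
rewrite -[X in << X, _ >>]/((- 1) *: E x v + cplx c *: z v) zv.
rewrite dotDl !dotZl dotQ mulN1r addrC.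
by congr (_ - _); rewrite /cplx -rmorphM.
Qed.

Lemma me_normal_comp : normal_functional dot M (omega \o E).
Proof.
apply/subspace_continuousP => x Mx.
have /subspace_continuousP/(_ x Mx) nE := me_normal ME.
have /subspace_continuousP/(_ _ (me_M Mx)) nom := state_normal nomega.
move=> A /nom; move=> h.
have {}h : nbhs (E x : weakstar dot) [set y | M y -> A (omega y)] := h.
have h2 : nbhs (x : weakstar dot) [set y | M y -> M (E y) -> A (omega (E y))] := nE _ h.
suff : nbhs (x : weakstar dot) [set y | M y -> A (omega (E y))] by [].
apply: (@filterS _ _ (@nbhs_filter _ (x : weakstar dot)) _ _ _ h2) => y hy My.
by apply: hy => //; exact: me_M.
Qed.

Lemma me_extension : centralizing_extension dot M D omega (omega \o E).
Proof.
split.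
- by move=> x Mx /=; rewrite (me_dom ME Mx) (lin0 vM (state_linear nomega)).
- split; last exact: me_normal_comp.
  + move=> a x y Mx My /=; rewrite (me_linear ME)//.
    by rewrite (state_linear nomega)//; exact: me_M.
  + by move=> x Mx x0 /=; apply: (state_ge0 nomega); [exact: me_M|exact: me_ge0].
  + rewrite /= me_1 -[z]/(idfun \o z) omega_mulz ?(state_unit nomega)//.
    exact: (vn_id vM).
- move=> d Dd /=; have Md := subDM Dd; rewrite -[X in E X]/(d \o idfun).
  rewrite (me_modl ME)//; last exact: (vn_id vM).
  by rewrite me_1 omega_mulz.
- by move=> d x Dd Mx /=; rewrite (me_modl ME)// (me_modr ME)// tr//; exact: me_M.
Qed.

(** The positive operator [a = E x] satisfies [a^2 <= c a], so [omega a = 0] gives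
    [omega (adj a \o a) = 0], and faithfulness applies. *)
Lemma me_comp_null x : M x -> op_ge0 dot x -> omega (E x) = 0 -> E x = 0.
Proof.
move=> Mx x0 ox; have Da := me_D Mx; have a0 := me_ge0 Mx x0.
set a := E x in Da a0 ox *.
have Ma := subDM Da; have ba := vn_bdd vM Ma; have al := vn_linear vM Ma.
have [c c0 ac] := form_bound vM Ma.
have Maa : M (adj a \o a) by inalg.
have Mca : M (cplx c *: a) by inalg.
have : op_ge0 dot (cplx c *: a - (adj a \o a)).
  move=> u; rewrite -[X in << X, _ >>]/(cplx c *: a u - adj a (a u)).
  rewrite dotBl dotZl dot_adjl// dotQ.
  have [-> _] := op_ge0_re u a0.
  apply/cplx_ge0P; rewrite !(imB, reB, imM, reM, re_cplx, im_cplx).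
  split; first by ring.
  have := op_ge0_bound al a0 (fun u => le_trans (ler_norm _) (ac u)) (ltW c0) u.
  lra.
move=> /(state_ge0 nomega (vnB vM Mca Maa)).
rewrite (linB vM (state_linear nomega))// (linZ vM _ (state_linear nomega))//.
rewrite ox mulr0 sub0r => /cplx_ge0P[_]; rewrite reN => h.
have /(faithful Da) : re (omega (adj a \o a)) = 0.
  by have := posf_ge0 vM omega_posf Ma; lra.
by move=> az; rewrite -az; apply/funext => u; rewrite -[RHS]/(E x (z u)) me_zr.
Qed.

Lemma me_supports : exists2 s, is_support dot M E s & is_support dot M (omega \o E) s.
Proof.
have [s es _] := me_support ME; exists s => //; have [Ms ps sE smax] := es.
split=> //; first by rewrite /= sE (lin0 vM (state_linear nomega)).
move=> p Mp pp op; apply: smax => //.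
by apply: me_comp_null => //; exact: projection_ge0.
Qed.

(** On vectors [b j xi] the double sum is the form at [xi] of a single operator, which by the module
    property is [E] applied to the sum of the [adj (b i) \o (X i j \o b j)], a positive element of
    [M]. *)
Lemma me_completely_positive : completely_positive dot M E.
Proof.
move=> n X MX X0 u.
under eq_bigr => i _ do under eq_bigr => j _ do rewrite mxE.
apply: (cyclic_positive vD (a := fun i j => E (X i j))) => [i j|b xi Db].
  exact: me_D.
have bb i := vn_bdd vD (Db i).
pose T i j := adj (b i) \o (X i j \o b j).
have Da i : D (adj (b i)) by exact: (vn_adj vD).
have MXb i j : M (X i j \o b j) by apply: (vn_comp vM) => //; exact: subDM.
have MT i j : M (T i j) by apply: (vn_comp vM) => //; exact: subDM.
have ET i j : E (T i j) = adj (b i) \o (E (X i j) \o b j).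
  by rewrite (me_modl ME)// (me_modr ME).
have [MS ES] := me_sum (index_enum _) (fun i => (me_sum (index_enum _) (MT i)).1).
have : op_ge0 dot (\sum_i \sum_j T i j).
  move=> v; rewrite fct_sumE dot_suml.
  under eq_bigr => i _.
    rewrite fct_sumE dot_suml.
    under eq_bigr => j _ do rewrite -[X in << X, _ >>]/(adj (b i) (X i j (b j v))) dot_adjl//.
    over.
  exact: (X0 (fun i => b i v)).
move=> /(me_ge0 MS)/(_ xi).
rewrite ES fct_sumE dot_suml; congr (0 <= _).
apply: eq_bigr => i _; rewrite (me_sum (index_enum _) (MT i)).2 fct_sumE dot_suml.
apply: eq_bigr => j _; rewrite ET.
by rewrite -[X in << X, _ >>]/(adj (b i) (E (X i j) (b j xi))) dot_adjl.
Qed.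

Lemma me_comp_idem : omega \o E = omega \o E \o E.
Proof.
apply/funext => x /=; have [Mx|nMx] := pselect (M x); first by rewrite (me_idem ME).
by rewrite (me_dom ME nMx) me_0.
Qed.

(** Every module expectation is recovered from its state [omega \o E] through [expected]; with
    [expected_unique] this gives injectivity. *)
Lemma me_expected x : M x -> expected (omega \o E) x (E x).
Proof.
move=> Mx; split; first exact: me_D.
  by apply/funext => u; exact: me_zr.
by move=> d Dd /=; rewrite (me_modl ME).
Qed.

End GivenExpectation.

(** * Bijectivity of the correspondence *)

Lemma expectation_inj E1 E2 : module_expectation dot M D z E1 ->
  module_expectation dot M D z E2 -> omega \o E1 = omega \o E2 -> E1 = E2.
Proof.
move=> ME1 ME2 E12; apply/funext => x; have [Mx|nMx] := pselect (M x); last first.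
  by rewrite (me_dom ME1 nMx) (me_dom ME2 nMx).
have [_ sr rD cr] := me_extension ME1.
apply: (expected_unique sr rD cr (x := x)); first exact: me_expected.
by rewrite E12; exact: me_expected.
Qed.

Lemma expectation_surj rho : centralizing_extension dot M D omega rho ->
  exists2 E, module_expectation dot M D z E & omega \o E = rho.
Proof.
move=> [ro sr rD cr]; have [E [Eoff Eexp]] := expectation_exists sr rD cr.
exists E; first exact: constructed_expectation Eexp.
apply/funext => x /=; have [Mx|nMx] := pselect (M x).
  by rewrite -(rhoE sr rD cr Eoff Eexp).
by rewrite Eoff// ro// (lin0 vM (state_linear nomega)).
Qed.

End Support.

End OperatorAlgebras.

Unset Implicit Arguments.

Theorem corollary3p14 (R : realType) (H : completeNormedModType (Cplx R))
    (dot : {dot H for Num.conj}) (dotE : forall u : H, dot u u = `|u| ^+ 2)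
    (M D : set (H -> H))
    (vnaM : von_neumann_algebra dot M) (vnaD : von_neumann_algebra dot D)
    (subDM : D `<=` M)
    (omega : (H -> H) -> Cplx R) (omega_state : normal_state dot M omega)
    (omega_centralizer : in_centralizer D M omega)
    (z : H -> H) (z_support : is_support dot D omega z) :
  exists Phi : ((H -> H) -> (H -> H)) -> ((H -> H) -> Cplx R),
    set_bij [set E | module_expectation dot M D z E]
            [set rho | centralizing_extension dot M D omega rho] Phi /\
    forall E, module_expectation dot M D z E ->
      [/\ exists2 s, is_support dot M E s & is_support dot M (Phi E) s,
          Phi E = Phi E \o E,
          Phi E = omega \o E &
          completely_positive dot M E].
Proof.
exists (fun E => omega \o E); split; last first.
  move=> E ME; split=> //.
  - exact (me_supports dotE vnaM vnaD subDM omega_state omega_centralizer z_support ME).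
  - exact (me_comp_idem dotE vnaM vnaD subDM omega_state omega_centralizer z_support ME).
  - exact (me_completely_positive dotE vnaM vnaD subDM omega_state omega_centralizer
      z_support ME).
split.
- move=> E ME.
  exact (me_extension dotE vnaM vnaD subDM omega_state omega_centralizer z_support ME).
- move=> E1 E2; rewrite !inE => ME1 ME2.
  exact (expectation_inj dotE vnaM vnaD subDM omega_state omega_centralizer z_support ME1 ME2).
- move=> rho crho.
  exact (expectation_surj dotE vnaM vnaD subDM omega_state omega_centralizer z_support crho).
Qed.
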